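(* Let $X$ be a process satisfying general self-similarity on a connected locally compact separable metric space $E$, and let $((f_y,c_y),\ y \in E)$ be a family of good invariance components for $X$, relatively to some reference point $y_0$. Assume that either Assumption 1 or Assumption 2 is satisfied for $E$ and that $Sym(X_{y_0})$ is discrete. Define an internal composition law $\star$ on $E$ by $y \star x := f_y(x)$. Then: (i) $(E,\star)$ is a topological group with neutral element $y_0$; (ii) $y \mapsto c_y$ is a continuous group homomorphism from $(E,\star)$ to $(\mathbb{R}_+^*,\times)$; (iii) there is a Lévy process $L$ (starting from $y_0$) on $(E,\star)$ such that, if we define $\varphi(t) := \int_0^t \frac{1}{c_{L(s)}}\, ds$ for all $t \in [0,+\infty]$, then $\zeta(X_{y_0}) = \varphi(+\infty)$ and $$\forall\, 0 \leq t < \varphi(+\infty),\quad X_{y_0}(t) = L(\varphi^{-1}(t)).$$ Let $\xi(\cdot) := \log(1/c_{L(\cdot)})$; then $\xi$ is a real Lévy process and $\zeta(X_{y_0}) = \int_0^{+\infty} e^{\xi(s)}\, ds$. If moreover, for some $k \geq 1$, $E$ is a $\mathcal{C}^k$-differentiable manifold and $((f_y,c_y),\ y \in E)$ are $\mathcal{C}^k$ good invariance components, then $(E,\star)$ is a $\mathcal{C}^k$-Lie group and $y \mapsto c_y$ is a $\mathcal{C}^k$-Lie group homomorphism.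
   Context: Processes and life-time. Let $E$ be a locally compact separable metric space. A strongly Markovian càdlàg process $X$ on $E$ is given through the processes $X_y$ ($y\in E$), $X_y$ being $X$ started from $y$; $P_y$ is the law of $X_y$. The process $X_y$ may have a finite life-time $\zeta(X_y)\in(0,+\infty]$, namely the time at which every compact subset of $E$ containing $y$ has been left by $X_y$ (the limit of the first exit times from an increasing sequence of compact sets such that every compact subset of $E$ is contained in one of them). If $\mathbb{P}(\zeta(X_y)<+\infty)>0$ one adds a cemetery point $\Delta$ to $E$, whose neighborhoods are the sets $K^c\cup\{\Delta\}$, $K\subset E$ compact, and puts $X_y(t)=\Delta$ for $t\ge \zeta(X_y)$. There is no instantaneous killing: $\Delta$ is absorbing and can only be reached continuously. A homeomorphism $f$ of $E$ is extended to $E\cup\{\Delta\}$ by $f(\Delta)=\Delta$. General self-similarity. $X$ satisfies general self-similarity on $E$ if for some point $y_0\in E$, $$\forall y\in E,\ (X_y(t),\ t\ge 0)\overset{\mathcal L}{=}(f_y(X_{y_0}(c_y t)),\ t\ge 0),$$ where $(f_y,\ y\in E)$ is a family of homeomorphisms of $E$ such that $(y,x)\mapsto f_y(x)$ and $(y,x)\mapsto f_y^{-1}(x)$ are continuous from $E\times E$ to $E$, and $(c_y,\ y\in E)$ is a family of positive constants with $y\mapsto c_y$ continuous. Then $((f_y,c_y),\ y\in E)$ is called a family of invariance components for $X$ relatively to the reference point $y_0$. $\mathcal{C}^k$ and good invariance components. If $E$ is a $\mathcal{C}^k$-differentiable manifold, invariance components are called $\mathcal{C}^k$ if $(y,x)\mapsto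 f_y(x)$, $(y,x)\mapsto f_y^{-1}(x)$ and $y\mapsto c_y$ are of class $\mathcal{C}^k$. Invariance components $((f_y,c_y),\ y\in E)$ relatively to $y_0$ are called good if $f_{y_0}=id_E$, $c_{y_0}=1$, and $c_{f_y(z)}=c_y\times c_z$ for all $y,z\in E$. Support, symmetries and assumptions. $Supp(X_y):=\overline{\bigcup_{t\ge0}Supp(X_y(t))}=\{z\in E:\ \forall\epsilon>0,\ \exists t\ge0,\ \mathbb{P}(X_y(t)\in B(z,\epsilon))>0\}$. Assumption 1: $E=Supp(X_{y_0})$. Assumption 2: there exists $y\in E$ such that $y$ belongs to the interior of $Supp(X_y)$. $Sym(X_y):=\{h\in Hom(E):\ X_y\overset{\mathcal L}{=}h(X_y)\}$, where $Hom(E)$ is the group of homeomorphisms of $E$; it is regarded as a subset of $\mathcal{C}^0(E,E)$ with the topology of uniform convergence on compact sets, and ''discrete'' refers to this topology. Lévy processes on groups. A Lévy process $L$ on a topological group $(E,\star)$ means a left Lévy process: a càdlàg process starting from the neutral element such that for every $t\ge0$ the process $(L(t))^{-1}\star L(t+\cdot)$ is independent of the past of $L$ up to time $t$ and has the same law as $L$. A $\mathcal{C}^k$-Lie group is a group on a $\mathcal{C}^k$-manifold whose multiplication and inversion are $\mathcal{C}^k$. $\mathbb{R}_+^*=]0,+\infty[$. $\varphi^{-1}$ is the inverse of the increasing bijection $\varphi:[0,+\infty[\to[0,\varphi(+\infty)[$. *)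

(* Defs.v *)
From HB Require Import structures.
From mathcomp Require Import all_boot all_order all_algebra.
From mathcomp Require Import all_classical all_reals all_analysis.

Set Implicit Arguments.
Unset Strict Implicit.
Unset Printing Implicit Defensive.

Import Order.TTheory GRing.Theory Num.Theory.
Import numFieldNormedType.Exports.
Local Open Scope classical_set_scope.
Local Open Scope ring_scope.

(** * Processes

    A process indexed by [0, +oo[ is a function [X : R -> Om -> S]; its
    values at negative times are junk and are never looked at. *)

Definition cadlag (R : realType) (S : topologicalType) (x : R -> S) : Prop :=
  (forall t : R, 0 <= t -> x @ t^'+ --> x t) /\
  (forall t : R, 0 < t -> exists l : S, x @ t^'- --> l).

(** The sigma-algebra generated by the coordinates at nonnegative times; the law
    of a process is its distribution on this sigma-algebra. *)
Definition path_sets (R : realType) (S : topologicalType) : set (set (R -> S)) :=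
  <<s [set D | exists t U, [/\ 0 <= t, open U & D = [set x | U (x t)]] ]>>.

Definition process_measurable (R : realType) (d : measure_display)
    (Om : measurableType d) (S : topologicalType) (X : R -> Om -> S) : Prop :=
  forall t U, 0 <= t -> open U -> measurable (X t @^-1` U).

Definition natural_filtration (R : realType) (Om : Type) (S : topologicalType)
    (X : R -> Om -> S) (t : R) : set (set Om) :=
  <<s [set B | exists s U, [/\ 0 <= s <= t, open U & B = X s @^-1` U] ]>>.

Definition eq_law (R : realType) (d1 d2 : measure_display)
    (Om1 : measurableType d1) (Om2 : measurableType d2)
    (P1 : probability Om1 R) (P2 : probability Om2 R) (S : topologicalType)
    (X1 : R -> Om1 -> S) (X2 : R -> Om2 -> S) : Prop :=
  forall D, path_sets D ->
    P1 [set w | D (X1 ^~ w)] = P2 [set w | D (X2 ^~ w)].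

Definition stopping_time (R : realType) (Om : Type) (S : topologicalType)
    (X : R -> Om -> S) (T : Om -> \bar R) : Prop :=
  (forall w, (0 <= T w)%E) /\
  (forall t, 0 <= t -> natural_filtration X t [set w | (T w <= t%:E)%E]).

Definition stopped_sets (R : realType) (Om : Type) (S : topologicalType)
    (X : R -> Om -> S) (T : Om -> \bar R) : set (set Om) :=
  [set A | forall t, 0 <= t ->
     natural_filtration X t (A `&` [set w | (T w <= t%:E)%E])].

(** * Processes with a life-time

    The cemetery point [Delta] is the point [None] of the one-point
    compactification of [E].  It is always added; a process that never dies
    does not visit it.  If [E] is compact then [None] is isolated. *)

Definition exit_time (R : realType) (E : topologicalType)
    (x : R -> one_point_compactification E) (K : set E) : \bar R :=
  ereal_inf [set t%:E | t in [set t | 0 <= t /\ ~ (Some @` K) (x t)]].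

(** The exit times increase with [K], so that the supremum below is the limit
    along any exhaustion of [E] by compact sets. *)
Definition lifetime (R : realType) (E : topologicalType) (y : E)
    (x : R -> one_point_compactification E) : \bar R :=
  ereal_sup [set exit_time x K | K in [set K | compact K /\ K y]].

(** That [x] lives in [E], with left limits in [E], before its life-time is a
    consequence of the definition of the life-time: on each [0, t] with
    [t < lifetime y x] the path stays in a compact subset of [E]. The last
    clause is the absence of instantaneous killing. *)
Definition path_from (R : realType) (E : topologicalType) (y : E)
    (x : R -> one_point_compactification E) : Prop :=
  [/\ x 0 = Some y,
      cadlag x,
      forall t, 0 <= t -> (lifetime y x <= t%:E)%E -> x t = None &
      forall t, lifetime y x = t%:E -> x @ t^'- --> (None : one_point_compactification E)].

Definition extend (E : Type) (h : E -> E) :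
    one_point_compactification E -> one_point_compactification E := omap h.

(** The law of the process started from a point of [E] or from the (absorbing)
    cemetery. *)
Definition law_from (R : realType) (E : topologicalType)
    (d : E -> measure_display) (Om : forall y, measurableType (d y))
    (P : forall y, probability (Om y) R)
    (X : forall y, R -> Om y -> one_point_compactification E)
    (z : one_point_compactification E)
    (D : set (R -> one_point_compactification E)) : \bar R :=
  match z with
  | Some y => P y [set w | D (X y ^~ w)]
  | None => (\1_D (cst None))%:E
  end.

(** [X y], defined on the probability space [(Om y, P y)], is the process
    started from [y].  The third clause is the Borel measurability of
    [y |-> P_y(D)]; the last one is the strong Markov property with respect to
    the natural filtration of [X y], the integrand being the law of the process
    started from [X y T], evaluated at [D]. *)
Definition strong_markov_process (R : realType) (E : topologicalType)
    (d : E -> measure_display) (Om : forall y, measurableType (d y))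
    (P : forall y, probability (Om y) R)
    (X : forall y, R -> Om y -> one_point_compactification E) : Prop :=
  [/\ forall y, process_measurable (X y),
      forall y w, path_from y (X y ^~ w),
      forall D, path_sets D ->
        forall r : R, <<s @open E >> [set y |
          (law_from P X (Some y : one_point_compactification E) D < r%:E)%E] &
      forall y (T : Om y -> \bar R), stopping_time (X y) T ->
      forall A, stopped_sets (X y) T A ->
      forall D, path_sets D ->
        P y (A `&` [set w | (T w < +oo)%E /\
                            D (fun t => X y (fine (T w) + t) w)]) =
        (\int[P y]_(w in A `&` [set w | T w < +oo])
            law_from P X (X y (fine (T w)) w) D)%E].

(** * General self-similarity *)

(** [finv y] is the inverse of [f y]; each [f y] is then a homeomorphism. *)
Definition invariance_components (R : realType) (E : topologicalType)
    (d : E -> measure_display) (Om : forall y, measurableType (d y))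
    (P : forall y, probability (Om y) R)
    (X : forall y, R -> Om y -> one_point_compactification E)
    (y0 : E) (f finv : E -> E -> E) (c : E -> R) : Prop :=
  [/\ forall y, cancel (f y) (finv y) /\ cancel (finv y) (f y),
      continuous (fun p : E * E => f p.1 p.2) /\
      continuous (fun p : E * E => finv p.1 p.2),
      forall y, 0 < c y,
      continuous c &
      forall y, eq_law (P y) (P y0) (X y)
                  (fun t w => extend (f y) (X y0 (c y * t) w))].

Definition good_components (R : realType) (E : Type)
    (y0 : E) (f : E -> E -> E) (c : E -> R) : Prop :=
  [/\ f y0 = id, c y0 = 1 & forall y z, c (f y z) = c y * c z].

Definition supp (R : realType) (E : metricType R) (d : measure_display)
    (Om : measurableType d) (P : probability Om R)
    (X : R -> Om -> one_point_compactification E) : set E :=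
  [set z | forall e : R, 0 < e ->
     exists2 t, 0 <= t & (0 < P [set w | (Some @` ball z e) (X t w)])%E].

Definition homeomorphism (E : topologicalType) (h : E -> E) : Prop :=
  exists g, [/\ continuous h, continuous g, cancel h g & cancel g h].

Definition sym (R : realType) (E : metricType R) (d : measure_display)
    (Om : measurableType d) (P : probability Om R)
    (X : R -> Om -> one_point_compactification E) :
    set {family compact, E -> E} :=
  [set h | homeomorphism (h : E -> E) /\
           eq_law P P X (fun t w => extend h (X t w))].

Definition discrete_set (T : topologicalType) (A : set T) : Prop :=
  A `<=` isolated A.

(** * Groups and Levy processes *)

Definition is_group (T : Type) (mul : T -> T -> T) (inv : T -> T) (e : T) :=
  [/\ associative mul, left_id e mul, right_id e mul,
      left_inverse e inv mul & right_inverse e inv mul].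

Definition topological_group (T : topologicalType) (mul : T -> T -> T)
    (inv : T -> T) (e : T) : Prop :=
  [/\ is_group mul inv e, continuous (fun p : T * T => mul p.1 p.2) &
      continuous inv].

Definition levy_process (R : realType) (d : measure_display)
    (Om : measurableType d) (P : probability Om R) (T : topologicalType)
    (mul : T -> T -> T) (inv : T -> T) (e : T) (L : R -> Om -> T) : Prop :=
  [/\ process_measurable L,
      forall w, L 0 w = e,
      forall w, cadlag (L ^~ w) &
      forall t, 0 <= t ->
        let increments := fun s w => mul (inv (L t w)) (L (t + s) w) in
        eq_law P P increments L /\
        forall D B, path_sets D -> natural_filtration L t B ->
          P ([set w | D (increments ^~ w)] `&` B) =
          (P [set w | D (increments ^~ w)] * P B)%E].

Definition phi (R : realType) (E : Type) (c : E -> R) (l : R -> E)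
    (t : \bar R) : \bar R :=
  (\int[lebesgue_measure]_(s in [set s : R | (0 <= s)%R /\ s%:E <= t])
     ((c (l s))^-1)%:E)%E.

(** For a cadlag [l] and a continuous positive [c], [phi c l] is a bijection
    from [0, +oo[ onto [0, phi c l +oo[, and [phi_inv c l] is its inverse
    on the latter interval; elsewhere it is junk. *)
Definition phi_inv (R : realType) (E : Type) (c : E -> R) (l : R -> E)
    (t : R) : R :=
  'pinv_(fun=> 0) [set s : R | 0 <= s] (fun s => phi c l s%:E) t%:E.

(** * Manifolds of class C^k, 1 <= k < oo *)

(** Meant for [U] open and [V], [W] of finite dimension, where the differential
    is of class C^k if and only if its value at each vector [v] is. *)
Fixpoint Ck_on (R : realType) (V W : normedModType R) (k : nat) (U : set V)
    (f : V -> W) : Prop :=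
  match k with
  | 0%N => forall x, U x -> {for x, continuous f}
  | k'.+1 => (forall x, U x -> differentiable f x) /\
             (forall v, Ck_on k' U (fun x => 'd f x v))
  end.

(** A chart [coord] of [T] in [V] with domain [dom] and inverse [param]; the
    values of [coord] outside [dom] and of [param] outside [coord @` dom] are
    junk. *)
Record chart (T V : Type) := Chart {
  dom : set T;
  coord : T -> V;
  param : V -> T
}.

Definition chart_valid (R : realType) (T : topologicalType)
    (V : normedModType R) (a : chart T V) : Prop :=
  [/\ open (dom a), open (coord a @` dom a),
      forall x, dom a x -> param a (coord a x) = x,
      forall x, dom a x -> {for x, continuous (coord a)} &
      forall v, (coord a @` dom a) v -> {for v, continuous (param a)}].

Definition Ck_atlas (R : realType) (T : topologicalType) (V : normedModType R)
    (k : nat) (A : set (chart T V)) : Prop :=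
  [/\ forall a, A a -> chart_valid a,
      forall x, exists2 a, A a & dom a x &
      forall a b, A a -> A b ->
        Ck_on k (coord a @` (dom a `&` dom b)) (coord b \o param a)].

Definition prod_chart (T V T' V' : Type) (a : chart T V) (b : chart T' V') :
    chart (T * T') (V * V') :=
  Chart (dom a `*` dom b) (fun p => (coord a p.1, coord b p.2))
        (fun p => (param a p.1, param b p.2)).

Definition prod_atlas (T V T' V' : Type) (A : set (chart T V))
    (B : set (chart T' V')) : set (chart (T * T') (V * V')) :=
  [set ab | exists a b, [/\ A a, B b & ab = prod_chart a b]].

Definition real_atlas (R : realType) : set (chart R R) :=
  [set Chart setT id id].

Definition Ck_map (R : realType) (T T' : topologicalType)
    (V V' : normedModType R) (k : nat) (A : set (chart T V))
    (B : set (chart T' V')) (F : T -> T') : Prop :=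
  continuous F /\
  forall a b, A a -> B b ->
    Ck_on k (coord a @` (dom a `&` F @^-1` dom b)) (coord b \o F \o param a).

Definition Ck_components (R : realType) (E : topologicalType)
    (V : normedModType R) (k : nat) (A : set (chart E V))
    (f finv : E -> E -> E) (c : E -> R) : Prop :=
  [/\ Ck_map k (prod_atlas A A) A (fun p : E * E => f p.1 p.2),
      Ck_map k (prod_atlas A A) A (fun p : E * E => finv p.1 p.2) &
      Ck_map k A (@real_atlas R) c].

Definition Ck_lie_group (R : realType) (E : topologicalType)
    (V : normedModType R) (k : nat) (A : set (chart E V))
    (mul : E -> E -> E) (inv : E -> E) (e : E) : Prop :=
  [/\ is_group mul inv e,
      Ck_atlas k A,
      Ck_map k (prod_atlas A A) A (fun p : E * E => mul p.1 p.2) &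
      Ck_map k A A inv].

(* Main.v *)
Require Import Defs.
From HB Require Import structures.
From mathcomp Require Import all_boot all_order all_algebra.
From mathcomp Require Import all_classical all_reals all_analysis.
From mathcomp Require Import measurable_realfun ring lra.
Set Implicit Arguments.
Unset Strict Implicit.
Unset Printing Implicit Defensive.
Import Order.TTheory GRing.Theory Num.Theory.
Import numFieldNormedType.Exports.
Local Open Scope classical_set_scope.
Local Open Scope ring_scope.

(** Let [A u] be the integral over [0, u] of [c (X y0 s)] and let [L] be [X y0] run
    with the inverse of the clock [A]. Self-similarity makes the clock compatible
    with the action of [f], so that the strong Markov property at the inverse of
    [A] shows that [finv (L t) (L (t + .))], as long as [L t] is alive, is
    independent of the past and distributed as [L].

    [L] does not die: in a time interval of length [s], an increment that dies has
    to leave every compact neighbourhood [K] of [y0] before. By the above, the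
    probability to leave [K] and die before [s] is at most the product of the two
    probabilities; summing over the intervals [k * s, k.+1 * s[, during only one
    of which [L] dies, the probability that [L] ever dies is at most that of
    leaving [K] before [s], which tends to [0] with [s].

    For associativity, the Markov property seen from [y] and from [y0] gives
    [f (f y z) = f y \o f z] up to a symmetry of [X y0], for [z] in a dense subset
    of the support of [X y0]. That support is a neighbourhood of [y0], the symmetry
    depends continuously on [z], is the identity at [y0], and symmetries are
    isolated: equality holds for [z] near [y0], then everywhere by connectedness.

    Finally [phi] is the inverse of [A]: both [phi] and the inverse of [A] are
    locally Lipschitz and have [1 / c (L t)] as right derivative at [t]. *)

(** No filtration is completed: the strong Markov property is given for the raw natural filtration
    of [X y0], so the time at which the clock reaches a level must be a stopping time on the nose.
    Hence the results on progressive measurability, which rest on right-continuity, and a clock that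
    stops at death. Null sets are the second obstacle. Two conditional laws agree only almost surely
    and event by event, so laws are compared on countably many events that determine them. A path
    that dies cannot be a path of a Levy process in [E], but at time [t] it is not known whether it
    will die; independence is therefore proved for the killed process in the compactification and
    carried over to [levy] outside a null set. The killed process has increments
    [finv (L t) (L (t + s))], which make sense before associativity is known; associativity then
    turns them into left increments of a group with inverse [finv y y0]. *)

Local Notation opc := one_point_compactification.

(** * One-sided limits and cadlag paths *)

Section one_sided.
Context {R : realType}.
Implicit Types (t : R) (P : R -> Prop).

Lemma near_at_rightE t P :
  (\forall s \near t^'+, P s) <->
  exists2 e, 0 < e & forall s, t < s -> s < t + e -> P s.
Proof.
split=> [/nbhs_right0P [e /= e0 H]|[e e0 H]].
  exists e => // s ts se; rewrite -(subrKC t s); apply: H; last by rewrite subr_gt0.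
  by rewrite /= sub0r normrN gtr0_norm ?subr_gt0// ltrBlDl.
apply/nbhs_right0P; exists e => //= s; rewrite /= sub0r normrN => se s0.
by apply: H; rewrite ?ltrDl// ltrD2l -(gtr0_norm s0).
Qed.

Lemma near_at_leftE t P :
  (\forall s \near t^'-, P s) <->
  exists2 e, 0 < e & forall s, t - e < s -> s < t -> P s.
Proof.
split=> [/nbhs_left0P [e /= e0 H]|[e e0 H]].
  exists e => // s ts se.
  rewrite (_ : s = t - (t - s)); last by rewrite opprB addrC subrK.
  apply: H; last by rewrite subr_gt0.
  by rewrite /= sub0r normrN gtr0_norm ?subr_gt0// ltrBlDl -ltrBlDr.
apply/nbhs_left0P; exists e => //= s; rewrite /= sub0r normrN => se s0.
by apply: H; rewrite ?gtrBl// ltrD2l ltrN2 -(gtr0_norm s0).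
Qed.

Lemma cadlag_right (S : topologicalType) (x : R -> S) t U :
  cadlag x -> 0 <= t -> nbhs (x t) U ->
  exists2 e, 0 < e & forall s, t <= s -> s < t + e -> U (x s).
Proof.
move=> [xr _] t0 xU; have := xr _ t0 _ xU.
rewrite nbhs_simpl => /near_at_rightE[e e0 H]; exists e => // s.
rewrite le_eqVlt => /predU1P[<- _|]; last exact: H.
exact: nbhs_singleton.
Qed.

Lemma cadlag_comp (S S' : topologicalType) (F : S -> S') (x : R -> S) :
  continuous F -> cadlag x -> cadlag (F \o x).
Proof.
move=> cF [xr xl]; split=> [t t0|t t0].
  by apply: (cvg_comp x F (xr _ t0)); exact: cF.
have [l xl'] := xl _ t0.
by exists (F l); apply: (cvg_comp x F xl'); exact: cF.
Qed.

Lemma cvg_left_affine (S : topologicalType) (x : R -> S) (a k t : R) (l : S) :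
  0 < k -> x @ (a + k * t)^'- --> l ->
  (fun s => x (a + k * s)) @ t^'- --> l.
Proof.
move=> k0 xl U /xl; rewrite !nbhs_simpl => /near_at_leftE[e e0 H].
apply/near_at_leftE; exists (e / k); first by rewrite divr_gt0.
move=> s ts st; apply: H; last by rewrite ltrD2l ltr_pM2l.
rewrite -addrA ltrD2l -(@ltr_pM2l _ k^-1) ?invr_gt0// mulKf ?gt_eqF//.
by rewrite mulrBr mulKf ?gt_eqF// mulrC.
Qed.

Lemma cadlag_affine (S : topologicalType) (x : R -> S) (a k : R) :
  0 <= a -> 0 < k -> cadlag x -> cadlag (fun t => x (a + k * t)).
Proof.
move=> a0 k0 cx; have [_ xl] := cx; split=> t t0.
  move=> U xU; rewrite nbhs_simpl; apply/near_at_rightE.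
  have [|e e0 H] := @cadlag_right S x (a + k * t) U cx _ xU.
    by rewrite addr_ge0// mulr_ge0// ltW.
  exists (e / k); first by rewrite divr_gt0.
  move=> s ts st; apply: H; first by rewrite lerD2l ler_pM2l// ltW.
  rewrite -addrA ltrD2l -(@ltr_pM2l _ k^-1) ?invr_gt0// mulKf ?gt_eqF//.
  by rewrite mulrDr mulKf ?gt_eqF// (mulrC _ e).
have [|l ?] := xl (a + k * t); first by rewrite ltr_wpDl// mulr_gt0.
by exists l; exact: cvg_left_affine.
Qed.

End one_sided.

(** * Paths in the one-point compactification *)

Section paths.
Context {R : realType} {E : metricType R}.
Implicit Types (x : R -> opc E) (y : E) (K U : set E) (z : opc E).

Lemma compact_closed_metric K : compact K -> closed K.
Proof. exact: (compact_closed (@metric_hausdorff R E)). Qed.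

Lemma open_SomeC K : compact K -> open (~` (Some @` K) : set (opc E)).
Proof.
move=> cK; rewrite openE => -[y|] ny /=.
  rewrite /interior /nbhs/=; rewrite nbhs_simpl.
  have : open (~` K) by apply: closed_openC; exact: compact_closed_metric cK.
  rewrite openE => /(_ y) Cy; apply: filterS (Cy _).
    by move=> u nu [v Kv [vu]]; apply: nu; rewrite -vu.
  by move=> Ky; apply: ny; exists y.
exists K; first by split => //; exact: compact_closed_metric.
by move=> u [[v nv <-]|->] [w Kw] // [wv]; apply: nv; rewrite -wv.
Qed.

Lemma open_Some U : open U -> open (Some @` U : set (opc E)).
Proof. exact: one_point_compactification_open_some. Qed.

Lemma open_preSome (U : set (opc E)) : open U -> open [set y | U (Some y)].
Proof.
by move=> oU; apply: open_comp oU => ? _; exact: one_point_compactification_some_continuous.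
Qed.

Lemma compact_image (h : E -> E) K : continuous h -> compact K -> compact (h @` K).
Proof. by move=> ch cK; apply: continuous_compact => //; exact: continuous_subspaceT. Qed.

Lemma extend_continuous (h : E -> E) : homeomorphism h -> continuous (extend h).
Proof.
move=> [g [ch cg hK gK]] [y|] U.
  rewrite /nbhs /= !nbhs_simpl => Uy.
  exact: (ch y (fun v => U (Some v))).
move=> [K [cK _] KU]; rewrite nbhs_simpl; exists (g @` K).
  split; last apply: compact_closed_metric; exact: compact_image.
move=> u [[v nv <-]|->]; apply: KU; last by right.
by left; exists (h v) => // Khv; apply: nv; exists (h v) => //; rewrite hK.
Qed.

Lemma extend_comp (h g : E -> E) z : extend h (extend g z) = extend (h \o g) z.
Proof. by case: z. Qed.

Lemma extendK (h g : E -> E) : cancel h g -> cancel (extend h) (extend g).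
Proof. by move=> hK [z|//]; rewrite /= hK. Qed.

(** What [path_from] says without naming the starting point and the life-time:
    in this form it passes to shifted, rescaled and time-changed paths. *)
Definition good_path x :=
  [/\ cadlag x,
      forall s t, 0 <= s -> s <= t -> x s = None -> x t = None,
      forall t, 0 <= t -> x t <> None ->
        exists2 K, compact K & forall s, 0 <= s -> s <= t -> (Some @` K) (x s) &
      forall t, 0 < t -> x t = None -> (forall s, 0 <= s -> s < t -> x s <> None) ->
        x @ t^'- --> (None : opc E)].

(** Before the life-time some compact set has not been left yet, so the path is in [E]; from the
    life-time on, the third clause of [path_from] forces [None]. *)
Lemma path_from_aliveP y x t : path_from y x -> 0 <= t ->
  x t <> None <-> (t%:E < lifetime y x)%E.
Proof.
move=> [x0 _ xz _] t0; split=> [xt|].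
  by rewrite ltNge; apply/negP => /(xz _ t0).
move=> /ereal_sup_gt[_ [K [cK Ky] <-]] tK xt.
suff : (exit_time x K <= t%:E)%E by rewrite leNgt tK.
by apply: ereal_inf_lbound; exists t => //; split=> // -[v _]; rewrite xt.
Qed.

Lemma path_from_good y x : path_from y x -> good_path x.
Proof.
move=> xP; have [x0 cx xz xk] := xP.
have alive t : 0 <= t -> x t <> None ->
    exists2 K, compact K & forall s, 0 <= s -> s <= t -> (Some @` K) (x s).
  move=> t0 /(path_from_aliveP xP t0) /ereal_sup_gt[_ [K [cK Ky] <-]] tK.
  exists K => // s s0 st; apply: contrapT => nK.
  suff : (exit_time x K <= t%:E)%E by rewrite leNgt tK.
  by apply: ge_ereal_inf; exists s%:E; rewrite ?lee_fin//; exists s.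
split=> //.
  move=> s t s0 st xs; apply: contrapT => xt.
  have [K _ /(_ s s0 st)] := alive t (le_trans s0 st) xt.
  by rewrite xs => -[].
(* The first time at [None] is the life-time: were the life-time smaller, the path would already be
   dead at it. *)
move=> t t0 xt xlt; apply: xk; apply/eqP; rewrite eq_le; apply/andP; split.
  by rewrite leNgt; apply/negP => /(path_from_aliveP xP (ltW t0)).
rewrite leNgt; apply/negP => zt.
have z0 : (0 <= lifetime y x)%E.
  apply/ltW/(@path_from_aliveP y x 0) => //; by rewrite x0.
have zfin : lifetime y x \is a fin_num.
  by rewrite ge0_fin_numE// (lt_trans zt)// ltry.
rewrite -(fineK zfin) in zt z0.
apply: (xlt _ z0 zt); apply: xz; first exact: z0.
by rewrite fineK.
Qed.

Lemma good_path_affine x (a k : R) : good_path x -> 0 <= a -> 0 < k ->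
  good_path (fun t => x (a + k * t)).
Proof.
move=> [cx abs alive killed] a0 k0.
have ge0 t : 0 <= t -> 0 <= a + k * t by move=> t0; rewrite addr_ge0// mulr_ge0// ltW.
split.
- exact: cadlag_affine.
- move=> s t s0 st; apply: abs; first exact: ge0.
  by rewrite lerD2l ler_pM2l.
- move=> t t0 /alive[|K cK H]; first exact: ge0.
  exists K => // s s0 st; apply: H; first exact: ge0.
  by rewrite lerD2l ler_pM2l.
- move=> t t0 xt xlt; apply: cvg_left_affine => //.
  apply: killed => //; first by rewrite ltr_wpDl// mulr_gt0.
  move=> s s0 st xs.
  have xa : x a <> None by have := xlt 0 (lexx _) t0; rewrite mulr0 addr0.
  have as_ : a <= s by rewrite leNgt; apply/negP => /ltW sa; exact/xa/(abs s).
  apply: (xlt ((s - a) / k)).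
  + by rewrite divr_ge0 ?subr_ge0// ltW.
  + by rewrite ltr_pdivrMr// ltrBlDl mulrC.
  + by rewrite mulrC divfK ?gt_eqF// subrKC.
Qed.

Lemma good_path_extend x (h : E -> E) : good_path x -> homeomorphism h ->
  good_path (extend h \o x).
Proof.
move=> [cx abs alive killed] hh; have ch := extend_continuous hh.
have eN z : extend h z = None -> z = None by case: z.
split.
- exact: cadlag_comp.
- by move=> s t s0 st /= /eN xs; rewrite (abs _ _ s0 st xs).
- move=> t t0 xt; have [|K cK H] := alive t t0; first by move=> xtN; apply: xt; rewrite /= xtN.
  exists (h @` K); first by apply: compact_image => //; have [g []] := hh.
  move=> s s0 st /=; have [v Kv <-] := H s s0 st.
  by exists (h v) => //; exists v.
- move=> t t0 /eN xt xlt; apply: (cvg_comp x (extend h)) (ch None).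
  apply: killed => // s s0 st xs.
  by apply: (xlt s s0 st); rewrite /= xs.
Qed.

Lemma good_path_None : good_path (cst None).
Proof.
split=> //; last by move=> *; exact: cvg_cst.
by split=> [t _|t _]; [exact: cvg_cst|exists None; exact: cvg_cst].
Qed.

End paths.

(** * Values of a path at random times *)

Section progressive.
Context {R : realType} {E : metricType R}.
Implicit Types (x : R -> opc E) (U : set E).

(** An inner approximation of [U] whose closure stays in [U], so that membership along a sequence
    passes to the limit; the interior makes it open. *)
Definition shrink U (n : nat) : set E := [set y | ball y n.+1%:R^-1 `<=` U]°.

Lemma open_shrink U n : open (shrink U n).
Proof. exact: open_interior. Qed.

Lemma shrink_cover U y : open U -> U y -> exists n, shrink U n y.
Proof.
rewrite openE => oU /oU /nbhs_ballP[e /= e0 yU].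
have e20 : 0 < e / 2 by rewrite divr_gt0.
have [n] := ltr_add_invr e20; rewrite add0r => ne.
exists n; apply/nbhs_ballP; exists (e / 2) => //.
move=> z yz w zw; apply: yU; rewrite (splitr e); apply: ball_triangle yz _.
exact: (le_ball (ltW ne)).
Qed.

Lemma closure_shrink U n : closure (shrink U n) `<=` U.
Proof.
move=> p /(_ (ball p n.+1%:R^-1)) [|q [/interior_subset Uq pq]].
  by apply: nbhsx_ballx; rewrite invr_gt0.
by apply: Uq; exact: ball_sym.
Qed.

(** The first multiple of [1/(n+1)] strictly after [s], capped at [u]: it approaches [s] from above
    through countably many values, and the cap keeps it within what is known at time [u]. *)
Definition round_up (u : R) (n : nat) (s : R) : R :=
  Num.min u ((Num.truncn (s * n.+1%:R)).+1%:R / n.+1%:R).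

Lemma round_up_ge u n s : 0 <= s -> s <= u -> s <= round_up u n s.
Proof.
move=> s0 su; rewrite le_min su/= ler_pdivlMr ?ltr0n// ltW//.
exact: truncnS_gt.
Qed.

Lemma round_up_lt u s e : 0 <= s -> 0 < e ->
  exists N, forall n, (N <= n)%N -> round_up u n s < s + e.
Proof.
move=> s0 e0; have [N] := ltr_add_invr e0; rewrite add0r => Ne.
exists N => n Nn; apply: (@le_lt_trans _ _ (s + n.+1%:R^-1)).
  rewrite ge_min; apply/orP; right; rewrite ler_pdivrMr ?ltr0n//.
  rewrite mulrDl mulVf ?pnatr_eq0// -natr1 lerD2r.
  by rewrite truncn_le mulr_ge0.
rewrite ltrD2l (le_lt_trans _ Ne)// lef_pV2 ?posrE ?ltr0n//.
by rewrite ler_nat.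
Qed.

(** Right-continuity puts the values just after [s] in one open [shrink U m]. Conversely the value
    at [s] is alive, since [None] is absorbing, and is a limit of points of [shrink U m], hence lies
    in [U]. *)
Lemma good_path_SomeE x u s U : good_path x -> 0 <= s -> s <= u -> open U ->
  (Some @` U) (x s) <->
  exists m N, forall n, (N <= n)%N -> (Some @` shrink U m) (x (round_up u n s)).
Proof.
move=> [cx abs _ _] s0 su oU; split=> [[y Uy yx]|[m [N H]]].
  have [m my] := shrink_cover oU Uy; exists m.
  have [e e0 He] : exists2 e, 0 < e & forall r, s <= r -> r < s + e ->
      (Some @` shrink U m) (x r).
    apply: (@cadlag_right _ _ x s _ cx) => //.
    rewrite -yx; apply: one_point_compactification_some_nbhs.
    by apply: open_nbhs_nbhs; split=> //; exact: open_shrink.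
  have [N HN] := round_up_lt u s0 e0; exists N => n Nn.
  by apply: He; [exact: round_up_ge|exact: HN].
case xs : (x s) => [y|]; last first.
  have [z _] := H _ (leqnn N).
  by rewrite (abs _ _ s0 (round_up_ge N s0 su) xs).
exists y => //; apply: (@closure_shrink _ m) => B yB.
have [e e0 He] : exists2 e, 0 < e & forall r, s <= r -> r < s + e ->
    (Some @` B) (x r).
  apply: (@cadlag_right _ _ x s _ cx) => //.
  by rewrite xs; exact: one_point_compactification_some_nbhs.
have [N' HN'] := round_up_lt u s0 e0.
have [z mz zx] := H _ (leq_maxl N N').
have [|w Bw] := He (round_up u (maxn N N') s) (round_up_ge _ s0 su).
  by apply: HN'; exact: leq_maxr.
by rewrite -zx => -[wz]; exists z; split=> //; rewrite -wz.
Qed.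

(** Only times up to [u] enter the hypotheses, so that [Z] may carry the sigma-algebra of the past
    at time [u]: this is the progressive measurability of right-continuous processes. *)
Lemma measurable_sampled d (Z : measurableType d) (x : Z -> R -> opc E)
    (sg : Z -> R) (u : R) :
  (forall z, good_path (x z)) -> measurable_fun setT sg ->
  (forall z, 0 <= sg z) -> (forall z, sg z <= u) ->
  (forall r U, 0 <= r -> r <= u -> open U -> measurable [set z | (Some @` U) (x z r)]) ->
  forall U, open U -> measurable [set z | (Some @` U) (x z (sg z))].
Proof.
move=> gx msg sg0 sgu mx U oU.
pose A m n := [set z | (Some @` shrink U m) (x z (round_up u n (sg z)))].
have -> : [set z | (Some @` U) (x z (sg z))] =
    \bigcup_m \bigcup_N \bigcap_(n in [set n | (N <= n)%N]) A m n.
  apply/seteqP; split=> z /=.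
    move=> /(good_path_SomeE (gx z) (sg0 z) (sgu z) oU)[m [N H]].
    by exists m => //; exists N.
  move=> [m _ [N _ H]]; apply/(good_path_SomeE (gx z) (sg0 z) (sgu z) oU).
  by exists m, N.
apply: bigcupT_measurable => m; apply: bigcupT_measurable => N.
apply: bigcap_measurable; first by exists N => /=.
move=> n _.
(* On [T k] the rounded time is constant, equal to [Num.min u (k.+1%:R / n.+1%:R)]. *)
pose T (k : nat) := [set z | sg z * n.+1%:R \in `[k%:R, k.+1%:R[].
have -> : A m n = \bigcup_k (T k `&` [set z | (Some @` shrink U m)
    (x z (Num.min u (k.+1%:R / n.+1%:R)))]).
  have sgn z : 0 <= sg z * n.+1%:R by rewrite mulr_ge0.
  apply/seteqP; split=> z.
    rewrite /A /round_up /= => H; exists (Num.truncn (sg z * n.+1%:R)) => //.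
    by split=> //=; rewrite /T/= in_itv/= truncn_itv.
  move=> [k _ []]; rewrite /T/= in_itv/= => /(truncn_def) + H.
  by rewrite /A /round_up /= => ->.
apply: bigcupT_measurable => k; apply: measurableI.
  have mM : measurable_fun setT (fun z => sg z * n.+1%:R).
    exact: measurable_funM.
  rewrite -[T k]setTI; exact: (mM measurableT `[k%:R, k.+1%:R[%classic).
apply: mx; last exact: open_shrink.
  by rewrite le_min (le_trans (sg0 point))//= divr_ge0.
by rewrite ge_min lexx.
Qed.

End progressive.

(** [k] times the image of Lebesgue measure under the inverse of the affine map's action on sets
    agrees with Lebesgue measure on half-open intervals, hence on all Borel sets. *)
Lemma integral_affine (R : realType) (g : R -> \bar R) (r k v : R) : 0 < k ->
  measurable_fun `[r, r + k * v] g -> (forall s, (0 <= g s)%E) ->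
  (\int[lebesgue_measure]_(s in `[r, (r + k * v)%R]) g s =
   k%:E * \int[lebesgue_measure]_(s in `[0%R, v]) g (r + k * s)%R)%E.
Proof.
move=> k0 mg g0.
pose h : measurableTypeR R -> measurableTypeR R := fun s => r + k * s.
have mh : measurable_fun setT h.
  by apply: measurable_funD => //; apply: measurable_funM.
have hE : `[0, v]%classic = h @^-1` `[r, r + k * v]%classic.
  apply/seteqP; split=> s /=; rewrite !in_itv/= /h lerDl lerD2l ler_pM2l// pmulr_rge0//.
pose m := pushforward lebesgue_measure h.
pose kk : {nonneg R} := NngNum (ltW k0).
rewrite hE -(ge0_integral_pushforward mh)//.
rewrite -[k]/(kk%:num) -ge0_integral_mscale//.
apply: eq_measure_integral => A mA _.
apply: (@lebesgue_measure_unique _ (mscale kk (pushforward lebesgue_measure h))) => //.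
move=> _ [[a b] _ <-].
have hab : h @^-1` `]a, b]%classic = `](a - r) / k, (b - r) / k]%classic.
  by apply/seteqP; split=> s /=; rewrite !in_itv/= /h ltr_pdivrMr// ler_pdivlMr//
    ltrBlDl lerBrDl (mulrC s).
rewrite -[RHS]/(k%:E * lebesgue_measure (h @^-1` `]a, b]%classic))%E hab.
rewrite !lebesgue_measure_itv/= !lte_fin ltr_pM2r ?invr_gt0// ltrD2r.
case: ifPn; last by rewrite mule0.
by rewrite -!EFinD -EFinM -mulrBl mulrC divfK ?gt_eqF// opprB addrA subrK.
Qed.

(** * The clock and the Lamperti time change *)

Section clock.
Context {R : realType} {E : metricType R}.
Variable c : E -> R.
Hypothesis c_cont : continuous c.
Hypothesis c_gt0 : forall y, 0 < c y.
Implicit Types (x : R -> opc E).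
Local Notation mu := (@lebesgue_measure R).

(** The value 0 at the cemetery stops the clock at death. *)
Definition rate (z : opc E) : R := if z is Some y then c y else 0.

Definition clock x (u : R) : \bar R := (\int[mu]_(s in `[0%R, u]) (rate (x s))%:E)%E.

Lemma rate_ge0 z : 0 <= rate z.
Proof. by case: z => //= y; exact/ltW. Qed.

Lemma measurable_rate d (Z : measurableType d) (X : Z -> opc E) :
  (forall U, open U -> measurable [set z | (Some @` U) (X z)]) ->
  measurable_fun setT (fun z => rate (X z)).
Proof.
move=> mX; apply: (measurability _ (RGenOInfty.measurableE R)) => //.
move=> /= _ [_ [a ->] <-]; rewrite setTI.
have [a0|a0] := ltP a 0.
  rewrite (_ : _ @^-1` _ = setT)//; apply/seteqP; split=> // z _ /=.
  by rewrite in_itv/= andbT (lt_le_trans a0)// rate_ge0.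
rewrite (_ : _ @^-1` _ = [set z | (Some @` (c @^-1` `]a, +oo[%classic)) (X z)]).
  apply: mX; move/continuousP : c_cont; apply; exact: interval_open.
apply/seteqP; split=> z /=; rewrite in_itv/= andbT.
  case: (X z) => [y|]/= ay; last by move: a0; rewrite leNgt ay.
  by exists y; rewrite //= in_itv/= ay.
by move=> [y + <-]; rewrite /= in_itv/= andbT.
Qed.

(** A single path is sampled at the clamped identity, which lies in [[0, u]] for every real [s]. *)
Lemma measurable_path_rate x (u : R) : good_path x -> measurable_fun `[0, u] (fun s => rate (x s)).
Proof.
move=> gx; have [u0|u0] := ltP u 0.
  by rewrite set_itv_ge ?bnd_simp -?ltNge//; exact: measurable_fun_set0.
pose sg (s : R) := Num.min u (Num.max 0 s).
apply: (@eq_measurable_fun _ _ _ _ _ (fun s => rate (x (sg s)))).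
  move=> s; rewrite inE/= in_itv/= => /andP[s0 su].
  by rewrite /sg (max_r s0) (min_r su).
apply: measurable_funTS; apply: measurable_rate => U oU.
apply: (@measurable_sampled _ _ _ (measurableTypeR R) (fun=> x) sg u) => //.
- apply: measurable_minr => //; exact: measurable_maxr.
- by move=> s; rewrite /sg le_min u0 le_max lexx.
- by move=> s; rewrite /sg ge_min lexx.
- move=> r U' _ _ _; case: (pselect ((Some @` U') (x r))) => H.
    by rewrite (_ : [set _ | _] = setT)//; apply/seteqP; split.
  by rewrite (_ : [set _ | _] = set0)//; apply/seteqP; split.
Qed.

Lemma measurable_path_rateE x (a b : R) : good_path x -> 0 <= a ->
  measurable_fun `]a, b] (fun s => (rate (x s))%:E).
Proof.
move=> gx a0; apply/measurable_EFinP; apply: (measurable_funS _ _ (@measurable_path_rate x b gx)) => //.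
by move=> s /=; rewrite !in_itv/= => /andP[/ltW/(le_trans a0)->].
Qed.

Lemma clock_ge0 x u : (0 <= clock x u)%E.
Proof. by apply: integral_ge0 => s _; rewrite lee_fin rate_ge0. Qed.

Lemma clock0 x : clock x 0 = 0%E.
Proof. by rewrite /clock set_itv1 integral_set1. Qed.

Lemma clockD x (a b : R) : good_path x -> 0 <= a -> a <= b ->
  clock x b = (clock x a + \int[mu]_(s in `]a, b]) (rate (x s))%:E)%E.
Proof.
move=> gx a0 ab; rewrite /clock.
have -> : `[0, b]%classic = `[0, a]%classic `|` `]a, b]%classic.
  by rewrite -itv_bndbnd_setU ?bnd_simp.
rewrite ge0_integral_setU//.
- rewrite -itv_bndbnd_setU ?bnd_simp//.
  apply/measurable_EFinP; exact: measurable_path_rate.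
- by move=> *; rewrite lee_fin rate_ge0.
- apply/disj_setPS => s [] /=; rewrite !in_itv/= => /andP[_ sa] /andP[].
  by rewrite ltNge sa.
Qed.

Lemma clock_le x (a b : R) : good_path x -> 0 <= a -> a <= b -> (clock x a <= clock x b)%E.
Proof.
move=> gx a0 ab; rewrite (clockD gx a0 ab) leeDl// integral_ge0// => s _.
by rewrite lee_fin rate_ge0.
Qed.

Lemma clock_bounds x (a b m M : R) : good_path x -> 0 <= a -> a <= b -> 0 <= m ->
  (forall s, a <= s -> s <= b -> m <= rate (x s) /\ rate (x s) <= M) ->
  (clock x a + (m * (b - a))%:E <= clock x b)%E /\
  (clock x b <= clock x a + (M * (b - a))%:E)%E.
Proof.
move=> gx a0 ab m0 H; have M0 : 0 <= M.
  by have [mx xM] := H a (lexx _) ab; exact: le_trans (rate_ge0 _) xM.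
have itvab : mu `]a, b]%classic = (b - a)%:E.
  rewrite lebesgue_measure_itv/= lte_fin; move: ab; rewrite le_eqVlt.
  by case/predU1P => [->|->]; rewrite ?ltxx ?subrr// EFinB.
have cstE (k : R) : (k * (b - a))%:E = (\int[mu]_(s in `]a, b]) (cst k%:E s))%E.
  by rewrite integral_cst// EFinM -itvab.
rewrite (clockD gx a0 ab) !cstE; split; apply: leeD2l; apply: ge0_le_integral => //.
- exact: measurable_path_rateE.
- move=> s /=; rewrite in_itv/= => /andP[/ltW sa sb]; rewrite lee_fin.
  by have [] := H s sa sb.
- by move=> s _; rewrite lee_fin rate_ge0.
- exact: measurable_path_rateE.
- move=> s /=; rewrite in_itv/= => /andP[/ltW sa sb]; rewrite lee_fin.
  by have [] := H s sa sb.
Qed.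

Lemma clock_dead x (a b : R) : good_path x -> 0 <= a -> a <= b -> x a = None ->
  clock x b = clock x a.
Proof.
move=> gx a0 ab xa; have [_ abs _ _] := gx.
have [|_] := @clock_bounds x a b 0 0 gx a0 ab (lexx _).
  by move=> s sa sb; rewrite (abs a s).
rewrite mul0r adde0 => H; apply/eqP; rewrite eq_le H/=; exact: clock_le.
Qed.

Lemma clock_shift x (r v : R) : good_path x -> 0 <= r -> 0 <= v ->
  clock x (r + v) = (clock x r + clock (fun s => x (r + s)%R) v)%E.
Proof.
move=> gx r0 v0; rewrite (@clockD x r)// ?lerDl//; congr (_ + _)%E.
rewrite integral_itv_obnd_cbnd; last exact: measurable_path_rateE.
rewrite -[v in (r + v)%R]mul1r integral_affine//.
- by rewrite mul1e /clock; apply: eq_integral => s _; rewrite mul1r.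
- apply/measurable_EFinP; apply: (measurable_funS _ _ (@measurable_path_rate x (r + 1 * v) gx)) => //.
  by move=> s /=; rewrite !in_itv/= => /andP[/(le_trans r0)->].
- by move=> s; rewrite lee_fin rate_ge0.
Qed.

(** Running the path [k] times faster divides the integral by [k], while [h] multiplies the rate by
    [k]; only the change of the upper limit remains. *)
Lemma clock_scale x (h : E -> E) (k v : R) : good_path x -> 0 < k ->
  (forall y, c (h y) = k * c y) ->
  clock (fun s => extend h (x (k * s))) v = clock x (k * v).
Proof.
move=> gx k0 ch; rewrite /clock.
have := @integral_affine R (fun s => (rate (x s))%:E) 0 k v k0.
rewrite !add0r => ->; last 2 first.
- apply/measurable_EFinP; exact: measurable_path_rate.
- by move=> s; rewrite lee_fin rate_ge0.
rewrite -ge0_integralZl_EFin//; last 3 first.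
- by move=> s _; rewrite lee_fin rate_ge0.
- have g' : good_path (fun s => x (0 + k * s)) by exact: good_path_affine.
  by apply/measurable_EFinP; exact: measurable_path_rate g'.
- exact: ltW.
apply: eq_integral => s _; rewrite add0r -EFinM; congr EFin.
by case: (x (k * s)) => [y|] /=; rewrite ?mulr0.
Qed.

(** Up to a time at which the path is alive it stays in a compact set, on which [c] is bounded above
    and away from 0. *)
Lemma clock_lipschitz x (v : R) : good_path x -> 0 <= v -> x v <> None ->
  exists m M, [/\ 0 < m, 0 < M & forall a b, 0 <= a -> a <= b -> b <= v ->
    (clock x a + (m * (b - a))%:E <= clock x b)%E /\
    (clock x b <= clock x a + (M * (b - a))%:E)%E].
Proof.
move=> gx v0 xv; have [_ _ alive _] := gx.
have [K cK HK] := alive v v0 xv.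
have [y0 Ky0 _] := HK 0 (lexx _) v0.
have K0 : K !=set0 by exists y0.
have cc : {within K, continuous c} by apply: continuous_subspaceT.
have [ym Kym Hm] := compact_EVT_min K0 cK cc.
have [yM KyM HM] := compact_EVT_max K0 cK cc.
exists (c ym), (c yM); split=> // a b a0 ab bv.
apply: clock_bounds => //; first exact: ltW.
move=> s sa sb; have [y Ky <-] /= := HK s (le_trans a0 sa) (le_trans sb bv).
by split; [apply: Hm|apply: HM]; rewrite inE.
Qed.

Lemma clock_fin x (v : R) : good_path x -> 0 <= v -> x v <> None -> clock x v \is a fin_num.
Proof.
move=> gx v0 /(clock_lipschitz gx v0)[m [M [m0 M0]]] /(_ 0 v (lexx _) v0 (lexx _))[_].
rewrite clock0 add0e => H; rewrite ge0_fin_numE ?clock_ge0//.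
by rewrite (le_lt_trans H)// ltry.
Qed.

(** Right-continuity holds the rate between [c y - e] and [c y + e] just after [t]; [e <= c y] makes
    the lower bound nonnegative, as [clock_bounds] requires. *)
Lemma clock_right_derivative x (t : R) y (e : R) : good_path x -> 0 <= t -> x t = Some y -> 0 < e ->
  e <= c y -> exists2 d, 0 < d & forall b, t <= b -> b < t + d ->
    (clock x t + ((c y - e) * (b - t))%:E <= clock x b)%E /\
    (clock x b <= clock x t + ((c y + e) * (b - t))%:E)%E.
Proof.
move=> gx t0 xt e0 ey; have [cx _ _ _] := gx.
have [d d0 H] : exists2 d, 0 < d & forall s, t <= s -> s < t + d ->
    (Some @` (c @^-1` ball (c y) e)) (x s).
  apply: (@cadlag_right _ _ x t _ cx) => //.
  rewrite xt; apply: one_point_compactification_some_nbhs.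
  by apply: c_cont; exact: nbhsx_ballx.
exists d => // b tb bd; apply: clock_bounds => //; first by rewrite subr_ge0.
move=> s ts sb; have [z + <-] := H s ts (le_lt_trans sb bd).
by rewrite /ball/= ltr_distlC => /andP[/ltW ? /ltW].
Qed.

End clock.

(** * The path run with the inverse clock *)

Section time_change.
Context {R : realType} {E : metricType R}.
Variable c : E -> R.
Hypothesis c_cont : continuous c.
Hypothesis c_gt0 : forall y, 0 < c y.
Implicit Types (x : R -> opc E) (t u v r s : R) (y : E).
Local Notation clock := (clock c).

(** The time at which the clock reaches [t], [+oo] if it never does. In the
    latter case [lamperti], the path run with the inverse clock, is dead. *)
Definition hit x t : \bar R :=
  ereal_inf [set u%:E | u in [set u | 0 <= u /\ (t%:E <= clock x u)%E]].

Definition lamperti x t : opc E := if hit x t is r%:E then x r else None.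

Lemma hit_ge0 x t : (0 <= hit x t)%E.
Proof. by apply: le_ereal_inf_tmp => _ [u [u0 _] <-]; rewrite lee_fin. Qed.

(** The infimum is attained because the clock is right-continuous: if it is below [t] at [u], it is
    still below slightly later. Events on [hit] thus become events on the clock at a fixed time. *)
Lemma hit_leP x t u : good_path x -> 0 <= u ->
  (t%:E <= clock x u)%E <-> (hit x t <= u%:E)%E.
Proof.
move=> gx u0; split=> [tu|]; first by apply: ereal_inf_lbound; exists u.
move=> hu; rewrite leNgt; apply/negP => ut.
suff [v uv Hv] : exists2 v, u < v & (clock x v < t%:E)%E.
  suff : (v%:E <= hit x t)%E by move=> /le_trans/(_ hu); rewrite lee_fin leNgt uv.
  apply: le_ereal_inf_tmp => _ [w [w0 tw] <-]; rewrite lee_fin leNgt; apply/negP => wv.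
  by have := lt_le_trans Hv tw; rewrite ltNge clock_le// ltW.
case xu : (x u) => [y|]; last first.
  exists (u + 1); first by rewrite ltrDl.
  by rewrite (clock_dead c_cont c_gt0 gx u0 _ xu) ?lerDl.
have [d d0 Hd] := clock_right_derivative c_cont c_gt0 gx u0 xu (c_gt0 y) (lexx _).
have xuN : x u <> None by rewrite xu.
have fu := clock_fin c_cont c_gt0 gx u0 xuN.
move: ut; rewrite -(fineK fu) lte_fin -subr_gt0 => ut.
set C := fine _ in ut *.
(* The rate is at most [c y + c y] on the window, so the factor 4 lets the clock advance by at most
   half of the gap [t - C]. *)
pose e := Num.min (d / 2) ((t - C) / (4 * c y)).
have e0 : 0 < e by rewrite lt_min !divr_gt0// mulr_gt0.
exists (u + e); first by rewrite ltrDl.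
have [||_] := Hd (u + e); first by rewrite lerDl ltW.
  by rewrite ltrD2l gt_min ltr_pdivrMr// ltr_pMr// ltr1n.
move=> /le_lt_trans; apply; rewrite -(fineK fu) -/C -EFinD lte_fin -ltrBrDl (addrC u) addrK.
apply: (@le_lt_trans _ _ ((c y + c y) * ((t - C) / (4 * c y)))).
  by rewrite ler_wpM2l// ?ge_min ?lexx ?orbT// addr_ge0// ltW.
have cy : c y != 0 by rewrite gt_eqF.
rewrite (_ : _ * _ = (t - C) / 2); last by field.
by rewrite ltr_pdivrMr// ltr_pMr// ltr1n.
Qed.

Lemma clock_lt x a b : good_path x -> 0 <= a -> a < b -> x a <> None -> (clock x a < clock x b)%E.
Proof.
move=> gx a0 ab xa; case xay : (x a) xa => [y|//] _.
have c20 : 0 < c y / 2 by rewrite divr_gt0.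
have [|d d0 Hd] := clock_right_derivative c_cont c_gt0 gx a0 xay c20.
  by rewrite ler_pdivrMr// ler_pMr// ler1n.
pose e := Num.min b (a + d / 2).
have ae : a < e by rewrite lt_min ab ltrDl divr_gt0.
have [||+ _] := Hd e; first exact: ltW.
  by rewrite gt_min ltrD2l ltr_pdivrMr// ltr_pMr// ltr1n orbT.
have fa : clock x a \is a fin_num by rewrite (clock_fin c_cont c_gt0)// xay.
move=> H; apply: (@lt_le_trans _ _ (clock x e)); last first.
  apply: clock_le => //; first exact: le_trans (ltW ae).
  by rewrite ge_min lexx.
apply: lt_le_trans H; rewrite lteDl// lte_fin mulr_gt0 ?subr_gt0//.
by rewrite ltr_pdivrMr// ltr_pMr// ltr1n.
Qed.

Lemma hit_clock x r t : good_path x -> 0 <= r -> x r <> None -> clock x r = t%:E ->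
  hit x t = r%:E.
Proof.
move=> gx r0 xr rt; apply/eqP; rewrite eq_le; apply/andP; split.
  by apply/hit_leP => //; rewrite rt.
apply: le_ereal_inf_tmp => _ [w [w0 tw] <-]; rewrite lee_fin leNgt; apply/negP => wr.
have [_ abs _ _] := gx.
have : (clock x w < clock x r)%E.
  by apply: clock_lt => // /(abs _ _ w0 (ltW wr)).
by rewrite rt ltNge tw.
Qed.

Lemma clock_hit x r t : good_path x -> 0 <= t -> hit x t = r%:E -> x r <> None ->
  0 <= r /\ clock x r = t%:E.
Proof.
move=> gx t0 hr xr.
have r0 : 0 <= r by rewrite -lee_fin -hr hit_ge0.
split=> //; apply/eqP; rewrite eq_le; apply/andP; split; last first.
  by apply/hit_leP => //; rewrite hr.
have [m [M [_ M0 H]]] := clock_lipschitz c_cont c_gt0 gx r0 xr.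
rewrite leNgt; apply/negP => tr.
have fr := clock_fin c_cont c_gt0 gx r0 xr.
move: tr; rewrite -(fineK fr) lte_fin; set C := fine _ => tC.
have r0' : 0 < r.
  rewrite lt0r r0 andbT; apply/eqP => re0; move: tC; rewrite /C re0 clock0/=.
  by rewrite ltNge t0.
(* By the Lipschitz bound [M], going back by [e] lowers the clock by at most the excess [C - t];
   level [t] would be reached before [r]. *)
pose e := Num.min r ((C - t) / M).
have e0 : 0 < e by rewrite lt_min r0' divr_gt0// subr_gt0.
have re0 : 0 <= r - e by rewrite subr_ge0 ge_min lexx.
have rer : r - e <= r by rewrite gerBl ltW.
have [_] := H (r - e) r re0 rer (lexx _).
rewrite -(fineK fr) -/C subKr => Ce.
suff : (hit x t <= (r - e)%:E)%E by rewrite hr lee_fin leNgt gtrBl e0.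
apply/hit_leP => //.
have Me : M * e <= C - t by rewrite mulrC -ler_pdivlMr// ge_min lexx orbT.
rewrite -(@leeD2rE _ (M * e)%:E)//; apply: le_trans Ce.
by rewrite -EFinD lee_fin; lra.
Qed.

(** Replaces the infimum by an equation, legitimate because the clock is continuous and strictly
    increasing while the path is alive. Identities between time-changed paths are proved through
    it. *)
Lemma lamperti_SomeP x t y : good_path x -> 0 <= t ->
  lamperti x t = Some y <-> exists r, [/\ 0 <= r, x r = Some y & clock x r = t%:E].
Proof.
move=> gx t0; split.
  rewrite /lamperti; case hr : (hit x t) => [r||]// xr; exists r.
  by have [|? ?] := clock_hit gx t0 hr; rewrite ?xr.
move=> [r [r0 xr rt]]; rewrite /lamperti (@hit_clock x r)//; by rewrite xr.
Qed.

Lemma lamperti0 x y : good_path x -> x 0 = Some y -> lamperti x 0 = Some y.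
Proof. by move=> gx x0; apply/lamperti_SomeP => //; exists 0; rewrite clock0. Qed.

Lemma lamperti_aliveW x s t : good_path x -> 0 <= s -> s <= t -> lamperti x t <> None ->
  lamperti x s <> None.
Proof.
move=> gx s0 st; case xt : (lamperti x t) => [y|//] _.
have /lamperti_SomeP [||r [r0 xr rt]] := xt; [by []|exact: le_trans st|].
have hs : (hit x s <= r%:E)%E by apply/hit_leP => //; rewrite rt lee_fin.
rewrite /lamperti; case hq : (hit x s) hs (hit_ge0 x s) => [q||]//.
rewrite !lee_fin => qr q0 xq; have [_ abs _ _] := gx.
by rewrite (abs _ _ q0 qr xq) in xr.
Qed.

Lemma opc_eq (a b : opc E) : (forall y, a = Some y <-> b = Some y) -> a = b.
Proof.
case: a => [y /(_ y)[-> //]|]; case: b => [y /(_ y)[_ -> //]|//].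
Qed.

Lemma lamperti_clock x r t : good_path x -> 0 <= r -> x r <> None -> clock x r = t%:E ->
  lamperti x t = x r.
Proof. by move=> gx r0 xr rt; rewrite /lamperti (hit_clock gx r0). Qed.

(** The clock is additive: restarting the path at [r], where the clock shows [t], amounts to reading
    the time change from [t] on. *)
Lemma lamperti_shift x r t s : good_path x -> 0 <= t -> 0 <= s ->
  hit x t = r%:E -> x r <> None -> lamperti (fun u => x (r + u)) s = lamperti x (t + s).
Proof.
move=> gx t0 s0 hr xr; have [r0 rt] := clock_hit gx t0 hr xr.
have gx' : good_path (fun u => x (r + u)).
  rewrite (_ : (fun u => _) = (fun u => x (r + 1 * u))).
    exact: good_path_affine.
  by apply/funext => u; rewrite mul1r.
apply: opc_eq => y; split.
  move=> /lamperti_SomeP[//|//|v [v0 xv vs]].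
  apply/lamperti_SomeP => //; first exact: addr_ge0.
  exists (r + v); split=> //; first exact: addr_ge0.
  by rewrite clock_shift// rt vs.
move=> /lamperti_SomeP[//||v [v0 xv vts]]; first exact: addr_ge0.
have rv : r <= v.
  rewrite leNgt; apply/negP => vr.
  have : (clock x v < clock x r)%E by apply: clock_lt => //; rewrite xv.
  by rewrite rt vts lte_fin ltNge lerDl s0.
apply/lamperti_SomeP => //; exists (v - r); split; rewrite ?subr_ge0//.
  by rewrite subrKC.
have vr0 : 0 <= v - r by rewrite subr_ge0.
move: (clock_shift c_cont c_gt0 gx r0 vr0); rewrite subrKC vts rt.
by case: (clock _ (v - r)) => [q [/addrI->]||].
Qed.

(** The scaling of time disappears, since the rescaled clock at [r / k] shows what the clock of [x]
    shows at [r]. This is what will make the law of the increments independent of the current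
    position. *)
Lemma lamperti_scale x (h : E -> E) k t : good_path x -> homeomorphism h -> 0 < k -> 0 <= t ->
  (forall y, c (h y) = k * c y) ->
  lamperti (fun s => extend h (x (k * s))) t = extend h (lamperti x t).
Proof.
move=> gx hh k0 t0 ch.
have gx' : good_path (fun s => extend h (x (k * s))).
  rewrite (_ : (fun s => _) = extend h \o (fun s => x (0 + k * s))).
    apply: good_path_extend => //; exact: good_path_affine.
  by apply/funext => s /=; rewrite add0r.
apply: opc_eq => y; split.
  move=> /lamperti_SomeP[//|//|r [r0 xr]]; rewrite clock_scale// => rt.
  have xkr : x (k * r) <> None by move=> N; rewrite N in xr.
  by rewrite (lamperti_clock gx _ xkr rt) ?mulr_ge0// ltW.
case lt : (lamperti x t) => [z|//] /= [<-].
have /lamperti_SomeP[//|//|r [r0 xr rt]] := lt.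
apply/lamperti_SomeP => //; exists (r / k); split.
- by rewrite divr_ge0// ltW.
- by rewrite mulrC divfK ?gt_eqF// xr.
- by rewrite clock_scale// mulrC divfK ?gt_eqF.
Qed.

Lemma lamperti_right x t y U : good_path x -> 0 <= t -> lamperti x t = Some y -> nbhs y U ->
  exists2 e, 0 < e & forall s, t <= s -> s < t + e -> (Some @` U) (lamperti x s).
Proof.
move=> gx t0 /lamperti_SomeP[//|//|r [r0 xr rt]] yU; have [cx abs _ _] := gx.
have [d d0 Hd] : exists2 d, 0 < d & forall s, r <= s -> s < r + d -> (Some @` U) (x s).
  apply: (@cadlag_right _ _ x r _ cx) => //.
  by rewrite xr; exact: one_point_compactification_some_nbhs.
(* The path is still alive at [r + d / 2], and the clock shows some [C > t] there; levels in [[t,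
   C[] are hit between [r] and [r + d / 2]. *)
have d2 : r + d / 2 < r + d by rewrite ltrD2l ltr_pdivrMr// ltr_pMr// ltr1n.
have rd2 : r < r + d / 2 by rewrite ltrDl divr_gt0.
have rd0 : 0 <= r + d / 2 by exact: le_trans r0 (ltW _).
have [z _ xz] := Hd (r + d / 2) (ltW rd2) d2.
have xrd : x (r + d / 2) <> None by rewrite -xz.
have fr := clock_fin c_cont c_gt0 gx rd0 xrd.
have : (clock x r < clock x (r + d / 2))%E by apply: clock_lt; rewrite ?xr.
rewrite rt -(fineK fr); set C := fine _; rewrite lte_fin => tC.
exists (C - t); first by rewrite subr_gt0.
move=> s ts; rewrite subrKC => sC.
have hs : (hit x s <= (r + d / 2)%:E)%E.
  by apply/hit_leP => //; rewrite -(fineK fr) lee_fin ltW.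
rewrite /lamperti; case hq : (hit x s) hs (hit_ge0 x s) => [q||]//.
rewrite !lee_fin => qr q0; apply: Hd; last exact: le_lt_trans qr _.
rewrite leNgt; apply/negP => qlr.
have xq : x q <> None by move=> /(abs _ _ q0 (ltW qlr)); rewrite xr.
have [_ qs] := clock_hit gx (le_trans t0 ts) hq xq.
have : (clock x q < clock x r)%E by exact: clock_lt.
by rewrite rt qs lte_fin ltNge ts.
Qed.

Lemma lamperti_compact x t : good_path x -> 0 <= t -> lamperti x t <> None ->
  exists2 K, compact K & forall s, 0 <= s -> s <= t -> (Some @` K) (lamperti x s).
Proof.
move=> gx t0 lt; case ly : (lamperti x t) (lt) => [y|//] _.
have /lamperti_SomeP[//|//|r [r0 xr rt]] := ly; have [_ _ alive _] := gx.
have [|K cK H] := alive r r0; first by rewrite xr.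
exists K => // s s0 st; have := lamperti_aliveW gx s0 st lt.
case lsz : (lamperti x s) => [z|//] _.
have /lamperti_SomeP[//|//|q [q0 xq qs]] := lsz.
rewrite -xq; apply: H => //; rewrite leNgt; apply/negP => rq.
have : (clock x r < clock x q)%E by apply: clock_lt; rewrite ?xr.
by rewrite rt qs lte_fin ltNge st.
Qed.

Lemma lamperti_left x t : good_path x -> 0 < t -> lamperti x t <> None ->
  exists l, lamperti x @ t^'- --> (Some l : opc E).
Proof.
move=> gx t0 lt; case ly : (lamperti x t) (lt) => [y|//] _.
have /lamperti_SomeP[//||r [r0 xr rt]] := ly; first exact: ltW.
have [[_ xl] abs alive _] := gx.
have rgt0 : 0 < r.
  rewrite lt0r r0 andbT; apply/eqP => re0; move: rt; rewrite re0 clock0 => -[te].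
  by rewrite -te ltxx in t0.
have [|K cK HK] := alive r r0; first by rewrite xr.
have pick e : 0 < e -> exists q, [/\ 0 <= q, r - e < q & q < r].
  move=> e0; exists (Num.max 0 (r - e / 2)); rewrite le_max lexx lt_max gt_max rgt0/=.
  rewrite ltrD2l ltrN2 ltr_pdivrMr// ltr_pMr// ltr1n orbT; split=> //.
  by rewrite gtrBl divr_gt0.
(* The left limit cannot be [None]: up to [r] the path stays in the compact [K], whose complement is
   a neighbourhood of [None]. *)
have [[l|] xrl] := xl r rgt0; last first.
  have := xrl (~` (Some @` K)); rewrite nbhs_simpl => -[].
    by apply: open_nbhs_nbhs; split; [exact: open_SomeC|move=> []].
  move=> e /= e0 He; have [q [q0 eq qr]] := pick e e0.
  have [] := He q; last exact: HK (ltW qr).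
    by rewrite /ball/= gtr0_norm ?subr_gt0// ltrBlDl -ltrBlDr.
  done.
exists l => U /xrl; rewrite !nbhs_simpl => /near_at_leftE[e e0 He].
have [q [q0 eq qr]] := pick e e0.
have xq : x q <> None by move=> /(abs _ _ q0 (ltW qr)); rewrite xr.
have := clock_lt gx q0 qr xq.
have fq := clock_fin c_cont c_gt0 gx q0 xq.
rewrite rt -(fineK fq); set C := fine _; rewrite lte_fin => Ct.
apply/near_at_leftE; exists (t - C); first by rewrite subr_gt0.
move=> s; rewrite subKr => Cs st.
have C0 : 0 <= C by rewrite fine_ge0// clock_ge0.
have s0 : 0 <= s by exact: le_trans C0 (ltW Cs).
have := lamperti_aliveW gx s0 (ltW st) lt.
case lsz : (lamperti x s) => [z|//] _.
have /lamperti_SomeP[//|//|p [p0 xp ps]] := lsz.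
rewrite /= lsz -xp; apply: He.
  apply: (lt_trans eq); rewrite ltNge; apply/negP => pq.
  have := clock_le c_cont c_gt0 gx p0 pq.
  by rewrite ps -(fineK fq) lee_fin leNgt Cs.
rewrite ltNge; apply/negP => rp.
have := clock_le c_cont c_gt0 gx r0 rp.
by rewrite rt ps lee_fin leNgt st.
Qed.

End time_change.

(** The time-changed path being only right-continuous, [phi] and [hit] are
    compared through their right derivatives. *)
Lemma right_derivative0_const (R : realType) (g : R -> R) :
  (forall t e, 0 <= t -> 0 < e -> exists2 d, 0 < d & forall b, t <= b -> b < t + d ->
     `|g b - g t| <= e * (b - t)) ->
  (forall t, 0 <= t -> exists2 M, 0 < M & forall s, 0 <= s -> s <= t ->
     `|g t - g s| <= M * (t - s)) ->
  forall t, 0 <= t -> g t = g 0.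
Proof.
move=> gr gl b b0; apply/eqP; rewrite -subr_eq0 -normr_le0.
apply/ler_addgt0Pl => eps eps0; rewrite addr0.
have [e e0 eb] : exists2 e, 0 < e & e * b <= eps.
  exists (eps / (b + 1)); first by rewrite divr_gt0// ltr_wpDl.
  by rewrite mulrAC ler_pdivrMr ?ltr_wpDl// ler_pM2l// lerDl.
apply: le_trans eb.
(* Continuous induction: the supremum of [A] belongs to [A] by the Lipschitz bound on its left, and
   the right derivative enlarges [A] unless this supremum is [b]. *)
pose A := [set t | [/\ 0 <= t, t <= b & forall s, 0 <= s -> s <= t -> `|g s - g 0| <= e * s]].
have A0 : A 0.
  split=> // s s0 s0'; have -> : s = 0 by apply/eqP; rewrite eq_le s0 s0'.
  by rewrite subrr normr0 mulr0.
have Aub : has_ubound A by exists b => t [].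
have Asup : has_sup A by split=> //; exists 0.
set S := sup A.
have S0 : 0 <= S by apply: ub_le_sup.
have Sb : S <= b by apply: ge_sup; [exists 0|move=> t []].
have below s : 0 <= s -> s < S -> `|g s - g 0| <= e * s.
  move=> s0 sS; have dS : 0 < S - s by rewrite subr_gt0.
  have [t [t0 tb H]] := sup_adherent dS Asup; rewrite subKr => st.
  by apply: H => //; exact: ltW.
have AS : A S.
  split=> // s s0; rewrite le_eqVlt => /predU1P[->|]; last exact: below.
  have [S00|Sgt0] := leP S 0.
    have -> : S = 0 by apply/eqP; rewrite eq_le S00 S0.
    by rewrite subrr normr0 mulr0.
  apply/ler_addgt0Pl => del del0; have [M M0 HM] := gl S S0.
  pose q := Num.max 0 (S - del / M).
  have q0 : 0 <= q by rewrite le_max lexx.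
  have qS : q < S by rewrite gt_max Sgt0/= gtrBl divr_gt0.
  rewrite -(subrK (g q) (g S)) -addrA (le_trans (ler_normD _ _))// lerD//.
    apply: (le_trans (HM q q0 (ltW qS))).
    rewrite mulrC -ler_pdivlMr// lerBlDr -lerBlDl.
    by rewrite le_max lexx orbT.
  by rewrite (le_trans (below q q0 qS))// ler_pM2l// ltW.
have [_ _ HS] := AS.
move: Sb; rewrite le_eqVlt => /predU1P[Sb|Sb]; first by rewrite -Sb HS.
have [d d0 Hd] := gr S e S0 e0.
pose q := Num.min b (S + d / 2).
have Sq : S < q by rewrite lt_min Sb ltrDl divr_gt0.
have qd : q < S + d by rewrite gt_min ltrD2l ltr_pdivrMr// ltr_pMr// ltr1n orbT.
suff /(ub_le_sup Aub) : A q by rewrite leNgt Sq.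
split; first exact: le_trans S0 (ltW Sq).
  by rewrite ge_min lexx.
move=> s s0 sq; have [sS|Ss] := leP s S; first exact: HS.
rewrite -(subrK (g S) (g s)) -addrA (le_trans (ler_normD _ _))//.
rewrite -[s in _ <= e * s](subrK S) mulrDr lerD//; last exact: HS.
by apply: Hd; [exact: ltW|exact: le_lt_trans qd].
Qed.

(** * The inverse of the clock is [phi], for a path whose time change never dies *)

Section inverse_clock.
Context {R : realType} {E : metricType R}.
Variable c : E -> R.
Hypothesis c_cont : continuous c.
Hypothesis c_gt0 : forall y, 0 < c y.
Variables (y0 : E) (x : R -> opc E).
Hypothesis gx : good_path x.
Hypothesis immortal : forall t, 0 <= t -> lamperti c x t <> None.
Implicit Types (t u v r s : R) (y : E).

Definition lamperti_path (t : R) : E := odflt y0 (lamperti c x t).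
Definition hit_time (t : R) : R := fine (hit c x t).
Local Notation l := lamperti_path.
Local Notation h := hit_time.

Lemma lamperti_pathE t : 0 <= t -> lamperti c x t = Some (l t).
Proof. by move=> /immortal; rewrite /l; case: (lamperti c x t). Qed.

Lemma hit_timeP t : 0 <= t ->
  [/\ hit c x t = (h t)%:E, 0 <= h t, x (h t) = Some (l t) & clock c x (h t) = t%:E].
Proof.
move=> t0; have := lamperti_pathE t0; rewrite /h {1}/lamperti.
case hr : (hit c x t) => [r||]//= xr.
by have [|r0 rt] := clock_hit c_cont c_gt0 gx t0 hr; rewrite ?xr.
Qed.

Lemma cadlag_lamperti_path : cadlag l.
Proof.
split=> t t0.
  move=> U lU; rewrite nbhs_simpl.
  have [e e0 H] := lamperti_right c_cont c_gt0 gx t0 (lamperti_pathE t0) lU.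
  apply/near_at_rightE; exists e => // s ts se.
  have [z Uz] := H s (ltW ts) se.
  by rewrite lamperti_pathE ?(le_trans t0 (ltW ts))// => -[zs]; rewrite /= -zs.
have [z Hz] := lamperti_left c_cont c_gt0 gx t0 (immortal (ltW t0)).
exists z => U zU; have := Hz (Some @` U) (@one_point_compactification_some_nbhs _ z U zU).
rewrite !nbhs_simpl => /near_at_leftE[e e0 H].
apply/near_at_leftE; exists (Num.min e t); first by rewrite lt_min e0.
move=> s ts st; have s0 : 0 <= s.
  apply/ltW/(le_lt_trans _ ts); by rewrite subr_ge0 ge_min lexx orbT.
have [|w Uw] := H s _ st.
  by apply: le_lt_trans ts; rewrite lerD2l lerN2 ge_min lexx.
by rewrite /= lamperti_pathE// => -[ws]; rewrite -ws.
Qed.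

Lemma good_lamperti_path : good_path (fun t => Some (l t) : opc E).
Proof.
split=> //.
- apply: (@cadlag_comp _ _ _ (Some : E -> opc E) l); last exact: cadlag_lamperti_path.
  exact: one_point_compactification_some_continuous.
- move=> t t0 _; have [K cK H] := lamperti_compact c_cont c_gt0 gx t0 (immortal t0).
  by exists K => // s s0 st; rewrite -lamperti_pathE//; exact: H.
Qed.

Let cV y := (c y)^-1.

Let cV_gt0 y : 0 < cV y. Proof. by rewrite invr_gt0. Qed.

Let cV_cont : continuous cV.
Proof.
rewrite /cV => y; have cy : c y != 0 by rewrite gt_eqF.
exact: (cvgV cy (@c_cont y)).
Qed.

Lemma phi_clock t : phi c l t%:E = clock cV (fun t => Some (l t)) t.
Proof.
rewrite /phi /clock; congr integral; apply/seteqP; split=> s /=; rewrite in_itv/= lee_fin.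
  by move=> [-> ->].
by move=> /andP[].
Qed.

Lemma hit_time_le s t : 0 <= s -> s <= t -> h s <= h t.
Proof.
move=> s0 st; have t0 := le_trans s0 st.
have [hs _ _ _] := hit_timeP s0; have [ht ht0 _ htt] := hit_timeP t0.
rewrite -lee_fin -hs; apply/(hit_leP c_cont c_gt0) => //.
by rewrite htt lee_fin.
Qed.

Lemma hit_time_lipschitz t : 0 <= t -> exists2 M, 0 < M & forall s, 0 <= s -> s <= t ->
  `|h t - h s| <= M * (t - s).
Proof.
move=> t0; have [ht ht0 xt htt] := hit_timeP t0.
have [|m [M [m0 _ H]]] := clock_lipschitz c_cont c_gt0 gx ht0; first by rewrite xt.
exists m^-1; first by rewrite invr_gt0.
move=> s s0 st; have [_ hs0 _ hss] := hit_timeP s0.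
have hst := hit_time_le s0 st.
have [+ _] := H _ _ hs0 hst (lexx _).
rewrite hss htt -EFinD lee_fin => H'.
by rewrite ger0_norm ?subr_ge0// mulrC ler_pdivlMr// mulrC; lra.
Qed.

Let I t := fine (phi c l t%:E).

Let IE t : 0 <= t -> phi c l t%:E = (I t)%:E.
Proof.
by move=> t0; rewrite /I fineK// phi_clock (clock_fin cV_cont cV_gt0 good_lamperti_path).
Qed.

Let I_lipschitz t : 0 <= t -> exists2 M, 0 < M & forall s, 0 <= s -> s <= t ->
  `|I t - I s| <= M * (t - s).
Proof.
move=> t0.
have [//|m [M [m0 M0 H]]] := clock_lipschitz cV_cont cV_gt0 good_lamperti_path t0.
exists M => // s s0 st; have [H1 H2] := H _ _ s0 st (lexx _).
move: H1 H2; rewrite -!phi_clock !IE// -!EFinD !lee_fin => H1 H2.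
have mts : 0 <= m * (t - s) by rewrite mulr_ge0 ?subr_ge0// ltW.
by rewrite ger0_norm; lra.
Qed.

Let I_right t e : 0 <= t -> 0 < e -> exists2 d, 0 < d & forall b, t <= b -> b < t + d ->
  `|I b - I t - cV (l t) * (b - t)| <= e * (b - t).
Proof.
move=> t0 e0; pose e' := Num.min e (cV (l t)).
have e'0 : 0 < e' by rewrite lt_min e0 cV_gt0.
have e'e : e' <= e by rewrite ge_min lexx.
have [|d d0 H] := clock_right_derivative cV_cont cV_gt0 good_lamperti_path t0 erefl e'0.
  by rewrite ge_min lexx orbT.
exists d => // b tb bd; have b0 := le_trans t0 tb.
have [H1 H2] := H b tb bd.
move: H1 H2; rewrite -!phi_clock !IE// -!EFinD !lee_fin => H1 H2.
have : e' * (b - t) <= e * (b - t) by rewrite ler_wpM2r ?subr_ge0.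
by move: H1 H2; rewrite mulrBl mulrDl ler_norml => H1 H2 H3; apply/andP; split; lra.
Qed.

Lemma hit_time_right t e : 0 <= t -> 0 < e -> exists2 d, 0 < d & forall b, t <= b -> b < t + d ->
  `|h b - h t - cV (l t) * (b - t)| <= e * (b - t).
Proof.
move=> t0 e0; have [ht ht0 xt htt] := hit_timeP t0.
set k := c (l t); have k0 : 0 < k by exact: c_gt0.
(* The first bound keeps the rate of the clock above [k / 2], whence [h b - h t] is at most
   [2 * (b - t) / k]; the second then turns the error [e1 * (h b - h t)] into at most
   [k * e * (b - t)]. *)
pose e1 := Num.min (k / 2) (e * k * k / 2).
have e10 : 0 < e1 by rewrite lt_min !divr_gt0// !mulr_gt0.
have e1k : e1 <= k / 2 by rewrite ge_min lexx.
have e1e : e1 <= e * k * k / 2 by rewrite ge_min lexx orbT.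
have [|d d0 H] := clock_right_derivative c_cont c_gt0 gx ht0 xt e10.
  by rewrite -/k; lra.
have ke : 0 < k - e1 by lra.
(* The clock advances by at least this much during [d / 2], so [h b] stays within the window of
   width [d] where the rate is controlled. *)
exists ((k - e1) * (d / 2)); first by rewrite mulr_gt0// divr_gt0.
move=> b tb bd; have b0 := le_trans t0 tb.
have [hb hb0 xb hbb] := hit_timeP b0.
have htb := hit_time_le t0 tb.
have hbd : h b < h t + d.
  apply: (@le_lt_trans _ _ (h t + d / 2)); last by lra.
  rewrite -lee_fin -hb; apply/(hit_leP c_cont c_gt0) => //.
    by rewrite addr_ge0// divr_ge0// ltW.
  have [||+ _] := H (h t + d / 2); [by lra|by lra|].
  apply: le_trans; rewrite htt -EFinD lee_fin -/k.
  have -> : h t + d / 2 - h t = d / 2 by ring.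
  by lra.
have [] := H _ htb hbd.
rewrite htt hbb -!EFinD !lee_fin -/k => H1 H2.
set D := h b - h t in H1 H2 *; have D0 : 0 <= D by rewrite subr_ge0.
have e1D : e1 * D <= k * (e * (b - t)).
  have kD : k / 2 * D <= b - t.
    apply: (@le_trans _ _ ((k - e1) * D)); last by lra.
    by apply: ler_wpM2r => //; lra.
  apply: (@le_trans _ _ (e * k * k / 2 * D)); first exact: ler_wpM2r.
  rewrite (_ : e * k * k / 2 * D = k * (e * (k / 2 * D))); last by ring.
  by rewrite !ler_pM2l.
have kV : k * cV (l t) = 1 by rewrite /cV mulfV// gt_eqF.
rewrite -(ler_pM2l k0) -{1}(gtr0_norm k0) -normrM mulrBr mulrA kV mul1r.
by apply: le_trans e1D; rewrite ler_norml; apply/andP; split; lra.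
Qed.

Lemma phi_hit t : 0 <= t -> phi c l t%:E = (h t)%:E.
Proof.
move=> t0; rewrite IE//; congr EFin; apply/eqP; rewrite -subr_eq0; apply/eqP.
have [h0 _ _ _] := hit_timeP (lexx 0).
have -> : 0 = (fun s => I s - h s) 0.
  rewrite /= /I phi_clock clock0 /=.
  suff -> : h 0 = 0 by rewrite subrr.
  rewrite /h (@hit_clock _ _ c c_cont c_gt0 x 0 0)// ?clock0//.
  move=> x0; have := immortal (lexx 0); rewrite /lamperti.
  have [_ abs _ _] := gx; have [-> r0 xr _] := hit_timeP (lexx 0).
  by rewrite (abs _ _ (lexx 0) r0 x0).
apply: (@right_derivative0_const _ (fun s => I s - h s)) => //.
- move=> s e s0 e0; have e20 : 0 < e / 2 by rewrite divr_gt0.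
  have [d d0 H] := I_right s0 e20; have [d' d'0 H'] := hit_time_right s0 e20.
  exists (Num.min d d'); first by rewrite lt_min d0.
  move=> b sb bd; have [bd1 bd2] : b < s + d /\ b < s + d'.
    by move: bd; rewrite -ltrBlDl lt_min => /andP[]; rewrite !ltrBlDl.
  have := H b sb bd1; have := H' b sb bd2.
  rewrite !ler_norml => /andP[? ?] /andP[? ?]; apply/andP; split; lra.
- move=> s s0; have [M M0 H] := I_lipschitz s0; have [M' M'0 H'] := hit_time_lipschitz s0.
  exists (M + M'); first exact: addr_gt0.
  move=> q q0 qs; have := H q q0 qs; have := H' q q0 qs.
  rewrite !ler_norml => /andP[? ?] /andP[? ?]; apply/andP; split; lra.
Qed.

Let F (n : nat) := `[0, n%:R : R]%classic.

Let FE n : phi c l n%:R%:E = (\int[lebesgue_measure]_(s in F n) (cV (l s))%:E)%E.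
Proof. by rewrite phi_clock. Qed.

Let mF n : measurable_fun (F n) (fun s => (cV (l s))%:E).
Proof.
apply/measurable_EFinP.
exact: (@measurable_path_rate _ _ cV cV_cont cV_gt0 _ _ good_lamperti_path).
Qed.

Let phi_oo : phi c l +oo%E = (\int[lebesgue_measure]_(s in \bigcup_n F n) (cV (l s))%:E)%E.
Proof.
rewrite /phi; congr integral; apply/seteqP; split=> s /=.
  move=> [s0 _]; exists (Num.truncn s).+1 => //=.
  by rewrite /F/= in_itv/= s0 ltW// truncnS_gt.
by move=> [n _] /=; rewrite /F/= in_itv/= => /andP[-> _]; rewrite leey.
Qed.

Lemma phi_oo_cvg : phi c l n%:R%:E @[n --> \oo] --> phi c l +oo%E.
Proof.
rewrite phi_oo.
under eq_fun do rewrite FE.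
apply: ge0_nondecreasing_set_cvg_integral.
- move=> n m nm; apply/subsetPset => s; rewrite /F/= !in_itv/= => /andP[-> /le_trans]; apply.
  by rewrite ler_nat.
- by move=> n; exact: measurable_itv.
- exact: mF.
- by move=> n s _; rewrite lee_fin ltW.
Qed.

Lemma phi_monotone t : (phi c l t%:E <= phi c l +oo%E)%E.
Proof.
rewrite phi_oo phi_clock; apply: ge0_subset_integral => //.
- by apply: bigcupT_measurable => n; exact: measurable_itv.
- by apply/measurable_fun_bigcup => // n; exact: measurable_itv.
- by move=> s _; rewrite lee_fin/= ltW.
- move=> s /=; rewrite in_itv/= => /andP[s0 _]; exists (Num.truncn s).+1 => //=.
  by rewrite /F/= in_itv/= s0 ltW// truncnS_gt.
Qed.

Lemma alive_hit_time u : 0 <= u -> x u <> None ->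
  exists t, [/\ 0 <= t, h t = u & x u = Some (l t)].
Proof.
move=> u0 xu; have fu := clock_fin c_cont c_gt0 gx u0 xu.
have t0 : 0 <= fine (clock c x u) by rewrite fine_ge0// clock_ge0.
exists (fine (clock c x u)); split=> //.
  by rewrite /h (@hit_clock _ _ c c_cont c_gt0 x u)// fineK.
by rewrite -lamperti_pathE// (@lamperti_clock _ _ c c_cont c_gt0 x u)// fineK.
Qed.

Lemma hit_time_lt s t : 0 <= s -> s < t -> h s < h t.
Proof.
move=> s0 st; have t0 := le_trans s0 (ltW st).
have [_ _ _ hs] := hit_timeP s0; have [_ _ _ ht] := hit_timeP t0.
rewrite lt_neqAle hit_time_le ?(ltW st)// andbT; apply/eqP => hst.
by move: ht; rewrite -hst hs => -[ste]; rewrite ste ltxx in st.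
Qed.

(** If the path were alive at time [phi c l +oo], that time would be some [h t], and [phi] at
    [t + 1], equal to [h (t + 1)], would exceed its own limit. Conversely every [phi c l n] equals
    [h n], a time at which the path is alive. *)
Lemma lifetime_phi z : path_from z x -> lifetime z x = phi c l +oo%E.
Proof.
move=> xP; have p0 : (0 <= phi c l +oo%E)%E.
  by apply: integral_ge0 => s _; rewrite lee_fin ltW// invr_gt0.
apply/eqP; rewrite eq_le; apply/andP; split.
  rewrite leNgt; apply/negP => lt.
  have fp : phi c l +oo%E \is a fin_num by rewrite ge0_fin_numE// (lt_le_trans lt)// leey.
  rewrite -(fineK fp) in lt p0; rewrite lee_fin in p0.
  have [t [t0 htu _]] := alive_hit_time p0 (proj2 (path_from_aliveP xP p0) lt).
  have t10 : 0 <= t + 1 by rewrite addr_ge0.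
  have := phi_monotone (t + 1); rewrite (phi_hit t10) leNgt -(fineK fp) -htu lte_fin.
  by rewrite hit_time_lt// ltrDl.
have cv := phi_oo_cvg; rewrite -(cvg_lim _ cv)//; apply: lime_le.
  by apply/cvg_ex; exists (phi c l +oo%E).
apply: nearW => n; have [_ h0 xh _] := hit_timeP (ler0n R n).
by rewrite phi_hit// ltW//; apply/(path_from_aliveP xP) => //; rewrite xh.
Qed.

(** An alive time [t] is some [h s], hence [phi] at [s]; injectivity of [phi] on nonnegative times
    makes the partial inverse return this [s]. *)
Lemma phi_invP z t : path_from z x -> 0 <= t -> (t%:E < phi c l +oo)%E ->
  x t = Some (l (phi_inv c l t)).
Proof.
move=> xP t0; rewrite -(lifetime_phi xP) => /(path_from_aliveP xP t0) xt.
have [s [s0 hs ->]] := alive_hit_time t0 xt.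
rewrite /phi_inv -hs -phi_hit// (pinvKV _ (A := [set s : R | 0 <= s])) ?inE//.
move=> a b; rewrite !inE/= => a0 b0; rewrite !phi_hit// => -[hab].
have [_ _ _ ha] := hit_timeP a0; have [_ _ _ hb] := hit_timeP b0.
by move: hb; rewrite -hab ha => -[].
Qed.

End inverse_clock.

(** * Measurability of the time change *)

Section sigma_algebras.
Context {R : realType}.

Lemma sigma_algebra_sub (T : Type) (G F : set (set T)) :
  sigma_algebra setT F -> G `<=` F -> <<s G >> `<=` F.
Proof. exact: smallest_sub. Qed.

Lemma sigma_algebra_setC (T : Type) (F : set (set T)) A : sigma_algebra setT F ->
  F A -> F (~` A).
Proof. by move=> [_ FC _] FA; rewrite -setTD; exact: FC. Qed.

Lemma sigma_algebra_setI (T : Type) (F : set (set T)) A B : sigma_algebra setT F ->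
  F A -> F B -> F (A `&` B).
Proof.
move=> sF FA FB; rewrite -(setCK (A `&` B)) setCI; apply: sigma_algebra_setC => //.
have [_ _ FU] := sF; rewrite -bigcup2E; apply: FU => -[|[|n]] /=.
- exact: sigma_algebra_setC.
- exact: sigma_algebra_setC.
- by case: sF.
Qed.

Definition filtration_gen (Om : Type) (S : topologicalType) (X : R -> Om -> S) (t : R) :
    set (set Om) :=
  [set B | exists s U, [/\ 0 <= s <= t, open U & B = X s @^-1` U]].

Lemma filtration_mono (Om : Type) (S : topologicalType) (X : R -> Om -> S) s t :
  s <= t -> natural_filtration X s `<=` natural_filtration X t.
Proof.
move=> st; apply: sub_sigma_algebra2 => _ [r [U [/andP[r0 rs] oU ->]]].
by exists r, U; split=> //; rewrite r0 (le_trans rs).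
Qed.

Lemma path_sets_preimage (Om : Type) (S : topologicalType) (F : set (set Om))
    (X : Om -> R -> S) :
  sigma_algebra setT F -> (forall t U, 0 <= t -> open U -> F [set w | U (X w t)]) ->
  forall D, path_sets D -> F [set w | D (X w)].
Proof.
move=> sF HF; apply: (@sigma_algebra_sub _ _ [set D | F [set w | D (X w)]]).
  have [F0 FC FU] := sF; split=> //.
  - by move=> A FA; exact: (FC [set w | A (X w)] FA).
  - by move=> A FA; exact: (FU (fun n => [set w | A n (X w)]) FA).
by move=> _ [t [U [t0 oU ->]]]; exact: HF.
Qed.

Lemma stopped_sets_sigma_algebra (Om : pointedType) (S : topologicalType) (X : R -> Om -> S)
    (T : Om -> \bar R) : stopping_time X T -> sigma_algebra setT (stopped_sets X T).
Proof.
move=> [_ XT]; split.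
- by move=> t t0; rewrite set0I; exact: sigma_algebra0.
- move=> A FA t t0; rewrite setTD.
  have -> : ~` A `&` [set w | (T w <= t%:E)%E] =
      ~` ((A `&` [set w | (T w <= t%:E)%E]) `|` ~` [set w | (T w <= t%:E)%E]).
    by rewrite setCU setCK setCI setIUl setICl setU0.
  apply: (@sigma_algebraC _ (filtration_gen X t)).
  apply: (@measurableU _ (g_sigma_algebraType (filtration_gen X t))); first exact: FA.
  by apply: sigma_algebraC; exact: XT.
- move=> A FA t t0; rewrite setI_bigcupl.
  by apply: (@sigma_algebra_bigcup _ _ (filtration_gen X t)) => n; exact: FA.
Qed.

End sigma_algebras.

Section measurability.
Context {R : realType} {E : metricType R}.
Variable c : E -> R.
Hypothesis c_cont : continuous c.
Hypothesis c_gt0 : forall y, 0 < c y.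
Variables (Om : pointedType) (Y : R -> Om -> opc E).
Hypothesis gY : forall w, good_path (Y ^~ w).
Implicit Types (t u v r s : R) (U : set E).

Local Notation Omu u := (g_sigma_algebraType (filtration_gen Y u)).

Let mY u r U : 0 <= r -> r <= u -> open U ->
  measurable [set w : Omu u | (Some @` U) (Y r w)].
Proof.
move=> r0 ru oU; apply: sub_sigma_algebra; exists r, (Some @` U).
by split; [rewrite r0|exact: open_Some|].
Qed.

(** The rate is jointly measurable in time and [w] for the past at time [u], by sampling at the
    clamped time; Tonelli's theorem integrates time out. *)
Lemma measurable_clock u : 0 <= u ->
  measurable_fun setT (fun w : Omu u => clock c (Y ^~ w) u).
Proof.
move=> u0.
pose sg (p : measurableTypeR R * Omu u) := Num.min u (Num.max 0 p.1).
have msg : measurable_fun setT sg.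
  by apply: measurable_minr => //; apply: measurable_maxr => //; exact: measurable_fst.
pose f (p : measurableTypeR R * Omu u) : \bar R :=
  (if p.1 \in `[0, u]%R then rate c (Y (sg p) p.2) else 0)%:E.
have mf : measurable_fun setT f.
  apply/measurable_EFinP; apply: measurable_fun_ifT => //.
  - apply: (measurable_fun_bool true); rewrite setTI.
    rewrite (_ : _ @^-1` _ = fst @^-1` `[0, u]%classic)//.
    by rewrite -[X in measurable X]setTI; exact: measurable_fst.
  - apply: (measurable_rate c_cont c_gt0) => U oU.
    refine (@measurable_sampled R E _ _ (fun p : measurableTypeR R * Omu u => Y ^~ p.2)
      sg u (fun p => @gY p.2) msg _ _ _ U oU).
    + by move=> p; rewrite /sg le_min u0 le_max lexx.
    + by move=> p; rewrite /sg ge_min lexx.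
    + move=> r U' r0 ru oU'.
      rewrite (_ : [set _ | _] = snd @^-1` [set w : Omu u | (Some @` U') (Y r w)])//.
      by rewrite -[X in measurable X]setTI; apply: measurable_snd => //; exact: mY.
have f0 p : (0%:E <= f p)%E by rewrite lee_fin; case: ifPn => // _; exact: rate_ge0.
have := @measurable_fun_fubini_tonelli_G _ _ _ _ _ (@lebesgue_measure R) f mf f0.
apply: eq_measurable_fun => w _; rewrite /fubini_G /clock [RHS]integral_mkcond.
apply: eq_integral => s _; rewrite /patch /f /= mem_setE; case: ifPn => //.
rewrite in_itv/= => /andP[s0 su].
by rewrite /sg/= (max_r s0) (min_r su).
Qed.

Lemma hit_stopping_time t : stopping_time Y (fun w => hit c (Y ^~ w) t).
Proof.
split=> [w|u u0]; first exact: hit_ge0.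
rewrite (_ : [set _ | _] = [set w | (t%:E <= clock c (Y ^~ w) u)%E]); last first.
  by apply/seteqP; split=> w /=; rewrite (hit_leP c_cont c_gt0).
have := measurable_clock u0; move=> /emeasurable_fun_c_infty => /(_ measurableT t%:E).
by rewrite setTI.
Qed.

(** On the event that the hitting time is at most [u], the time-changed value is the path sampled at
    the minimum of that time and [u], which is measurable for the past at time [u]. *)
Lemma lamperti_stopped t U : 0 <= t -> open U ->
  stopped_sets Y (fun w => hit c (Y ^~ w) t) [set w | (Some @` U) (lamperti c (Y ^~ w) t)].
Proof.
move=> t0 oU u u0.
pose sg (w : Omu u) : R := fine (mine (hit c (Y ^~ w) t) u%:E).
have sgfin w : (mine (hit c (Y ^~ w) t) u%:E) = (sg w)%:E.
  rewrite /sg fineK// ge0_fin_numE ?le_min ?hit_ge0 ?lee_fin//.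
  by rewrite gt_min ltry orbT.
have sg0 w : 0 <= sg w by rewrite -lee_fin -sgfin le_min hit_ge0 lee_fin.
have sgu w : sg w <= u by rewrite -lee_fin -sgfin ge_min lexx orbT.
have msg : measurable_fun setT sg.
  apply: (measurability _ (RGenOInfty.measurableE R)) => //.
  move=> /= _ [_ [a ->] <-]; rewrite setTI.
  have [a0|a0] := ltP a 0.
    rewrite (_ : _ @^-1` _ = setT)//; apply/seteqP; split=> // w _ /=.
    by rewrite in_itv/= andbT (lt_le_trans a0).
  have [ua|au] := leP u a.
    rewrite (_ : _ @^-1` _ = set0)//; apply/seteqP; split=> // w /=.
    by rewrite in_itv/= andbT ltNge (le_trans (sgu w)).
  rewrite (_ : _ @^-1` _ = ~` [set w | (hit c (Y ^~ w) t <= a%:E)%E]).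
    apply: measurableC; apply: (filtration_mono (ltW au)).
    by have [_] := hit_stopping_time t; exact.
  apply/seteqP; split=> w /=; rewrite in_itv/= andbT -lte_fin -sgfin lt_min lte_fin au andbT.
    by rewrite ltNge => /negP.
  by rewrite ltNge => /negP.
have := @measurable_sampled R E _ (Omu u) (fun w => Y ^~ w) sg u gY msg sg0 sgu (@mY u) U oU.
have [_ /(_ u u0) mu] := hit_stopping_time t.
move=> /(@measurableI _ (Omu u)) => /(_ _ mu).
congr (_ _); apply/seteqP; split=> w [] /= H hu; split=> //; move: H.
  rewrite /lamperti /sg (min_l hu); case hE : (hit _ _ _) hu (hit_ge0 c (Y ^~ w) t) => [r||]//.
rewrite /lamperti /sg (min_l hu); case hE : (hit _ _ _) hu (hit_ge0 c (Y ^~ w) t) => [r||]//.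
Qed.

Lemma stopped_sets_hit_mono s t : 0 <= s -> s <= t ->
  stopped_sets Y (fun w => hit c (Y ^~ w) s) `<=` stopped_sets Y (fun w => hit c (Y ^~ w) t).
Proof.
move=> s0 st A FA u u0; have := FA u u0; have [_ /(_ u u0) mu] := hit_stopping_time t.
move=> /(@measurableI _ (Omu u)) => /(_ _ mu).
congr (_ _); rewrite -setIA; congr (_ `&` _); apply/seteqP; split=> w /= [] //.
move=> tu; split=> //; apply/(hit_leP c_cont c_gt0) => //.
have /(hit_leP c_cont c_gt0 _ (gY w) u0) := tu; apply: le_trans.
by rewrite lee_fin.
Qed.

Lemma opc_open_setE (V : set (opc E)) (z : opc E) :
  V z <-> (Some @` [set y | V (Some y)]) z \/ (~ (Some @` [set: E]) z /\ V None).
Proof.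
case: z => [y|]; split.
- by move=> Vy; left; exists y.
- by case=> [[w Vw [<-]]|[[]]]//; exists y.
- by move=> Vn; right; split=> // -[].
- by case=> [[]|[]].
Qed.

Lemma opc_measurable d (Z : measurableType d) (f : Z -> opc E) :
  (forall U, open U -> measurable [set z | (Some @` U) (f z)]) ->
  forall V, open V -> measurable [set z | V (f z)].
Proof.
move=> mf V oV.
rewrite (_ : [set _ | _] = [set z | (Some @` [set y | V (Some y)]) (f z)] `|`
   (~` [set z | (Some @` [set: E]) (f z)] `&` [set _ | V None])).
  apply: measurableU; first by apply: mf; exact: open_preSome.
  apply: measurableI; first by apply: measurableC; apply: mf; exact: openT.
  have [Vn|Vn] := pselect (V None).
    by rewrite (_ : [set _ | _] = setT)//; apply/seteqP; split.
  by rewrite (_ : [set _ | _] = set0)//; apply/seteqP; split.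
by apply/seteqP; split=> z H; [exact: (proj1 (opc_open_setE V (f z)) H)|
  exact: (proj2 (opc_open_setE V (f z)) H)].
Qed.

Lemma lamperti_filtration_stopped t : 0 <= t ->
  natural_filtration (fun s w => lamperti c (Y ^~ w) s) t `<=`
  stopped_sets Y (fun w => hit c (Y ^~ w) t).
Proof.
move=> t0; have sA s := stopped_sets_sigma_algebra (hit_stopping_time s).
apply: sigma_algebra_sub => // _ [s [V [/andP[s0 st] oV ->]]].
apply: (stopped_sets_hit_mono s0 st).
pose F := stopped_sets Y (fun w => hit c (Y ^~ w) s).
have FE : F = <<s F>> by rewrite sigma_algebra_id//; exact: sA.
rewrite -/F FE.
apply: (@opc_measurable _ (g_sigma_algebraType F) (fun w => lamperti c (Y ^~ w) s)) => // U oU.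
by apply: sub_sigma_algebra; exact: lamperti_stopped.
Qed.

(** A value in [E] means that the hitting time is finite, hence bounded by some integer [n]; the
    event is a countable union of pieces known at the times [n]. *)
Lemma lamperti_measurable (F : set (set Om)) t V : sigma_algebra setT F ->
  (forall s V, 0 <= s -> open V -> F (Y s @^-1` V)) -> 0 <= t -> open V ->
  F [set w | V (lamperti c (Y ^~ w) t)].
Proof.
move=> sF FY t0; have FE : F = <<s F>> by rewrite sigma_algebra_id.
have FN n : natural_filtration Y n `<=` F.
  by apply: sigma_algebra_sub => // _ [s [U [/andP[s0 _] oU ->]]]; exact: FY.
rewrite FE; apply: (@opc_measurable _ (g_sigma_algebraType F)) => U oU.
rewrite (_ : [set _ | _] = \bigcup_n ([set w | (Some @` U) (lamperti c (Y ^~ w) t)] `&`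
    [set w | (hit c (Y ^~ w) t <= n%:R%:E)%E])).
  apply: bigcupT_measurable => n; apply: sub_sigma_algebra.
  apply: (FN n%:R); exact: lamperti_stopped.
apply/seteqP; split=> [w /= H|w [n _ []]//].
have [r hr] : exists r, hit c (Y ^~ w) t = r%:E.
  by move: H; rewrite /lamperti; case: (hit _ _ _) => [r _||[]//]; [exists r|case].
exists (Num.truncn r).+1 => //; split=> //=.
by rewrite hr lee_fin ltW// truncnS_gt.
Qed.

End measurability.

(** Values at negative times are invisible to path events, so two paths may be exchanged as soon as
    they agree at nonnegative times. *)
Lemma path_sets_ext (R : realType) (S : topologicalType) (D : set (R -> S)) :
  path_sets D -> forall x x', (forall t, 0 <= t -> x t = x' t) -> D x -> D x'.
Proof.
move=> PD x x' xx'; suff : D x <-> D x' by case.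
move: D PD; apply: sigma_algebra_sub => /=.
  split=> [|A AE|A AE]; first by split.
    by split=> -[_ nA]; split=> // /AE.
  by split=> -[n _ An]; exists n => //; exact/AE.
by move=> _ [t [U [t0 _ ->]]]; rewrite /= xx'.
Qed.

Lemma countable_base (R : realType) (E : metricType R) (y0 : E) :
  (exists2 Q : set E, countable Q & dense Q) ->
  exists b : nat * nat -> set E, (forall n, open (b n)) /\
    forall U y, open U -> U y -> exists n, b n y /\ b n `<=` U.
Proof.
move=> [Q /countable_injP[g ginj] dQ].
have [q Hq] : exists q : nat -> E, forall z, Q z -> exists n, q n = z.
  have [|z [_ Qz]] := dQ _ _ (@openT E); first by exists y0.
  exists (fun n => 'pinv_(fun=> z) Q g n) => w Qw; exists (g w).
  by rewrite pinvKV// inE.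
exists (fun n => (ball (q n.1) n.2.+1%:R^-1)°); split=> [n|U y]; first exact: open_interior.
rewrite openE => oU /oU /nbhs_ballP[e /= e0 yU].
have e20 : 0 < e / 2 by rewrite divr_gt0.
have [m] := ltr_add_invr e20; rewrite add0r => me.
have m0 : 0 < m.+1%:R^-1 :> R by rewrite invr_gt0.
have m20 : 0 < m.+1%:R^-1 / 2 :> R by rewrite divr_gt0.
have [|z [/interior_subset yz Qz]] := dQ _ _ (open_interior (ball y (m.+1%:R^-1 / 2))).
  by exists y; apply/nbhs_ballP; exists (m.+1%:R^-1 / 2).
have [n qn] := Hq _ Qz.
exists (n, m); rewrite /= qn; split.
  apply/nbhs_ballP; exists (m.+1%:R^-1 / 2) => //= w yw.
  by rewrite (splitr m.+1%:R^-1); apply: ball_triangle yw; exact: ball_sym.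
move=> w /interior_subset zw; apply: yU.
rewrite (splitr e); apply: (@ball_triangle _ _ z).
  apply: le_ball yz; rewrite ltW// (lt_trans _ me)//.
  by rewrite ltr_pdivrMr// ltr_pMr// ltr1n.
by apply: le_ball zw; exact: ltW.
Qed.

(** The set of good paths is not known to be measurable; this class allows an induction over events
    that looks at good paths only. *)
Lemma good_equiv_sigma_algebra (R : realType) (E : metricType R) (G : set (set (R -> opc E))) :
  sigma_algebra setT G ->
  sigma_algebra setT [set D | exists2 D', G D' & forall x, good_path x -> (D x <-> D' x)].
Proof.
move=> [G0 GC GU]; split.
- by exists set0.
- move=> A [D' GD' AD]; exists (setT `\` D'); first exact: GC.
  by move=> x gx; split=> -[_ nA]; split=> // /(AD x gx).
- move=> A HA; have /choice[D' HD'] : forall n, exists D', G D' /\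
      forall x, good_path x -> (A n x <-> D' x).
    by move=> n; have [D' ? ?] := HA n; exists D'.
  exists (\bigcup_n D' n); first by apply: GU => n; have [] := HD' n.
  by move=> x gx; split=> -[n _ An]; exists n => //;
    have [_ /(_ x gx)[? ?]] := HD' n; auto.
Qed.

(** * Measurable functionals of a path *)

Section path_functionals.
Context {R : realType} {E : metricType R}.
Hypothesis E_separable : exists2 Q : set E, countable Q & dense Q.

Definition opc2 (op : E -> E -> E) (a b : opc E) : opc E :=
  if a is Some u then omap (op u) b else None.

(** By continuity an open condition on a pair is a countable union of rectangles of basic open sets,
    which avoids a product sigma-algebra on [E * E]. *)
Lemma measurable_opc2 d (Z : measurableType d) (op : E -> E -> E) (A B : Z -> opc E) :
  continuous (fun p : E * E => op p.1 p.2) ->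
  (forall U, open U -> measurable [set z | (Some @` U) (A z)]) ->
  (forall U, open U -> measurable [set z | (Some @` U) (B z)]) ->
  forall U, open U -> measurable [set z | (Some @` U) (opc2 op (A z) (B z))].
Proof.
move=> cop mA mB U oU; have [[y0]|E0] := pselect (inhabited E); last first.
  rewrite (_ : [set _ | _] = set0); first exact: measurable0.
  by apply/seteqP; split=> // z [w _ _]; case: E0; exists.
have [b [ob Hb]] := countable_base y0 E_separable.
pose I := [set ij : (nat * nat) * (nat * nat) |
  forall u v, b ij.1 u -> b ij.2 v -> U (op u v)].
rewrite (_ : [set _ | _] = \bigcup_(ij in I)
  ([set z | (Some @` b ij.1) (A z)] `&` [set z | (Some @` b ij.2) (B z)])).
  rewrite bigcup_mkcond; apply: countable_bigcupT_measurable; first exact: countableP.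
  move=> ij; case: ifPn => _; last exact: measurable0.
  by apply: measurableI; [apply: mA|apply: mB].
apply/seteqP; split=> z /=.
  case Az : (A z) => [u|]; case Bz : (B z) => [v|] //= -[w Uw // [wE]].
  have : nbhs (u, v) [set p | U (op p.1 p.2)].
    by apply: (cop (u, v)); apply: open_nbhs_nbhs; split=> //; rewrite /= -wE.
  move=> [[V W] /= [uV vW] VW].
  move: uV vW; rewrite !nbhsE => -[V' [oV' V'u] V'V] [W' [oW' W'v] W'W].
  have [i [iu iV]] := Hb _ _ oV' V'u; have [j [jv jW]] := Hb _ _ oW' W'v.
  exists (i, j); last by split=> /=; [exists u|exists v]; rewrite ?Az ?Bz.
  by move=> u' v' /= /iV/V'V Vu /jW/W'W Wv; exact: (VW (u', v')).
move=> [ij Iij [[u bu uE] [v bv vE]]]; rewrite -uE -vE /=.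
by exists (op u v) => //; exact: Iij.
Qed.

(** The clock of an arbitrary path need not be measurable in the path; replacing
    the bad paths, which have no mass, makes it so. *)
Definition kill_bad (x : R -> opc E) : R -> opc E :=
  if `[< good_path x >] then x else cst None.

Lemma good_path_kill_bad x : good_path (kill_bad x).
Proof. by rewrite /kill_bad; case: asboolP => // _; exact: good_path_None. Qed.

Lemma kill_badE x : good_path x -> kill_bad x = x.
Proof. by rewrite /kill_bad; case: asboolP. Qed.

Definition kill_bad_gen : set (set (R -> opc E)) :=
  [set B | exists t V, [/\ 0 <= t, open V & B = [set x | V (kill_bad x t)]]].

Definition kill_bad_sets : set (set (R -> opc E)) := <<s kill_bad_gen >>.

Lemma kill_bad_path_sets D : kill_bad_sets D ->
  exists2 D', path_sets D' & forall x, good_path x -> (D x <-> D' x).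
Proof.
move: D; apply: sigma_algebra_sub.
  by apply: good_equiv_sigma_algebra; exact: smallest_sigma_algebra.
move=> _ [t [V [t0 oV ->]]]; exists [set x | V (x t)].
  by apply: sub_sigma_algebra; exists t, V.
by move=> x gx /=; rewrite kill_badE.
Qed.

Variable c : E -> R.
Hypothesis c_cont : continuous c.
Hypothesis c_gt0 : forall y, 0 < c y.
Variable op : E -> E -> E.
Hypothesis op_cont : continuous (fun p : E * E => op p.1 p.2).

(** Meant for the path restarted at a hitting time, whose starting point [x 0] is the current value
    of the time change. *)
Definition increments_path (x : R -> opc E) (s : R) : opc E :=
  opc2 op (x 0) (lamperti c x s).

(** The Markov property speaks of events on the path itself, so an event on the increments is pulled
    back to one. The condition on [x 0] excludes the dead path, so that the cemetery will contribute
    nothing. *)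
Lemma increments_path_sets D : path_sets D ->
  exists2 D', path_sets D' &
    forall x, good_path x -> (D (increments_path x) /\ x 0 <> None) <-> D' x.
Proof.
move=> PD.
have sF := @smallest_sigma_algebra _ setT kill_bad_gen.
pose Y (t : R) (x : R -> opc E) := kill_bad x t.
have gY x : good_path (Y ^~ x) by exact: good_path_kill_bad.
have Ym s V : 0 <= s -> open V -> kill_bad_sets (Y s @^-1` V).
  by move=> s0 oV; apply: sub_sigma_algebra; exists s, V.
pose D1 := [set x | D (increments_path (kill_bad x))] `&`
           [set x | (Some @` [set: E]) (kill_bad x 0)].
have mD1 : kill_bad_sets D1.
  apply: (@measurableI _ (g_sigma_algebraType kill_bad_gen)).
    apply: (path_sets_preimage (F := kill_bad_sets)) PD => // t V t0 oV.
    apply: (@opc_measurable _ E _ (g_sigma_algebraType kill_bad_gen)) oV => U oU.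
    apply: (@measurable_opc2 _ (g_sigma_algebraType kill_bad_gen)) oU => // W oW.
      by apply: (Ym 0) => //; exact: open_Some.
    have := @lamperti_measurable _ _ c c_cont c_gt0 _ Y gY kill_bad_sets t (Some @` W) sF Ym t0.
    by apply; exact: open_Some.
  by apply: Ym => //; apply: open_Some; exact: openT.
have [D' PD' HD'] := kill_bad_path_sets mD1.
exists D' => // x gx; rewrite -HD'// /D1 /setI/= kill_badE//.
have -> : x 0 <> None <-> (Some @` [set: E]) (x 0) => //.
by case: (x 0) => [y|]; split=> // -[].
Qed.

End path_functionals.

Lemma measure_bigcup_le_mul d (T : measurableType d) (R : realType) (mu : probability T R)
    (A B : nat -> set T) (e : R) :
  (forall n, measurable (A n)) -> (forall n, measurable (B n)) -> trivIset setT B ->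
  (forall n, (mu (A n) <= e%:E * mu (B n))%E) ->
  (mu (\bigcup_n A n) <= e%:E * mu (\bigcup_n B n))%E.
Proof.
move=> mA mB tB AB.
have mUA : measurable (\bigcup_n A n) by exact: bigcupT_measurable.
apply: (le_trans (measure_sigma_subadditive mu mA mUA (@subset_refl _ _))).
apply: (@le_trans _ _ (\sum_(0 <= n <oo) (e%:E * mu (B n))%E)%E).
  apply: lee_nneseries => [n _ _|n _]; [exact: measure_ge0|exact: AB].
rewrite measure_bigcup// nneseriesZl//.
rewrite le_eqVlt; apply/orP; left; apply/eqP; congr (_ * _)%E.
by apply: eq_eseriesl => n; rewrite in_setT.
Qed.

Lemma dyadic_between (R : realType) (s u v : R) : 0 < s -> 0 <= u -> u < v -> u < s ->
  exists m j, [/\ (j < 2 ^ m)%N, u <= j%:R * s / 2 ^+ m & j%:R * s / 2 ^+ m < v].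
Proof.
(* Capping [v] at [s] makes the grid point smaller than [s], which gives [j < 2 ^ m]. *)
move=> s0 u0 uv us; pose e := Num.min v s - u.
have e0 : 0 < e by rewrite subr_gt0 lt_min uv.
have [m] := ltr_add_invr (divr_gt0 e0 s0); rewrite add0r => me.
have m0 : 0 < 2 ^+ m :> R by rewrite exprn_gt0.
have sm : s / 2 ^+ m < e.
  rewrite ltr_pdivrMr// mulrC -ltr_pdivrMr//.
  rewrite -[s / e]invrK invf_div -(invrK (2 ^+ m)).
  rewrite ltf_pV2 ?posrE ?invr_gt0 ?divr_gt0//; apply: le_lt_trans me.
  rewrite lef_pV2 ?posrE ?ltr0n//.
  by rewrite -natrX ler_nat ltn_expl.
exists m, (Num.truncn (u * 2 ^+ m / s)).+1.
set j := Num.truncn _.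
have um0 : 0 <= u * 2 ^+ m / s by rewrite !mulr_ge0// ?invr_ge0 ltW.
have uj : u <= j.+1%:R * s / 2 ^+ m.
  by rewrite ler_pdivlMr// -ler_pdivrMr// ltW// truncnS_gt.
have jv : j.+1%:R * s / 2 ^+ m < Num.min v s.
  rewrite -(subrK u (Num.min v s)) -/e addrC.
  apply: (@le_lt_trans _ _ (u + s / 2 ^+ m)); last by rewrite ltrD2l.
  rewrite -natr1 2!mulrDl mul1r lerD2r ler_pdivrMr// -ler_pdivlMr//.
  by rewrite truncn_le.
split=> //.
  have := jv; rewrite lt_min => /andP[_].
  by rewrite ltr_pdivrMr// mulrC ltr_pM2l// -natrX ltr_nat.
by apply: lt_le_trans jv _; rewrite ge_min lexx.
Qed.

(** * A path confined to a compact set *)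

Section trapped.
Context {R : realType} {E : metricType R}.
Variable c : E -> R.
Hypothesis c_cont : continuous c.
Hypothesis c_gt0 : forall y, 0 < c y.
Implicit Types (x : R -> opc E) (t u v r s : R) (y : E).

(** The path cannot die: without instantaneous killing it would tend to [None], hence leave [K]. Its
    rate is then at least the minimum of [c] on [K], which is positive, so the clock reaches every
    level. *)
Lemma trapped_immortal x r K : good_path x -> 0 <= r -> x r <> None -> compact K ->
  (forall v, r <= v -> x v <> None -> (Some @` K) (x v)) ->
  forall t, 0 <= t -> lamperti c x t <> None.
Proof.
move=> gx r0 xr cK HK t t0; have [cx abs _ killed] := gx.
have alive v : 0 <= v -> x v <> None.
  move=> v0 xv; pose A := [set u | 0 <= u /\ x u = None].
  have A0 : A !=set0 by exists v.
  have Alb : has_lbound A by exists 0 => u [].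
  have rA u : A u -> r < u.
    by move=> [u0 xu]; rewrite ltNge; apply/negP => ur; exact/xr/(abs u).
  set z := inf A.
  have rz : r <= z by apply: lb_le_inf => // u /rA/ltW.
  have z0 : 0 <= z by exact: le_trans rz.
  have below u : 0 <= u -> u < z -> x u <> None.
    move=> u0 uz xu; have : z <= u by apply: ge_inf.
    by rewrite leNgt uz.
  have xz : x z = None.
    case xzy : (x z) => [y|//].
    have [e e0 He] : exists2 e, 0 < e & forall s, z <= s -> s < z + e ->
        (Some @` [set: E]) (x s).
      apply: (@cadlag_right _ _ x z _ cx) => //.
      by rewrite xzy; apply: one_point_compactification_some_nbhs; exact: filterT.
    have [u [u0 xu] uz] := inf_adherent e0 (conj A0 Alb).
    have zu : z <= u by apply: ge_inf.
    by have [w _] := He u zu uz; rewrite xu.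
  have rz' : r < z by apply: rA.
  have zgt0 : 0 < z by exact: le_lt_trans rz'.
  have := killed z zgt0 xz below (~` (Some @` K)); rewrite nbhs_simpl => -[].
    by apply: open_nbhs_nbhs; split; [exact: open_SomeC|move=> []].
  move=> e /= e0 He; pose u := Num.max r (z - e / 2).
  have uz : u < z by rewrite gt_max rz' gtrBl divr_gt0.
  have ru : r <= u by rewrite le_max lexx.
  apply: (He u) => //; last by apply: HK => //; apply: below => //; exact: le_trans ru.
  rewrite /ball/= gtr0_norm ?subr_gt0// ltrBlDl -ltrBlDr lt_max; apply/orP; right.
  by rewrite ltrD2l ltrN2 ltr_pdivrMr// ltr_pMr// ltr1n.
have [y Ky xy] := HK r (lexx _) xr.
have K0 : K !=set0 by exists y.
have cc : {within K, continuous c} by apply: continuous_subspaceT.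
have [ym Kym Hm] := compact_EVT_min K0 cK cc.
have [yM KyM HM] := compact_EVT_max K0 cK cc.
(* At the minimal rate [c ym], the clock advances by [t] between [r] and [v]. *)
have m0 := c_gt0 ym; pose v := r + t / c ym.
have rv : r <= v by rewrite lerDl divr_ge0// ltW.
have v0 : 0 <= v by exact: le_trans rv.
have [|H _] := @clock_bounds _ _ c c_cont c_gt0 x r v (c ym) (c yM) gx r0 rv (ltW m0).
  move=> s rs sv; have [z Kz <-] := HK s rs (alive s (le_trans r0 rs)).
  by split; [apply: Hm|apply: HM]; rewrite inE.
have tv : (t%:E <= clock c x v)%E.
  apply: le_trans H; have -> : v - r = t / c ym by rewrite /v addrC addKr.
  rewrite mulrCA mulfV ?gt_eqF// mulr1.
  by rewrite leeDr// clock_ge0.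
have hv : (hit c x t <= v%:E)%E by apply/(hit_leP c_cont c_gt0).
rewrite /lamperti; case hq : (hit c x t) hv (hit_ge0 c x t) => [q||]//.
by rewrite lee_fin => _ q0; apply: alive.
Qed.
End trapped.

Definition cylinders (R : realType) (S : topologicalType) : set (set (R -> S)) :=
  [set D | exists t U, [/\ 0 <= t, open U & D = [set x | U (x t)]] ].

Lemma open_metric_ball (R : realType) (E : metricType R) (z : E) (e : R) : open (ball z e).
Proof.
rewrite openE => y; rewrite ballEmdist/= => zy.
apply/nbhs_ballP; exists (e - mdist z y); first by rewrite /= subr_gt0.
move=> x; rewrite !ballEmdist/= ltrBrDl; apply: le_lt_trans.
exact: metric_triangle.
Qed.

(** * Countably many events that determine a law *)

Section rational_times.
Context {R : realType} {E : metricType R}.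
Variable b : nat * nat -> set E.
Hypothesis b_open : forall n, open (b n).
Hypothesis b_base : forall U y, open U -> U y -> exists n, b n y /\ b n `<=` U.
Local Notation time p := (p.1%:R / p.2.+1%:R : R).

(** A countable family determining the law of a process with good paths: null
    sets may depend on the event, hence have to be discarded event by event. *)
Definition rational_event (s : seq ((nat * nat) * (nat * nat))) : set (R -> opc E) :=
  [set x | forall p, p \in s -> (Some @` b p.2) (x (time p.1))].

Definition rational_events : set (set (R -> opc E)) := range rational_event.

Lemma rational_events_setI : setI_closed rational_events.
Proof.
move=> _ _ [s _ <-] [s' _ <-]; exists (s ++ s') => //.
apply/seteqP; split=> x /=.
  by move=> H; split=> p ps; apply: H; rewrite mem_cat ps ?orbT.
by move=> [H H'] p; rewrite mem_cat => /orP[/H|/H'].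
Qed.

Lemma path_sets_rational_event s : path_sets (rational_event s).
Proof.
elim: s => [|p s IHs].
  rewrite (_ : rational_event [::] = setT); last by apply/seteqP; split.
  by apply: (@measurableT _ (g_sigma_algebraType (@cylinders R (opc E)))).
rewrite (_ : rational_event (p :: s) =
    [set x | (Some @` b p.2) (x (time p.1))] `&` rational_event s).
  apply: (@measurableI _ (g_sigma_algebraType (@cylinders R (opc E)))) => //.
  apply: sub_sigma_algebra; exists (time p.1), (Some @` b p.2); split=> //.
  exact: open_Some.
apply/seteqP; split=> x /=.
  by move=> H; split=> [|q qs]; apply: H; rewrite inE ?eqxx// qs orbT.
by move=> [H H'] q; rewrite inE => /predU1P[->|/H'].
Qed.

(** Right-continuity recovers the value at [t] from the values at the rational times [round_up], and
    the base recovers the open sets of [E]. *)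
Lemma path_sets_rational D : path_sets D ->
  exists2 D', <<s rational_events >> D' & forall x, good_path x -> (D x <-> D' x).
Proof.
move: D; apply: sigma_algebra_sub.
  by apply: good_equiv_sigma_algebra; exact: smallest_sigma_algebra.
move=> _ [t [V [t0 oV ->]]].
pose Z := g_sigma_algebraType rational_events.
have mq (p : nat * nat) U : open U -> measurable [set x : Z | (Some @` U) (x (time p))].
  move=> oU; rewrite (_ : [set _ | _] =
      \bigcup_(n in [set n | b n `<=` U]) rational_event [:: (p, n)]).
    rewrite bigcup_mkcond; apply: countable_bigcupT_measurable; first exact: countableP.
    move=> n; case: ifPn => _; last exact: measurable0.
    by apply: sub_sigma_algebra; exists [:: (p, n)].
  apply/seteqP; split=> x /=.
    move=> [y Uy yx]; have [n [ny nU]] := b_base oU Uy; exists n => //.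
    by move=> q; rewrite inE => /eqP -> /=; exists y.
  move=> [n nU /(_ (p, n))]; rewrite inE eqxx => /(_ isT)[y ny yx].
  by exists y => //; exact: nU.
pose N := (Num.truncn t).+1.
have tN : t <= N%:R by rewrite ltW// truncnS_gt.
pose A (U : set E) : set Z := \bigcup_m \bigcup_K \bigcap_(n in [set n | (K <= n)%N])
  [set x : Z | (Some @` shrink U m) (x (round_up N%:R n t))].
have mA U : measurable (A U).
  apply: bigcupT_measurable => m; apply: bigcupT_measurable => K.
  apply: bigcap_measurable; first by exists K => /=.
  move=> n _; rewrite /round_up; case: (leP N%:R).
    move=> _; rewrite (_ : N%:R = time (N, 0%N)); last by rewrite /= divr1.
    by apply: mq; exact: open_shrink.
  move=> _; rewrite (_ : _ / _ = time ((Num.truncn (t * n.+1%:R)).+1, n))//.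
  by apply: mq; exact: open_shrink.
have AE U x : open U -> good_path x -> (Some @` U) (x t) <-> A U x.
  move=> oU gx; rewrite (good_path_SomeE gx t0 tN oU); split.
    by move=> [m [K H]]; exists m => //; exists K => // n Kn; exact: H.
  by move=> [m _ [K _ H]]; exists m, K => n Kn; exact: H.
exists (A [set y | V (Some y)] `|` (~` A setT `&` [set _ | V None])).
  apply: (@measurableU _ Z) => //; apply: measurableI; first exact: measurableC.
  have [Vn|Vn] := pselect (V None).
    by rewrite (_ : [set _ | _] = setT)//; apply/seteqP; split.
  by rewrite (_ : [set _ | _] = set0)//; apply/seteqP; split.
move=> x gx; rewrite [X in X <-> _](opc_open_setE V (x t)).
rewrite (AE _ x (open_preSome oV) gx) (AE _ x openT gx).
by split.
Qed.

(** Concatenation of lists makes the rational events stable under intersection, so Dynkin's theorem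
    extends the equality to the sigma-algebra that they generate. *)
Lemma eq_law_rational d1 d2 (Om1 : measurableType d1) (Om2 : measurableType d2)
    (P1 : probability Om1 R) (P2 : probability Om2 R)
    (X1 : R -> Om1 -> opc E) (X2 : R -> Om2 -> opc E) :
  (forall w, good_path (X1 ^~ w)) -> (forall w, good_path (X2 ^~ w)) ->
  (forall D, path_sets D -> measurable [set w | D (X1 ^~ w)]) ->
  (forall D, path_sets D -> measurable [set w | D (X2 ^~ w)]) ->
  (forall s, P1 [set w | rational_event s (X1 ^~ w)] =
             P2 [set w | rational_event s (X2 ^~ w)]) ->
  eq_law P1 P2 X1 X2.
Proof.
move=> g1 g2 m1 m2 E12 D /path_sets_rational[D' GD' DD'].
have -> : [set w | D (X1 ^~ w)] = [set w | D' (X1 ^~ w)].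
  by apply/seteqP; split=> w Dw; [exact: (proj1 (DD' _ (g1 w)) Dw)|
    exact: (proj2 (DD' _ (g1 w)) Dw)].
have -> : [set w | D (X2 ^~ w)] = [set w | D' (X2 ^~ w)].
  by apply/seteqP; split=> w Dw; [exact: (proj1 (DD' _ (g2 w)) Dw)|
    exact: (proj2 (DD' _ (g2 w)) Dw)].
have Gp : <<s rational_events >> `<=` @path_sets R (opc E).
  apply: sigma_algebra_sub; first exact: smallest_sigma_algebra.
  by move=> _ [s _ <-]; exact: path_sets_rational_event.
pose Z := g_sigma_algebraType rational_events.
apply: (@dynkin_induction _ Z rational_events (fun D => P1 [set w | D (X1 ^~ w)] =
             P2 [set w | D (X2 ^~ w)])) GD' => //.
- exact: rational_events_setI.
- by rewrite !probability_setT.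
- by move=> _ [s _ <-].
- move=> S mS PS.
  have -> : [set w | (~` S) (X1 ^~ w)] = ~` [set w | S (X1 ^~ w)] by [].
  have -> : [set w | (~` S) (X2 ^~ w)] = ~` [set w | S (X2 ^~ w)] by [].
  by rewrite !probability_setC ?PS//; [apply: m2|apply: m1]; exact: Gp.
- move=> F mF tF PF.
  have -> : [set w | (\bigcup_k F k) (X1 ^~ w)] = \bigcup_k [set w | F k (X1 ^~ w)] by [].
  have -> : [set w | (\bigcup_k F k) (X2 ^~ w)] = \bigcup_k [set w | F k (X2 ^~ w)] by [].
  have tr (T : Type) (f : T -> R -> opc E) : trivIset setT (fun k => [set w | F k (f w)]).
    apply/trivIsetP => i j _ _ ij; apply/seteqP; split=> // w [] /= Fi Fj.
    move/trivIsetP : tF => /(_ i j I I ij) Fij.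
    by have : (F i `&` F j) (f w) by []; rewrite Fij.
  rewrite measure_bigcup; [|by move=> k _; apply: m1; apply: Gp; exact: mF|exact: tr].
  rewrite measure_bigcup; [|by move=> k _; apply: m2; apply: Gp; exact: mF|exact: tr].
  by apply: eq_eseriesr => k _; exact: PF.
Qed.

End rational_times.

(** Joint continuity controls [h z x'] for [z] near [y] and [x'] near one point; compactness makes
    the control uniform. This is the topology in which the symmetries are isolated. *)
Lemma cvg_family_compact_id (R : realType) (E : metricType R) (h : E -> E -> E) (y : E) :
  continuous (fun p : E * E => h p.1 p.2) -> h y = id -> {family compact, h @ y --> (id : E -> E)}.
Proof.
move=> ch hy; apply/fam_cvgP => K cK P /uniform_nbhs[A [entA AP]].
move: entA; rewrite -entourage_from_ballE => -[e /= e0 eA].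
suff H : \forall z \near y, K `<=` (fun x => ball x e (h z x)).
  by apply: (filterS _ H) => z Kz; apply: AP => x Kx; apply: eA; exact: Kz.
move/compact_near_coveringP : cK; apply => x Kx.
have e20 : 0 < e / 2 by rewrite divr_gt0.
have hyx : nbhs (h (y, x).1 (y, x).2) (ball x (e / 2)).
  by rewrite /= hy; exact: nbhsx_ballx.
have [[V W] /= [yV xW] VW] := ch (y, x) _ hyx.
exists (W `&` ball x (e / 2), V) => /=.
  by split=> //; apply: filterI => //; exact: nbhsx_ballx.
move=> [x' z] /= [[Wx' xx'] Vz]; rewrite (splitr e).
by apply: ball_triangle (ball_sym xx') _; exact: (VW (z, x')).
Qed.

(** * The time-changed process *)

Section killed_levy.
Context {R : realType} {E : metricType R}.
Hypothesis E_separable : exists2 Q : set E, countable Q & dense Q.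
Context {d : E -> measure_display} {Om : forall y, measurableType (d y)}.
Variable P : forall y, probability (Om y) R.
Variable X : forall y, R -> Om y -> opc E.
Arguments X : clear implicits.
Hypothesis X_markov : strong_markov_process P X.
Variables (y0 : E) (f finv : E -> E -> E) (c : E -> R).
Hypothesis X_selfsimilar : invariance_components P X y0 f finv c.
Hypothesis fc_good : good_components y0 f c.
Implicit Types (t s : R) (y z : E).

Let fK y : cancel (f y) (finv y). Proof. by case: X_selfsimilar => /(_ y)[]. Qed.
Let finvK y : cancel (finv y) (f y). Proof. by case: X_selfsimilar => /(_ y)[]. Qed.
Let f_cont : continuous (fun p : E * E => f p.1 p.2).
Proof. by case: X_selfsimilar => _ []. Qed.
Let finv_cont : continuous (fun p : E * E => finv p.1 p.2).
Proof. by case: X_selfsimilar => _ []. Qed.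
Let c_gt0 y : 0 < c y. Proof. by case: X_selfsimilar. Qed.
Let c_cont : continuous c. Proof. by case: X_selfsimilar. Qed.
Let cM y z : c (f y z) = c y * c z. Proof. by case: fc_good. Qed.

Lemma continuous_section (op : E -> E -> E) y :
  continuous (fun p : E * E => op p.1 p.2) -> continuous (op y).
Proof.
move=> cop z; apply: (@continuous_comp _ _ _ (pair y) (fun p => op p.1 p.2) z).
  by apply: cvg_pair; [exact: cvg_cst|exact: cvg_id].
exact: cop.
Qed.

Lemma f_homeo y : homeomorphism (f y).
Proof.
by exists (finv y); split; rewrite //; exact: continuous_section.
Qed.

Lemma good_X y w : good_path (X y ^~ w).
Proof. by case: X_markov => _ /(_ y w)/path_from_good. Qed.

Lemma X0 y w : X y 0 w = Some y.
Proof. by case: X_markov => _ /(_ y w)[]. Qed.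

Lemma measurable_X_path y D : path_sets D -> measurable [set w | D (X y ^~ w)].
Proof.
apply: (path_sets_preimage (F := measurable)); first exact: sigma_algebra_measurable.
by move=> t U t0 oU; case: X_markov => /(_ y t U t0 oU).
Qed.

Lemma filtration_measurable y t : natural_filtration (X y) t `<=` measurable.
Proof.
apply: sigma_algebra_sub; first exact: sigma_algebra_measurable.
by move=> _ [s [U [/andP[s0 _] oU ->]]]; case: X_markov => /(_ y s U s0 oU).
Qed.

(** Self-similarity at time 0: [X y] starts at [y], and the transported process at [f y y0]. *)
Lemma f_right_neutral y : f y y0 = y.
Proof.
apply: contrapT => fy.
have [_ _ _ _ /(_ y [set x | (Some @` (~` [set y])) (x 0)])] := X_selfsimilar.
have PD : path_sets [set x : R -> opc E | (Some @` (~` [set y])) (x 0)].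
  apply: sub_sigma_algebra; exists 0, (Some @` (~` [set y])); split=> //.
  apply: open_Some; apply: closed_openC; apply: compact_closed_metric.
  exact: compact_set1.
move=> /(_ PD).
rewrite (_ : [set w | _] = set0); last first.
  by apply/seteqP; split=> // w /=; rewrite X0 => -[z zy [zE]]; apply: zy.
rewrite (_ : [set w | _] = setT); last first.
  by apply/seteqP; split=> // w _ /=; rewrite mulr0 X0; exists (f y y0).
by rewrite measure0 probability_setT => /eqP; rewrite eq_sym onee_eq0.
Qed.

Lemma good_scaled_homeo (h : E -> E) k w : homeomorphism h -> 0 < k ->
  good_path (fun t => extend h (X y0 (k * t) w)).
Proof.
move=> hh k0; rewrite (_ : (fun _ => _) = extend h \o (fun t => X y0 (0 + k * t) w)).
  apply: good_path_extend => //.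
  by apply: (@good_path_affine _ _ (X y0 ^~ w)) => //; exact: good_X.
by apply/funext => t /=; rewrite add0r.
Qed.

Local Notation L := (fun t w => lamperti c (X y0 ^~ w) t).
Local Notation hit_at t := (fun w => hit c (X y0 ^~ w) t).

Definition law_L (D : set (R -> opc E)) : \bar R := P y0 [set w | D (L ^~ w)].

Lemma measurable_L t V : 0 <= t -> open V -> measurable [set w | V (L t w)].
Proof.
move=> t0 oV.
apply: (@lamperti_measurable _ _ c c_cont c_gt0 _ (X y0) (good_X (y := y0))) => //.
  exact: sigma_algebra_measurable.
by move=> s U s0 oU; case: X_markov => /(_ y0 s U s0 oU).
Qed.

Lemma measurable_L_alive t : 0 <= t -> measurable [set w | L t w <> None].
Proof.
move=> t0; rewrite (_ : [set _ | _] = [set w | (Some @` [set: E]) (L t w)]).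
  by apply: measurable_L => //; apply: open_Some; exact: openT.
by apply/seteqP; split=> w /=; case: (lamperti _ _ _) => [y|]//; [move=> _; exists y|move=> []].
Qed.

Lemma stopped_measurable t A : stopped_sets (X y0) (hit_at t) A ->
  measurable (A `&` [set w | (hit_at t w < +oo)%E]).
Proof.
move=> sA; rewrite (_ : _ `&` _ = \bigcup_n (A `&` [set w | (hit_at t w <= n%:R%:E)%E])).
  by apply: bigcupT_measurable => n; apply: filtration_measurable; exact: sA.
apply/seteqP; split=> w [].
  move=> Aw Hw; have := hit_ge0 c (X y0 ^~ w) t.
  move: Hw => /=; case E1 : (hit _ _ _) => [r||]// _ r0.
  exists (Num.truncn r).+1 => //; split=> //=.
  by rewrite E1 lee_fin ltW// truncnS_gt.
by move=> n _ [Aw /= Hn]; split=> //=; apply: le_lt_trans Hn _; rewrite ltry.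
Qed.

(** [X y] is distributed as [f y] applied to [X y0] run at speed [c y]. Its time change is [f y]
    applied to [L], by [cM] and [lamperti_scale], and [finv y] undoes [f y]: the dependence on [y]
    is gone. *)
Lemma law_from_increments y D D' :
  path_sets D' -> path_sets D ->
  (forall x, good_path x -> (D (increments_path c finv x) /\ x 0 <> None) <-> D' x) ->
  P y [set w | D' (X y ^~ w)] = law_L D.
Proof.
move=> PD' PD HD'; have [_ _ _ _ /(_ y D' PD')->] := X_selfsimilar.
rewrite /law_L; congr (P y0 _).
have incE w s : 0 <= s ->
    increments_path c finv (fun t => extend (f y) (X y0 (c y * t) w)) s = L s w.
  move=> s0; rewrite /increments_path mulr0 X0 /= f_right_neutral.
  have /= -> := lamperti_scale c_cont c_gt0 (good_X w) (f_homeo y) (c_gt0 y) s0 (cM y).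
  by case: (lamperti _ _ _) => //= z; rewrite fK.
apply/seteqP; split=> w /=.
  move=> /(proj2 (HD' _ (good_scaled_homeo w (f_homeo y) (c_gt0 y))))[+ _].
  by apply: path_sets_ext => // t t0; rewrite incE.
move=> DL; apply: (proj1 (HD' _ (good_scaled_homeo w (f_homeo y) (c_gt0 y)))); split.
  by apply: path_sets_ext DL => // t t0; rewrite incE.
by rewrite mulr0 X0.
Qed.

Definition increments t w s : opc E := opc2 finv (L t w) (L (t + s) w).

(** The increments of [L] after [t] are those of the time change of
    [X y0 (hit_at t + .)], hence, by the strong Markov property at [hit_at t],
    of [X y] with [y = L t]; by self-similarity their law is that of [L]. *)
Lemma killed_levy t A D : 0 <= t -> stopped_sets (X y0) (hit_at t) A -> path_sets D ->
  P y0 (A `&` [set w | L t w <> None /\ D (increments t w)]) =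
  (P y0 (A `&` [set w | L t w <> None]) * law_L D)%E.
Proof.
move=> t0 sA PD.
have [D' PD' HD'] := increments_path_sets E_separable c_cont c_gt0 finv_cont PD.
have Hst := hit_stopping_time c_cont c_gt0 (good_X (y := y0)) t.
have [_ _ _ /(_ y0 (hit_at t) Hst A sA D' PD')] := X_markov.
have incE w r s : hit c (X y0 ^~ w) t = r%:E -> X y0 r w <> None -> 0 <= s ->
    increments_path c finv (fun s => X y0 (r + s) w) s = increments t w s.
  move=> hr xr s0; rewrite /increments_path addr0 (lamperti_shift c_cont c_gt0 (good_X w) t0 s0 hr xr).
  by rewrite /increments [in RHS]/lamperti hr.
have gsh w r : 0 <= r -> good_path (fun s => X y0 (r + s) w).
  move=> r0; rewrite (_ : (fun _ => _) = (fun s => X y0 (r + 1 * s) w)).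
    by apply: (@good_path_affine _ _ (X y0 ^~ w)) => //; exact: good_X.
  by apply/funext => s; rewrite mul1r.
rewrite (_ : A `&` [set w | _ /\ _] =
    A `&` [set w | L t w <> None /\ D (increments t w)]); last first.
  apply/seteqP; split=> w [Aw] /= [].
    have := hit_ge0 c (X y0 ^~ w) t; case hr : (hit _ _ _) => [r||]//= r0 _ HD; split=> //.
    have [Dr] := proj2 (HD' _ (gsh w r r0)) HD; rewrite addr0 => xr.
    rewrite /lamperti hr; split=> //.
    by apply: path_sets_ext Dr => // s s0; rewrite (incE w r).
  have := hit_ge0 c (X y0 ^~ w) t.
  rewrite {1}/lamperti; case hr : (hit _ _ _) => [r||]//= r0 xr Dr; split=> //; split; first by rewrite ltry.
  apply: (proj1 (HD' _ (gsh w r r0))); rewrite addr0; split=> //.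
  by apply: path_sets_ext Dr => // s s0; rewrite (incE w r).
move=> ->.
set B := [set w | L t w <> None].
set A' := A `&` [set w | (hit_at t w < +oo)%E].
have mA' : measurable A' by exact: stopped_measurable.
(* The integrand of the strong Markov property is the constant [law_L D] while [L t] is alive, and 0
   otherwise since [D'] excludes the dead path. *)
rewrite (@eq_integral _ _ _ _ _ ((cst (law_L D)) \_ B)); last first.
  move=> w /[!inE] -[_ /=]; rewrite /patch.
  case hr : (hit _ _ _) (hit_ge0 c (X y0 ^~ w) t) => [r||]//= _ _.
  have LE : L t w = X y0 r w by rewrite /lamperti hr.
  case xr : (X y0 r w) LE => [y|] LE /=.
    rewrite ifT; first exact: law_from_increments HD'.
    by rewrite inE /B /= LE.
  rewrite ifF; last by apply/negbTE; rewrite notin_setE /B/= LE => /(_ erefl).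
  rewrite indicE memNset// => D'N.
  have := proj2 (HD' _ good_path_None) D'N.
  by case.
rewrite -integral_mkcondr integral_cst; last first.
  by apply: measurableI => //; exact: measurable_L_alive.
rewrite muleC; congr (P y0 _ * _)%E; apply/seteqP; split=> w; rewrite /A'.
  by move=> [[]].
move=> [Aw Bw]; split=> //; split=> //=; move: Bw; rewrite /B/= /lamperti.
by case: (hit _ _ _) => // r _; rewrite ltry.
Qed.

Lemma L0 w : L 0 w = Some y0.
Proof. by apply: lamperti0; rewrite ?X0//; exact: good_X. Qed.

Lemma L_dead s t w : 0 <= s -> s <= t -> L s w = None -> L t w = None.
Proof.
move=> s0 st Ls; apply: contrapT => /(lamperti_aliveW c_cont c_gt0 (good_X w) s0 st).
by rewrite Ls.
Qed.

Lemma measurable_L_path D : path_sets D -> measurable [set w | D (L ^~ w)].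
Proof.
apply: (path_sets_preimage (F := measurable) (X := fun w => L ^~ w)).
  exact: sigma_algebra_measurable.
by move=> t U t0 oU; exact: measurable_L.
Qed.

Lemma law_L_fin D : path_sets D -> law_L D = (fine (law_L D))%:E.
Proof.
by move=> PD; rewrite fineK// /law_L fin_num_measure//; exact: measurable_L_path.
Qed.

Local Notation paths := (g_sigma_algebraType (@cylinders R (opc E))).

Lemma path_sets_at t (V : set (opc E)) : 0 <= t -> open V ->
  measurable [set x : paths | V (x t)].
Proof. by move=> t0 oV; apply: sub_sigma_algebra; exists t, V. Qed.

Definition dead s : set paths := [set x | x s = None].

Lemma measurable_dead s : 0 <= s -> measurable (dead s).
Proof.
move=> s0; rewrite (_ : dead s = ~` [set x | (Some @` [set: E]) (x s)]).
  by apply: measurableC; apply: path_sets_at => //; apply: open_Some; exact: openT.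
apply/seteqP; split=> x; rewrite /dead/=; first by move=> -> [].
by case: (x s) => // y ny; exfalso; apply: ny; exists y.
Qed.

Lemma killed_levyT t D : 0 <= t -> path_sets D ->
  P y0 [set w | L t w <> None /\ D (increments t w)] =
  (P y0 [set w | L t w <> None] * law_L D)%E.
Proof.
move=> t0 PD; rewrite -[LHS](congr1 _ (setTI _)) -[X in (P y0 X * _)%E]setTI.
apply: killed_levy => //.
have [_ FT] := hit_stopping_time c_cont c_gt0 (good_X (y := y0)) t.
by move=> u u0; rewrite setTI; exact: FT.
Qed.

(** * Leaving a closed set and dying within a short time *)

Section escape.
Variable K : set E.
Hypothesis K_closed : closed K.

Definition outside (z : opc E) := (Some @` (~` K)) z.

(** Dyadic times suffice by right-continuity, and keep the event measurable. *)
Definition escapes_grid s m : set paths :=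
  [set x | exists2 j, (j < 2 ^ m)%N & outside (x (j%:R * s / 2 ^+ m))].

Definition escapes s : set paths := \bigcup_m escapes_grid s m.

Let grid_ge0 s m j : 0 <= s -> 0 <= j%:R * s / 2 ^+ m.
Proof. by move=> s0; rewrite !mulr_ge0// invr_ge0 exprn_ge0. Qed.

Let open_outside : open outside.
Proof. by apply: open_Some; exact: closed_openC. Qed.

Lemma measurable_escapes_grid s m : 0 <= s -> measurable (escapes_grid s m).
Proof.
move=> s0; rewrite (_ : escapes_grid s m =
    \bigcup_(j in [set j | (j < 2 ^ m)%N]) [set x | outside (x (j%:R * s / 2 ^+ m))]).
  by apply: bigcup_measurable => j _; apply: path_sets_at => //; exact: grid_ge0.
by apply/seteqP; split.
Qed.

Lemma measurable_escapes s : 0 <= s -> measurable (escapes s).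
Proof. by move=> s0; apply: bigcupT_measurable => m; exact: measurable_escapes_grid. Qed.

Lemma escapes_grid_mono s m n : (m <= n)%N -> escapes_grid s m `<=` escapes_grid s n.
Proof.
move=> mn x [j jm xj]; exists (j * 2 ^ (n - m))%N.
  by rewrite -{2}(subnKC mn) expnD ltn_mul2r expn_gt0 jm.
rewrite -{2}(subnKC mn) exprD natrM natrX.
rewrite (_ : _ / _ = j%:R * s / 2 ^+ m)//; field.
by rewrite !expf_neq0.
Qed.

(** If the path is outside [K] at the grid time [tt j] and dead at [s], it is dead at [tt j + s], so
    its increment after [tt j] dies within [s]. Conditioning at the first such grid time yields the
    product. *)
Lemma escapes_grid_dead s m : 0 <= s ->
  (law_L (escapes_grid s m `&` dead s) <= law_L (dead s) * law_L (escapes_grid s m))%E.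
Proof.
move=> s0; pose tt (j : nat) := j%:R * s / 2 ^+ m.
have tt0 j : 0 <= tt j by exact: grid_ge0.
(* [j] is the first index at which the grid sees the path outside [K]; these events are disjoint and
   known at the times [tt j]. *)
pose B (j : nat) := [set w | (j < 2 ^ m)%N /\ outside (L (tt j) w)] `&`
  \bigcap_i ~` [set w | (i < j)%N /\ outside (L (tt i) w)].
have FB j : natural_filtration L (tt j) (B j).
  have at_ i : (i <= j)%N -> natural_filtration L (tt j) [set w | outside (L (tt i) w)].
    move=> ij; apply: sub_sigma_algebra; exists (tt i), outside; split=> //.
    by rewrite tt0/= /tt ler_wpM2r ?invr_ge0 ?exprn_ge0// ler_wpM2r// ler_nat.
  apply: (@measurableI _ (g_sigma_algebraType (filtration_gen L (tt j)))).
    have [jm|jm] := boolP (j < 2 ^ m)%N.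
      rewrite (_ : [set _ | _] = [set w | outside (L (tt j) w)]); first exact: at_.
      by apply/seteqP; split=> w //= [].
    rewrite (_ : [set _ | _] = set0); first exact: measurable0.
    by apply/seteqP; split=> w //= [].
  apply: bigcapT_measurable => i; apply: measurableC.
  have [ij|ij] := boolP (i < j)%N.
    rewrite (_ : [set _ | _] = [set w | outside (L (tt i) w)]); first exact: at_ (ltnW ij).
    by apply/seteqP; split=> w //= [].
  rewrite (_ : [set _ | _] = set0); first exact: measurable0.
  by apply/seteqP; split=> w //= [].
have sB j : stopped_sets (X y0) (hit_at (tt j)) (B j).
  by apply: (lamperti_filtration_stopped c_cont c_gt0 (good_X (y := y0)) (tt0 j)).
have BL j w : B j w -> L (tt j) w <> None.
  by move=> [[_ [z _ <-]]].
have Bfin j : B j `<=` [set w | (hit_at (tt j) w < +oo)%E].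
  move=> w /BL; rewrite /lamperti /=; case: (hit _ _ _) => // r _; exact: ltry.
have mB j : measurable (B j).
  by rewrite -(setIidl (Bfin j)); exact: stopped_measurable.
have mdead : measurable [set w | dead s (L ^~ w)].
  by apply: measurable_L_path; exact: measurable_dead.
have tB : trivIset setT B.
  apply/trivIsetP => i j _ _; rewrite neq_ltn => /orP[] ij;
    apply/seteqP; split=> // w [] [[_ oi] nj] [[_ oj] ni].
    by apply: (ni i) => //; split.
  by apply: (nj j) => //; split.
have := @measure_bigcup_le_mul _ _ _ (P y0) (fun j => B j `&` [set w | dead s (L ^~ w)])
  B (fine (law_L (dead s))).
rewrite -law_L_fin; last exact: measurable_dead.
rewrite -setI_bigcupl.
have -> : \bigcup_n B n = [set w | escapes_grid s m (L ^~ w)].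
  apply/seteqP; split=> w.
    by move=> [j _ [[jm oj] _]]; exists j.
  move=> [j jm oj]; have ex : exists j, `[< outside (L (tt j) w) >].
    by exists j; apply/asboolP.
  case: (ex_minnP ex) => i /asboolP oi imin; exists i => //; split.
    by split=> //; apply: leq_ltn_trans jm; apply: imin; apply/asboolP.
  move=> k _ [ki ok]; have := imin k (asboolT ok).
  by rewrite leqNgt ki.
apply => //; first by move=> n; apply: measurableI.
move=> j.
have := killed_levy (tt0 j) (sB j) (measurable_dead s0).
have -> : B j `&` [set w | L (tt j) w <> None] = B j.
  by apply/setIidl => w /BL.
rewrite muleC => <-; apply: le_measure; rewrite ?inE.
- exact: measurableI.
- rewrite (_ : B j `&` _ = B j `&` [set w | L (tt j + s) w = None]).
    apply: measurableI => //.
    by apply: (@measurable_L_path (dead (tt j + s))); apply: measurable_dead; exact: addr_ge0.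
  apply/seteqP; split=> w [Bw]; rewrite /= /increments /dead/=.
    case: (L (tt j) w) (BL _ _ Bw) => [y|]//= _ [_].
    by case: (lamperti _ _ _).
  by move=> ->; split=> //; split; [exact: BL|case: (L (tt j) w)].
- move=> w [Bw]; rewrite /dead /= => dw; split=> //; split; first exact: BL.
  rewrite /increments (@L_dead s (tt j + s))// ?lerDr//.
  by case: (L (tt j) w).
Qed.

Lemma escapes_dead s : 0 <= s ->
  (law_L (escapes s `&` dead s) <= law_L (dead s) * law_L (escapes s))%E.
Proof.
move=> s0.
have mesc m : measurable [set w | escapes_grid s m (L ^~ w)].
  by apply: measurable_L_path; exact: measurable_escapes_grid.
have mdead : measurable [set w | dead s (L ^~ w)].
  by apply: measurable_L_path; exact: measurable_dead.
pose F m := [set w | escapes_grid s m (L ^~ w)] `&` [set w | dead s (L ^~ w)].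
have mF m : measurable (F m) by exact: measurableI.
have FE : \bigcup_m F m = [set w | (escapes s `&` dead s) (L ^~ w)].
  rewrite /F -setI_bigcupl; apply/seteqP; split=> w [].
    by move=> [m _ em] dw; split=> //; exists m.
  by move=> [m _ em] dw; split=> //; exists m.
have := @nondecreasing_cvg_mu _ _ _ (P y0) F mF.
rewrite FE; move=> cvF.
have {}cvF : P y0 (F m) @[m --> \oo] --> law_L (escapes s `&` dead s).
  apply: cvF; first by rewrite -FE; exact: bigcupT_measurable.
  move=> m n mn; apply/subsetPset => w [em dw]; split=> //.
  exact: escapes_grid_mono mn _ em.
rewrite -(cvg_lim _ cvF)//; apply: lime_le; first by apply/cvg_ex; exists (law_L (escapes s `&` dead s)).
apply: nearW => m; apply: le_trans (escapes_grid_dead m s0) _.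
apply: lee_wpmul2l; first exact: measure_ge0.
apply: le_measure; rewrite ?inE//.
  by apply: measurable_L_path; exact: measurable_escapes.
by move=> w em; exists m.
Qed.

Lemma measurable_increments t D : 0 <= t -> path_sets D ->
  measurable [set w | L t w <> None /\ D (increments t w)].
Proof.
move=> t0 PD; apply: (@measurableI _ _ [set w | L t w <> None]).
  exact: measurable_L_alive.
apply: (path_sets_preimage (F := measurable) (X := increments t)) PD.
  exact: sigma_algebra_measurable.
move=> u V u0 oV; apply: (@opc_measurable _ E) oV => U oU.
apply: (measurable_opc2 E_separable finv_cont) oU => W oW; apply: measurable_L => //.
- exact: open_Some.
- exact: addr_ge0.
- exact: open_Some.
Qed.

Definition bad s (k : nat) : set (Om y0) :=
  [set w | L (k%:R * s) w <> None /\ (escapes s `&` dead s) (increments (k%:R * s) w)].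

Lemma measurable_escapes_dead s : 0 <= s -> path_sets (escapes s `&` dead s).
Proof.
by move=> s0; apply: (@measurableI _ paths); [exact: measurable_escapes|exact: measurable_dead].
Qed.

Lemma measurable_bad s k : 0 <= s -> measurable (bad s k).
Proof.
move=> s0; apply: measurable_increments; first exact: mulr_ge0.
exact: measurable_escapes_dead.
Qed.

Lemma bad_small s : 0 < s -> (P y0 (\bigcup_k bad s k) <= law_L (escapes s))%E.
Proof.
move=> s0.
have ks0 k : 0 <= k%:R * s by rewrite mulr_ge0// ltW.
have mescd := measurable_escapes_dead (ltW s0).
have mdead : path_sets (dead s) by apply: measurable_dead; exact: ltW.
have mesc : path_sets (escapes s) by apply: measurable_escapes; exact: ltW.
(* Alive at [k * s] and dead at [k.+1 * s]: a path dies only once, so these events are disjoint. *)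
pose C (k : nat) := [set w | L (k%:R * s) w <> None /\ dead s (increments (k%:R * s) w)].

have tC : trivIset setT C.
  apply/trivIsetP => i j _ _; rewrite neq_ltn.
  have CE k w : C k w -> L (k%:R * s) w <> None /\ L (k.+1%:R * s) w = None.
    rewrite /C/= /increments /dead/= -natr1 mulrDl mul1r => -[].
    by case: (L (k%:R * s) w) => [y|]// _; case: (lamperti _ _ _).
  by move=> /orP[] ij; apply/seteqP; split=> // w [] /CE[Li Li1] /CE[Lj Lj1];
    [apply: Lj; apply: L_dead Li1|apply: Li; apply: L_dead Lj1];
    rewrite // ler_wpM2r ?ler_nat// ltW.
apply: (@le_trans _ _ ((fine (law_L (escapes s)))%:E * P y0 (\bigcup_k C k))%E).
  apply: measure_bigcup_le_mul => //.
  - by move=> k; exact: measurable_bad (ltW s0).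
  - by move=> k; exact: measurable_increments.
  move=> k; have := killed_levyT (ks0 k) mescd; rewrite -/(bad s k) => ->.
  have := killed_levyT (ks0 k) mdead; rewrite -/(C k) => ->.
  rewrite -law_L_fin// muleCA; apply: lee_wpmul2l; first exact: measure_ge0.
  by rewrite muleC; apply: escapes_dead; exact: ltW.
rewrite -law_L_fin// -[leRHS]mule1; apply: lee_wpmul2l; first exact: measure_ge0.
by apply: probability_le1; apply: bigcupT_measurable => k; exact: measurable_increments.
Qed.

End escape.

(** * Almost sure survival of the time-changed process *)

Section immortality.
Variable K : set E.
Hypothesis K_compact : compact K.

Let K_closed : closed K. Proof. exact: compact_closed_metric. Qed.

(** A path dying between [k * s] and [k.+1 * s] without [bad s k] remains from
    [k * s] on in a translate of [K], which is compact, hence cannot die. *)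
Lemma not_bad_immortal s w : 0 < s -> (forall k, ~ bad K s k w) ->
  forall t, 0 <= t -> L t w <> None.
Proof.
move=> s0 nbad t t0 Lt.
have ks0 k : 0 <= k%:R * s by rewrite mulr_ge0// ltW.
have [k Lk Lk1] : exists2 k, L (k%:R * s) w <> None & L (k.+1%:R * s) w = None.
  have ex : exists k : nat, `[< L (k%:R * s) w = None >].
    exists (Num.truncn (t / s)).+1; apply/asboolP; apply: L_dead Lt => //.
    by rewrite -ler_pdivrMr// ltW// truncnS_gt.
  case: (ex_minnP ex) => -[/asboolP|k /asboolP Lk kmin]; first by rewrite mul0r L0.
  exists k => // /asboolP /kmin; by rewrite ltnn.
case Lz : (L (k%:R * s) w) Lk => [z|//] _.
have hom := f_homeo z; have [g [cf _ _ _]] := hom.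
have cK' : compact (f z @` K) by exact: compact_image.
have nesc : ~ escapes K s (increments (k%:R * s) w).
  move=> es; apply: (nbad k); split; first by rewrite Lz.
  split=> //; rewrite /dead /= /increments Lz.
  by rewrite -natr1 mulrDl mul1r in Lk1; rewrite Lk1.
have inK u : 0 <= u -> u < s -> L (k%:R * s + u) w <> None ->
    (Some @` (f z @` K)) (L (k%:R * s + u) w).
  move=> u0 us; case Lv : (L (k%:R * s + u) w) => [v|//] _.
  exists v => //; apply: contrapT => vK.
  have vn : nbhs v (~` (f z @` K)).
    by apply: open_nbhs_nbhs; split=> //; apply: closed_openC; exact: (compact_closed_metric cK').
  have ku0 : 0 <= k%:R * s + u by rewrite addr_ge0.
  have [e e0 He] := lamperti_right c_cont c_gt0 (good_X w) ku0 Lv vn.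
  have uv : u < u + e by rewrite ltrDl.
  (* By right-continuity the path stays outside the translate of [K] for a while after [u], long
     enough to be caught by a dyadic time: this contradicts [nesc]. *)
  have [m [j [jm uj je]]] := dyadic_between s0 u0 uv us.
  apply: nesc; exists m => //; exists j => //.
  rewrite /increments Lz /=.
  have [||v' v'K <-] := He (k%:R * s + j%:R * s / 2 ^+ m).
  - by rewrite lerD2l.
  - by rewrite -addrA ltrD2l.
  exists (finv z v') => // Kv'; apply: v'K; exists (finv z v') => //; exact: finvK.
have := Lz; rewrite /lamperti; have := hit_ge0 c (X y0 ^~ w) (k%:R * s).
case hr : (hit _ _ _) => [r||]//; rewrite lee_fin => r0 xr.
have xrN : X y0 r w <> None by rewrite xr.
have [_ rk] := clock_hit c_cont c_gt0 (good_X w) (ks0 k) hr xrN.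
suff imm : forall t, 0 <= t -> L t w <> None by exact: (imm t t0).
(* Back to the original clock: an alive value of [X y0] at [v >= r] is the value of [L] at the level
   [C] shown by the clock, which lies between [k * s] and the death of [L]. *)
apply: (trapped_immortal c_cont c_gt0 (good_X w) r0 xrN cK') => v rv xv.
have v0 : 0 <= v by exact: le_trans rv.
have fv := clock_fin c_cont c_gt0 (good_X w) v0 xv.
have := clock_le c_cont c_gt0 (good_X w) r0 rv.
rewrite rk -(fineK fv) lee_fin; set C := fine _ => kC.
have C0 : 0 <= C by exact: le_trans kC.
have LC : L C w = X y0 v w.
  by apply: (@lamperti_clock _ _ c c_cont c_gt0 (X y0 ^~ w)); rewrite ?fineK//; exact: good_X.
rewrite -LC -(subrKC (k%:R * s) C); apply: inK.
- by rewrite subr_ge0.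
- rewrite ltrBlDl ltNge; apply/negP => Ck; apply: xv; rewrite -LC.
  by apply: (L_dead (ks0 k.+1) _ Lk1); rewrite -natr1 mulrDl mul1r.
- by rewrite subrKC LC.
Qed.

Hypothesis K_nbhs : nbhs y0 K.

Definition mortal : set (Om y0) := \bigcup_n [set w | L n%:R w = None].

Lemma mortalP w : ~ mortal w -> forall t, 0 <= t -> L t w <> None.
Proof.
move=> nm t t0 Lt; apply: nm; exists (Num.truncn t).+1 => //=.
by apply: L_dead Lt => //; rewrite ltW// truncnS_gt.
Qed.

Lemma measurable_mortal : measurable mortal.
Proof.
apply: bigcupT_measurable => n.
by apply: (@measurable_L_path (dead n%:R)); exact: measurable_dead.
Qed.

(** Right-continuity at 0 keeps [L] in the neighbourhood [K] of [y0] for a positive time, so leaving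
    [K] before [s n] has a probability tending to 0, and it bounds that of ever dying. *)
Lemma mortal_null : P y0 mortal = 0%E.
Proof.
pose s (n : nat) : R := n.+1%:R^-1.
have s0 n : 0 < s n by rewrite invr_gt0.
pose N n := [set w | escapes K (s n) (L ^~ w)].
have mN n : measurable (N n).
  by apply: measurable_L_path; apply: measurable_escapes => //; exact: ltW.
(* The dyadic grids for different [s n] are not nested, so the tail unions [V n] provide the
   decreasing sequence that continuity from above asks for. *)
pose V n := \bigcup_(k in [set k | (n <= k)%N]) N k.
have mV n : measurable (V n) by apply: bigcup_measurable.
have V0 : \bigcap_n V n = set0.
  apply/seteqP; split=> // w Vw.
  have [e e0 He] := lamperti_right c_cont c_gt0 (good_X w) (lexx 0) (L0 w) K_nbhs.
  have [n] := ltr_add_invr e0; rewrite add0r => ne.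
  have [k nk [m _ [j jm [z zK zL]]]] := Vw n I.
  have [||z' z'K] := He (j%:R * s k / 2 ^+ m).
  - by rewrite !mulr_ge0// ?invr_ge0// ?exprn_ge0.
  - rewrite add0r; apply: le_lt_trans ne.
    apply: (@le_trans _ _ (s k)); last by rewrite lef_pV2 ?posrE// ler_nat.
    rewrite ler_pdivrMr ?exprn_gt0// mulrC ler_pM2l//.
    by rewrite -natrX ler_nat ltnW.
  by rewrite -zL => -[zz]; apply: zK; rewrite -zz.
have cvV : P y0 (V n) @[n --> \oo] --> P y0 (\bigcap_n V n).
  apply: nonincreasing_cvg_mu => //.
  - by rewrite (le_lt_trans (probability_le1 _ (mV 0)))// ltry.
  - by rewrite V0.
  - move=> m n mn; apply/subsetPset => w [k nk Nk]; exists k => //=.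
    exact: leq_trans nk.
rewrite V0 measure0 in cvV.
apply/eqP; rewrite eq_le measure_ge0 andbT -(cvg_lim _ cvV)//.
apply: lime_ge; first by apply/cvg_ex; exists 0%E.
apply: nearW => n; apply: (@le_trans _ _ (P y0 (\bigcup_k bad K (s n) k))).
  apply: le_measure; rewrite ?inE.
  - exact: measurable_mortal.
  - by apply: bigcupT_measurable => k; apply: measurable_bad => //; exact: ltW.
  move=> w [m _ Lm]; apply: contrapT => nb.
  apply: (not_bad_immortal (s0 n) _ (ler0n R m) Lm) => k bk.
  by apply: nb; exists k.
apply: (le_trans (bad_small K_closed (s0 n))).
apply: le_measure; rewrite ?inE//.
  exact: mN.
by move=> w Nw; exists n => /=.
Qed.

End immortality.

(** * The Levy process on the group *)

Section levy.
Hypothesis f_action : forall x y z, f (f x y) z = f x (f y z).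
Hypothesis mortal0 : P y0 mortal = 0%E.

Definition group_inv y := finv y y0.

Lemma f_neutral y : f y0 y = y.
Proof. by case: fc_good => ->. Qed.

(** Associativity identifies [finv y] with left multiplication by the inverse of [y]; the increments
    of the killed process thereby become group increments. *)
Lemma group_invE y z : f (group_inv y) z = finv y z.
Proof. by apply: (can_inj (fK y)); rewrite -f_action !finvK f_neutral. Qed.

Lemma f_is_group : is_group f group_inv y0.
Proof.
split=> [x y z|y|y|y|y]; first by rewrite f_action.
- exact: f_neutral.
- exact: f_right_neutral.
- by rewrite group_invE -{2}(f_right_neutral y) fK.
- by rewrite /group_inv finvK.
Qed.

Lemma f_topological_group : topological_group f group_inv y0.
Proof.
split; [exact: f_is_group|exact: f_cont|].
move=> y; apply: (@continuous_comp _ _ _ (fun y => (y, y0)) (fun p => finv p.1 p.2) y).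
  by apply: cvg_pair; [exact: cvg_id|exact: cvg_cst].
exact: finv_cont.
Qed.

Lemma measure_eq_off_null (A B N : set (Om y0)) :
  measurable A -> measurable B -> measurable N -> P y0 N = 0%E ->
  A `&` ~` N = B `&` ~` N -> P y0 A = P y0 B.
Proof.
move=> mA mB mN N0 AB.
have le A' B' : measurable A' -> measurable B' -> A' `&` ~` N = B' `&` ~` N ->
    (P y0 A' <= P y0 B')%E.
  move=> mA' mB' AB'; apply: (@le_trans _ _ (P y0 (B' `|` N))).
    apply: le_measure; rewrite ?inE//; first exact: measurableU.
    move=> w Aw; have [Nw|Nw] := pselect (N w); [by right|left].
    have : (A' `&` ~` N) w by [].
    by rewrite AB' => -[].
  apply: (le_trans (measureU2 (P y0) mB' mN)).
  by rewrite [X in (_ + X <= _)%E](_ : _ = 0%E) ?adde0.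
by apply/eqP; rewrite eq_le !le.
Qed.

(** Set to [y0] on the null event where the time-changed process dies. *)
Definition levy (t : R) (w : Om y0) : E :=
  if `[< mortal w >] then y0 else odflt y0 (L t w).

Lemma levyE w : ~ mortal w -> levy ^~ w = lamperti_path c y0 (X y0 ^~ w).
Proof. by move=> nm; apply/funext => t; rewrite /levy; case: asboolP. Qed.

Lemma Some_levy t w : ~ mortal w -> 0 <= t -> Some (levy t w) = L t w.
Proof.
move=> nm t0; have := mortalP nm t0; rewrite /levy; case: asboolP => // _.
by case: (lamperti _ _ _).
Qed.

Lemma odflt_measurable dd (Z : measurableType dd) (g : Z -> opc E) :
  (forall U, open U -> measurable [set z | (Some @` U) (g z)]) ->
  forall U, open U -> measurable [set z | U (odflt y0 (g z))].
Proof.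
move=> mg U oU.
rewrite (_ : [set _ | _] = [set z | (Some @` U) (g z)] `|`
    (~` [set z | (Some @` [set: E]) (g z)] `&` [set _ | U y0])).
  apply: measurableU; first exact: mg.
  apply: measurableI; first by apply: measurableC; apply: mg; exact: openT.
  have [Uy|Uy] := pselect (U y0).
    by rewrite (_ : [set _ | _] = setT)//; apply/seteqP; split.
  by rewrite (_ : [set _ | _] = set0)//; apply/seteqP; split.
apply/seteqP; split=> z /=; case: (g z) => [y|]/=.
- by move=> Uy; left; exists y.
- by move=> Uy; right; split=> // -[].
- by case=> [[v Uv [<-]]|[]]// nE; case: nE; exists y.
- by case=> [[]|[]].
Qed.

Lemma levy_measurable : process_measurable levy.
Proof.
move=> t U t0 oU.
rewrite (_ : _ @^-1` _ = (mortal `&` [set _ | U y0]) `|`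
    (~` mortal `&` [set w | U (odflt y0 (L t w))])).
  apply: measurableU.
    have [Uy|Uy] := pselect (U y0).
      by rewrite (_ : [set _ | _] = setT) ?setIT//; [exact: measurable_mortal|apply/seteqP; split].
    by rewrite (_ : [set _ | _] = set0) ?setI0//; apply/seteqP; split.
  apply: measurableI; first by apply: measurableC; exact: measurable_mortal.
  by apply: odflt_measurable oU => W oW; apply: measurable_L => //; exact: open_Some.
rewrite /levy; apply/seteqP; split=> w /=; case: asboolP => m.
- by move=> Uy; left.
- by move=> Uy; right.
- by case=> [[]|[]].
- by case=> [[]|[]].
Qed.

(** [levy] depends on [mortal], which is not known at time [t]; its past agrees with the stopped
    past of [X y0] only off that null event. *)
Lemma levy_filtration t B : 0 <= t -> natural_filtration levy t B ->
  exists2 A, stopped_sets (X y0) (hit_at t) A & A `&` ~` mortal = B `&` ~` mortal.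
Proof.
move=> t0; move: B; apply: sigma_algebra_sub.
  have [s0 sC sU] := stopped_sets_sigma_algebra (hit_stopping_time c_cont c_gt0 (good_X (y := y0)) t).
  split.
  - by exists set0.
  - move=> B [A sA AB]; exists (setT `\` A); first exact: sC.
    apply/seteqP; split=> w [[_ nA] nm]; split=> //; split=> // Bw; apply: nA.
      by have [] : (A `&` ~` mortal) w by rewrite AB.
    by have [] : (B `&` ~` mortal) w by rewrite -AB.
  - move=> B HB; have /choice[A HA] : forall n, exists A,
        stopped_sets (X y0) (hit_at t) A /\ A `&` ~` mortal = B n `&` ~` mortal.
      by move=> n; have [A ? ?] := HB n; exists A.
    exists (\bigcup_n A n); first by apply: sU => n; case: (HA n).
    by rewrite !setI_bigcupl; apply: eq_bigcupr => n _; case: (HA n).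
move=> _ [s [U [/andP[s0 st] oU ->]]].
exists [set w | U (odflt y0 (L s w))].
  apply: (lamperti_filtration_stopped c_cont c_gt0 (good_X (y := y0)) t0).
  apply: (@odflt_measurable _ (g_sigma_algebraType (filtration_gen L t))) oU => W oW.
  apply: sub_sigma_algebra; exists s, (Some @` W); split=> //; first by rewrite s0.
  exact: open_Some.
by apply/seteqP; split=> w [Uw nm]; split=> //; move: Uw; rewrite /levy /=; case: asboolP.
Qed.

Lemma path_sets_odflt (D : set (R -> E)) : path_sets D ->
  path_sets [set x : R -> opc E | D (fun t => odflt y0 (x t))].
Proof.
apply: (path_sets_preimage (F := @path_sets R (opc E))
  (X := fun (x : R -> opc E) t => odflt y0 (x t))).
  exact: smallest_sigma_algebra.
move=> t U t0 oU; apply: (@odflt_measurable _ paths) oU => W oW.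
by apply: path_sets_at => //; exact: open_Some.
Qed.

Let inc t (s : R) w := f (group_inv (levy t w)) (levy (t + s) w).

(** All three events are replaced, up to the null set [mortal], by their counterparts for the killed
    process, where [killed_levy] applies. *)
Lemma levy_increments t D B : 0 <= t -> path_sets D -> natural_filtration levy t B ->
  P y0 ([set w | D (inc t ^~ w)] `&` B) = (P y0 [set w | D (levy ^~ w)] * P y0 B)%E.
Proof.
move=> t0 PD FB; have [A sA AB] := levy_filtration t0 FB.
have PD' := path_sets_odflt PD.
set D' := [set x | _] in PD'.
have nullE := measure_eq_off_null _ _ measurable_mortal mortal0.
have mB : measurable B.
  move: FB; apply: sigma_algebra_sub; first exact: sigma_algebra_measurable.
  by move=> _ [s [U [/andP[s0 _] oU ->]]]; exact: levy_measurable.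
have mlevy (D1 : set (R -> E)) : path_sets D1 -> measurable [set w | D1 (levy ^~ w)].
  apply: (path_sets_preimage (F := measurable) (X := fun w => levy ^~ w)).
    exact: sigma_algebra_measurable.
  by move=> s U s0 oU; exact: levy_measurable.
have minc : measurable [set w | D (inc t ^~ w)].
  move: PD; apply: (path_sets_preimage (F := measurable) (X := fun w => inc t ^~ w)).
    exact: sigma_algebra_measurable.
  move=> s U s0 oU.
  have mS r (r0 : 0 <= r) (W : set E) (oW : open W) :
      measurable [set w | (Some @` W) (Some (levy r w) : opc E)].
    rewrite (_ : [set _ | _] = levy r @^-1` W); first exact: levy_measurable.
    by apply/seteqP; split=> w /=; [move=> [v Wv [<-]]|exists (levy r w)].
  have := @measurable_opc2 _ _ E_separable _ _ finv _ _ finv_cont (mS t t0)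
    (mS (t + s) (addr_ge0 t0 s0)) U oU.
  congr (measurable _); apply/seteqP; split=> w; rewrite /= /inc group_invE.
    by move=> [v Uv [<-]].
  by move=> Uw; exists (finv (levy t w) (levy (t + s) w)).
have alive_off w : ~ mortal w -> L t w <> None by move=> /mortalP; exact.
have HA : P y0 (A `&` [set w | L t w <> None]) = P y0 B.
  apply: nullE => //.
    rewrite (_ : _ `&` _ = (A `&` [set w | (hit_at t w < +oo)%E]) `&` [set w | L t w <> None]).
      by apply: measurableI; [exact: stopped_measurable|exact: measurable_L_alive].
    apply/seteqP; split=> w [] => [Aw Lw|[Aw _] Lw]; split=> //; split=> //.
    by move: Lw; rewrite /= /lamperti; case: (hit _ _ _) => // r _; exact: ltry.
  rewrite -AB; apply/seteqP; split=> w; first by move=> [[]].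
  by move=> [Aw nm]; split=> //; split=> //; exact: alive_off.
have HD : law_L D' = P y0 [set w | D (levy ^~ w)].
  rewrite /law_L; apply: nullE; [exact: measurable_L_path|exact: mlevy|].
  apply/seteqP; split=> w [Dw nm]; split=> //; move: Dw; rewrite /= levyE//.
rewrite -HA -HD muleC -killed_levy//; apply: nullE.
- exact: measurableI.
- rewrite (_ : _ `&` _ = (A `&` [set w | (hit_at t w < +oo)%E]) `&`
      [set w | L t w <> None /\ D' (increments t w)]).
    by apply: measurableI; [exact: stopped_measurable|exact: measurable_increments].
  apply/seteqP; split=> w [] => [Aw [Lw Dw]|[Aw _] Lw]; split=> //; split=> //.
  by move: Lw; rewrite /= /lamperti; case: (hit _ _ _) => // r _; exact: ltry.
have incE w s : ~ mortal w -> 0 <= s -> odflt y0 (increments t w s) = inc t s w.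
  move=> nm s0; rewrite /increments -!Some_levy ?addr_ge0//.
  by rewrite /inc group_invE.
apply/seteqP; split=> w [].
  move=> [Dw Bw] nm; split=> //; split; first by have [] : (A `&` ~` mortal) w by rewrite AB.
  split; first exact: alive_off.
  by rewrite /D'/=; apply: (path_sets_ext PD _ Dw) => s s0; rewrite incE.
move=> [Aw [_ Dw]] nm; split=> //; split; last by have [] : (B `&` ~` mortal) w by rewrite -AB.
by apply: (path_sets_ext PD _ Dw) => s s0; rewrite incE.
Qed.

Lemma levy_levy_process : levy_process (P y0) f group_inv y0 levy.
Proof.
split.
- exact: levy_measurable.
- by move=> w; rewrite /levy L0; case: asboolP.
- move=> w; have [m|nm] := pselect (mortal w).
    have -> : levy ^~ w = cst y0 by apply/funext => t; rewrite /levy asboolT.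
    by split=> [t _|t _]; [exact: cvg_cst|exists y0; exact: cvg_cst].
  rewrite levyE//; apply: cadlag_lamperti_path => //; [exact: good_X|].
  exact: mortalP.
- move=> t t0 incs.
  have FT : natural_filtration levy t setT.
    by apply: (@measurableT _ (g_sigma_algebraType (filtration_gen levy t))).
  have E1 D : path_sets D -> P y0 [set w | D (incs ^~ w)] = P y0 [set w | D (levy ^~ w)].
    by move=> PD; have := levy_increments t0 PD FT; rewrite setIT probability_setT mule1.
  split=> [D PD|D B PD FB]; first exact: E1.
  by rewrite E1//; exact: levy_increments.
Qed.

Lemma levy_time_change : {ae P y0, forall w,
  lifetime y0 (X y0 ^~ w) = phi c (levy ^~ w) +oo%E /\
  forall t, 0 <= t -> (t%:E < phi c (levy ^~ w) +oo)%E ->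
    X y0 t w = Some (levy (phi_inv c (levy ^~ w) t) w)}.
Proof.
exists mortal; split; [exact: measurable_mortal|exact: mortal0|].
move=> w; apply: contra_notP => nm /=; rewrite levyE//.
have pw : path_from y0 (X y0 ^~ w) by case: X_markov => _ /(_ y0 w).
split; first exact: (lifetime_phi c_cont c_gt0 y0 (good_X w) (mortalP nm) pw).
move=> t t0 tp; rewrite (phi_invP c_cont c_gt0 (good_X w) (mortalP nm) pw t0 tp).
by rewrite -(levyE nm).
Qed.

End levy.

(** A homomorphism maps increments to increments, and events on the image process, past or future,
    pull back to events on [l] by continuity. *)
Lemma levy_process_hom dd (Om' : measurableType dd) (Q : probability Om' R)
    (mul : E -> E -> E) (inv : E -> E) (e : E) (l : R -> Om' -> E) (h : E -> R) :
  continuous h -> (forall x y, h (mul x y) = h x + h y) -> h e = 0 ->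
  (forall x, h (inv x) = - h x) -> levy_process Q mul inv e l ->
  levy_process Q +%R -%R 0 (fun t w => h (l t w)).
Proof.
move=> ch hM h1 hV [ml l0 cl il]; split.
- move=> t U t0 oU; apply: (ml t (h @^-1` U) t0).
  by move/continuousP : ch; exact.
- by move=> w; rewrite l0 h1.
- by move=> w; exact: cadlag_comp (cl w).
- move=> t t0 incs; have [E1 E2] := il t t0.
  have Ph D : path_sets D -> path_sets [set x : R -> E | D (h \o x)].
    apply: (path_sets_preimage (F := @path_sets R E) (X := fun (x : R -> E) => h \o x)).
      exact: smallest_sigma_algebra.
    move=> s U s0 oU; apply: sub_sigma_algebra; exists s, (h @^-1` U); split=> //.
    by move/continuousP : ch; exact.
  have incsE w : incs ^~ w = h \o (fun s => mul (inv (l t w)) (l (t + s) w)).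
    by apply/funext => s; rewrite /incs /= hM hV.
  have setE D : [set w | D (incs ^~ w)] =
      [set w | [set x : R -> E | D (h \o x)] (fun s => mul (inv (l t w)) (l (t + s) w))].
    by apply/seteqP; split=> w /=; rewrite incsE.
  split=> [D PD|D B PD FB]; rewrite setE; first exact: (E1 _ (Ph D PD)).
  apply: E2; first exact: Ph.
  move: FB; apply: sub_sigma_algebra2 => _ [s [U [s0 oU ->]]].
  exists s, (h @^-1` U); split=> //.
  by move/continuousP : ch; exact.
Qed.

(** * Associativity *)

Section composition.
Local Notation borel := <<s (@open E) >>.

Lemma borel_preimage (T : Type) (F : set (set T)) (g : T -> opc E) : sigma_algebra setT F ->
  (forall U, open U -> F [set w | (Some @` U) (g w)]) ->
  forall S, borel S -> F [set w | (Some @` S) (g w)].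
Proof.
move=> sF HF; have [F0 FC FU] := sF.
apply: (@sigma_algebra_sub _ _ [set S | F [set w | (Some @` S) (g w)]]) => //.
split.
- by rewrite /= (_ : [set _ | _] = set0)//; apply/seteqP; split=> w //= -[].
- move=> S FS; rewrite /=.
  rewrite (_ : [set _ | _] = [set w | (Some @` [set: E]) (g w)] `\` [set w | (Some @` S) (g w)]).
    rewrite setDE; apply: sigma_algebra_setI => //; last exact: sigma_algebra_setC.
    by apply: HF; exact: openT.
  apply/seteqP; split=> w /=.
    by move=> [z [_ nz] <-]; split; [exists z|move=> [z' Sz' [zz]]; apply: nz; rewrite -zz].
  by move=> [[z _ <-] nz]; exists z => //; split=> // Sz; apply: nz; exists z.
- move=> S FS /=; rewrite (_ : [set _ | _] = \bigcup_n [set w | (Some @` S n) (g w)]).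
    exact: FU.
  apply/seteqP; split=> w /=; first by move=> [z [n _ Sn] zg]; exists n => //; exists z.
  by move=> [n _ [z Sz zg]]; exists z => //; exists n.
Qed.

Lemma borel_preimage_continuous (h : E -> E) S : continuous h -> borel S -> borel (h @^-1` S).
Proof.
move=> ch; move: S; apply: (@sigma_algebra_sub _ _ [set S | borel (h @^-1` S)]).
  split.
  - exact: sigma_algebra0.
  - by move=> S bS /=; apply: (sigma_algebraCD bS).
  - by move=> S bS /=; rewrite preimage_bigcup; exact: sigma_algebra_bigcup.
by move=> U oU; apply: sub_sigma_algebra; move/continuousP : ch; exact.
Qed.

Lemma borel_filtration y t S : 0 <= t -> borel S ->
  natural_filtration (X y) t [set w | (Some @` S) (X y t w)].
Proof.
move=> t0; apply: borel_preimage; first exact: smallest_sigma_algebra.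
move=> U oU; apply: sub_sigma_algebra; exists t, (Some @` U); split=> //.
  by rewrite t0 lexx.
exact: open_Some.
Qed.

Lemma path_sets_borel t S : 0 <= t -> borel S -> path_sets [set x : R -> opc E | (Some @` S) (x t)].
Proof.
move=> t0; apply: borel_preimage; first exact: smallest_sigma_algebra.
move=> U oU; apply: sub_sigma_algebra; exists t, (Some @` U); split=> //.
exact: open_Some.
Qed.

Lemma measurable_borel y t S : 0 <= t -> borel S -> measurable [set w | (Some @` S) (X y t w)].
Proof. by move=> t0 bS; apply: filtration_measurable; exact: borel_filtration. Qed.

Lemma markov_const y t S D : 0 <= t -> borel S -> path_sets D ->
  P y [set w | (Some @` S) (X y t w) /\ D (fun s => X y (t + s) w)] =
  (\int[P y]_(w in [set w | (Some @` S) (X y t w)]) law_from P X (X y t w) D)%E.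
Proof.
move=> t0 bS PD; have [_ _ _ /(_ y (cst t%:E))] := X_markov.
have st : stopping_time (X y) (cst t%:E).
  split=> [w|u u0]; first by rewrite lee_fin.
  have [tu|ut] := leP t u.
    rewrite (_ : [set _ | _] = setT); last by apply/seteqP; split=> // w _ /=; rewrite lee_fin.
    exact: (@measurableT _ (g_sigma_algebraType (filtration_gen (X y) u))).
  rewrite (_ : [set _ | _] = set0); first exact: sigma_algebra0.
  by apply/seteqP; split=> // w /=; rewrite lee_fin leNgt ut.
move=> /(_ st [set w | (Some @` S) (X y t w)]).
have sS : stopped_sets (X y) (cst t%:E) [set w | (Some @` S) (X y t w)].
  move=> u u0; have [tu|ut] := leP t u.
    rewrite (_ : _ `&` _ = [set w | (Some @` S) (X y t w)]).
      by apply: (filtration_mono tu); exact: borel_filtration.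
    by apply/seteqP; split=> [w []|w Sw]//; split=> //=; rewrite lee_fin.
  rewrite (_ : _ `&` _ = set0); first exact: sigma_algebra0.
  by apply/seteqP; split=> // w [_] /=; rewrite lee_fin leNgt ut.
move=> /(_ sS D PD); rewrite (_ : _ `&` [set w | _ /\ _] =
    [set w | (Some @` S) (X y t w) /\ D (fun s => X y (t + s) w)]); last first.
  by apply/seteqP; split=> w /=; [move=> [? [_ ?]]|move=> [? ?]; split=> //; split; rewrite ?ltry].
move=> ->; congr integral; apply/seteqP; split=> w; first by case.
by move=> Sw; split=> //=; rewrite ltry.
Qed.

Lemma law_borel D r : path_sets D -> borel [set z | (P z [set w | D (X z ^~ w)] < r%:E)%E].
Proof. by move=> PD; have [_ _ /(_ D PD r)] := X_markov. Qed.

Lemma measurable_law_from y t S D : 0 <= t -> borel S -> path_sets D ->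
  measurable_fun [set w | (Some @` S) (X y t w)] (fun w => law_from P X (X y t w) D).
Proof.
move=> t0 bS PD.
apply: (measurability _ (ErealGenInftyO.measurableE R)) => //.
move=> /= _ [_ [r ->] <-].
rewrite (_ : _ `&` _ = [set w | (Some @` (S `&` [set z | (P z [set w | D (X z ^~ w)] < r%:E)%E]))
   (X y t w)]).
  apply: (measurable_borel y t0).
  by apply: (@sigma_algebra_setI _ borel) => //; exact: law_borel.
apply/seteqP; split=> w /=; rewrite in_itv/=.
  by move=> [[z Sz zX]]; rewrite -zX /= => H; exists z.
by move=> [z [Sz H] zX]; rewrite -zX; split=> //; exists z.
Qed.

Lemma markov_const_le y t S D r : 0 <= t -> borel S -> path_sets D -> 0 <= r ->
  (forall z, S z -> (P z [set w | D (X z ^~ w)] <= r%:E)%E) ->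
  (P y [set w | (Some @` S) (X y t w) /\ D (fun s => X y (t + s) w)] <=
   r%:E * P y [set w | (Some @` S) (X y t w)])%E.
Proof.
move=> t0 bS PD r0 H; rewrite markov_const//.
have mS := measurable_borel y t0 bS.
rewrite -integral_cst//; apply: ge0_le_integral => //.
- by move=> w [z _ <-] /=.
- exact: measurable_law_from.
- by move=> w [z Sz <-]; exact: H.
Qed.

Lemma markov_const_ge y t S D r : 0 <= t -> borel S -> path_sets D -> 0 <= r ->
  (forall z, S z -> (r%:E <= P z [set w | D (X z ^~ w)])%E) ->
  (r%:E * P y [set w | (Some @` S) (X y t w)] <=
   P y [set w | (Some @` S) (X y t w) /\ D (fun s => X y (t + s) w)])%E.
Proof.
move=> t0 bS PD r0 H; rewrite markov_const//.
have mS := measurable_borel y t0 bS.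
rewrite -integral_cst//; apply: ge0_le_integral => //.
- exact: measurable_law_from.
- by move=> w [z Sz <-]; exact: H.
Qed.

Lemma path_sets_affine (h : E -> E) (a k : R) D : homeomorphism h -> 0 <= a -> 0 <= k ->
  path_sets D -> path_sets [set x : R -> opc E | D (fun s => extend h (x (a + s * k)))].
Proof.
move=> hh a0 k0.
apply: (path_sets_preimage (F := @path_sets R (opc E))
  (X := fun (x : R -> opc E) s => extend h (x (a + s * k)))).
  exact: smallest_sigma_algebra.
move=> s U s0 oU; apply: sub_sigma_algebra.
exists (a + s * k), (extend h @^-1` U); split=> //.
- by rewrite addr_ge0// mulr_ge0.
- by move/continuousP : (extend_continuous hh); exact.
Qed.

Lemma finv_homeo y : homeomorphism (finv y).
Proof. by have [g [? ? ? ?]] := f_homeo y; exists (f y); split=> //; exact: continuous_section. Qed.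

(** Self-similarity compares [P (f y z) (transported y D)] with [P z D]; they are
    equal as soon as [f (f y z) = f y \o f z]. *)
Definition transported y (D : set (R -> opc E)) : set (R -> opc E) :=
  [set x | D (fun s => extend (finv y) (x (0 + s * (c y)^-1)))].

Lemma path_sets_transported y D : path_sets D -> path_sets (transported y D).
Proof.
move=> PD; apply: path_sets_affine => //; first exact: finv_homeo.
by rewrite invr_ge0 ltW.
Qed.

(** Under self-similarity the time [t / c y] for [X y] corresponds to [t] for [X y0], and
    [transported] undoes both [f y] and the change of speed in the future. *)
Lemma transport_shift y t S D : 0 <= t -> borel S -> path_sets D ->
  P y [set w | (Some @` (finv y @^-1` S)) (X y (t / c y) w) /\
               transported y D (fun s => X y (t / c y + s) w)] =
  P y0 [set w | (Some @` S) (X y0 t w) /\ D (fun s => X y0 (t + s) w)].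
Proof.
move=> t0 bS PD; have tc : 0 <= t / c y by rewrite divr_ge0// ltW.
have [_ _ _ _ /(_ y [set x | (Some @` (finv y @^-1` S)) (x (t / c y)) /\
               transported y D (fun s => x (t / c y + s))])] := X_selfsimilar.
move=> ->.
  congr (P y0 _); have cy : c y != 0 by rewrite gt_eqF.
  have arg s : c y * (t / c y + (0 + s * (c y)^-1)) = t + s.
    by rewrite add0r mulrDr mulrCA mulfV// mulr1 mulrCA mulfV// mulr1.
  have argt : c y * (t / c y) = t by rewrite mulrCA mulfV// mulr1.
  have DE w : D (fun s => extend (finv y) (extend (f y) (X y0 (c y * (t / c y + (0 + s * (c y)^-1))) w)))
      = D (fun s => X y0 (t + s) w).
    by congr (D _); apply/funext => s; rewrite arg (extendK (fK y)).
  apply/seteqP; split=> w; rewrite /= argt /transported/= DE.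
    move=> [[z Sz zX] Dw]; split=> //; move: zX; case: (X y0 t w) => [v|]//= [zv].
    by exists v => //; move: Sz; rewrite /= zv fK.
  by move=> [[z Sz <-] Dw]; split=> //; exists (f y z); rewrite //= fK.
rewrite (_ : [set _ | _] = [set x | (Some @` (finv y @^-1` S)) (x (t / c y))] `&`
  [set x | transported y D (fun s => x (t / c y + s))])//.
apply: (@measurableI _ paths).
  apply: path_sets_borel => //; apply: borel_preimage_continuous => //.
  exact: continuous_section.
rewrite (_ : [set x | _] = [set x | D (fun s => extend (finv y) (x (t / c y + s * (c y)^-1)))]).
  by apply: path_sets_affine => //; [exact: finv_homeo|rewrite invr_ge0 ltW].
have add0 (x : R -> opc E) : (fun s => extend (finv y) (x (t / c y + (0 + s * (c y)^-1)))) =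
    (fun s => extend (finv y) (x (t / c y + s * (c y)^-1))).
  by apply/funext => s; rewrite add0r.
by apply/seteqP; split=> x; rewrite /transported /= add0.
Qed.

Lemma transport_at y t S : 0 <= t -> borel S ->
  P y [set w | (Some @` (finv y @^-1` S)) (X y (t / c y) w)] =
  P y0 [set w | (Some @` S) (X y0 t w)].
Proof.
move=> t0 bS; have PT : path_sets [set: R -> opc E] by apply: (@measurableT _ paths).
have := transport_shift y t0 bS PT.
rewrite (_ : [set w | _ /\ transported _ _ _] =
  [set w | (Some @` (finv y @^-1` S)) (X y (t / c y) w)]); last first.
  by apply/seteqP; split=> w // [].
move=> ->; congr (P y0 _).
by apply/seteqP; split=> w // [].
Qed.

Let law z D := P z [set w | D (X z ^~ w)].
Let law' y z D := law (f y z) (transported y D).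

Let law_fin z D : path_sets D -> law z D \is a fin_num.
Proof. by move=> PD; apply: fin_num_measure; exact: measurable_X_path. Qed.

(** Let [p] be the probability that [X y0 t] lies in the set. The Markov property from [y0] at [t]
    and from [y] at [t / c y] evaluates one and the same probability, bounded by [r1 * p] on one
    side and by [r2 * p] from below on the other; hence [p = 0]. *)
Lemma transported_lawE_lt y t D r1 r2 : 0 <= t -> path_sets D -> 0 <= r1 -> r1 < r2 ->
  (P y0).-negligible [set w |
    (Some @` [set z | (law z D < r1%:E)%E /\ ~ (law' y z D < r2%:E)%E]) (X y0 t w)] /\
  (P y0).-negligible [set w |
    (Some @` [set z | (law' y z D < r1%:E)%E /\ ~ (law z D < r2%:E)%E]) (X y0 t w)].
Proof.
move=> t0 PD r10 r12; have r20 : 0 <= r2 by exact: le_trans (ltW r12).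
have tc : 0 <= t / c y by rewrite divr_ge0// ltW.
have PD' := path_sets_transported y PD.
have bl r : borel [set z | (law z D < r%:E)%E] by exact: law_borel.
have bl' r : borel [set z | (law' y z D < r%:E)%E].
  apply: (@borel_preimage_continuous (f y) [set z | (law z (transported y D) < r%:E)%E]).
    exact: continuous_section.
  exact: law_borel.
have sE : sigma_algebra [set: E] borel by exact: smallest_sigma_algebra.
have b1 : borel [set z | (law z D < r1%:E)%E /\ ~ (law' y z D < r2%:E)%E].
  exact: (@sigma_algebra_setI _ borel _ _ sE (bl r1) (@sigma_algebra_setC _ borel _ sE (bl' r2))).
have b2 : borel [set z | (law' y z D < r1%:E)%E /\ ~ (law z D < r2%:E)%E].
  exact: (@sigma_algebra_setI _ borel _ _ sE (bl' r1) (@sigma_algebra_setC _ borel _ sE (bl r2))).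
have cont S : borel S -> borel (finv y @^-1` S).
  by apply: borel_preimage_continuous; exact: continuous_section.
have null S : borel S ->
    (r2%:E * P y0 [set w | (Some @` S) (X y0 t w)] <= r1%:E * P y0 [set w | (Some @` S) (X y0 t w)])%E ->
    (P y0).-negligible [set w | (Some @` S) (X y0 t w)].
  move=> bS; have mS := measurable_borel y0 t0 bS.
  move=> H0; apply/negligibleP => //; move: H0.
  have p0 : (0 <= P y0 [set w | (Some @` S) (X y0 t w)])%E by exact: measure_ge0.
  move: p0; set q := P y0 _; pose p := fine q.
  have pE : q = p%:E := esym (fineK (fin_num_measure (P y0) _ mS)).
  rewrite pE -!EFinM !lee_fin => p0 H.
  transitivity p%:E; first exact: pE.
  suff -> : p = 0 by [].
  have : (r2 - r1) * p <= 0 by rewrite mulrBl subr_le0.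
  rewrite pmulr_rle0 ?subr_gt0// => ?.
  by apply/eqP; rewrite eq_le p0 andbT.
split; apply: null => //.
- have := markov_const_le y0 t0 b1 PD r10.
  have := markov_const_ge y tc (cont _ b1) PD' r20.
  rewrite (transport_shift y t0 b1 PD) (transport_at y t0 b1) => H1 H2.
  apply: (le_trans (H1 _)); last by apply: H2 => z [/ltW].
  by move=> z [_ /negP]; rewrite -leNgt /law' /law finvK.
- have := markov_const_ge y0 t0 b2 PD r20.
  have := markov_const_le y tc (cont _ b2) PD' r10.
  rewrite (transport_shift y t0 b2 PD) (transport_at y t0 b2) => H1 H2.
  apply: (le_trans (H2 _)); first by move=> z [_ /negP]; rewrite -leNgt.
  apply: H1 => z [lt1 _]; apply: ltW.
  by move: lt1; rewrite /law' /law finvK.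
Qed.

(** Two distinct finite values are separated by two rationals, so the event is covered by countably
    many null ones. *)
Lemma transported_law_null y t D : 0 <= t -> path_sets D ->
  (P y0).-negligible [set w | exists2 z, X y0 t w = Some z & law z D <> law' y z D].
Proof.
move=> t0 PD.
pose A (q : rat * rat) : set (Om y0) :=
  if (0 <= ratr q.1 :> R) && (ratr q.1 < ratr q.2 :> R) then
    [set w | (Some @` [set z | (law z D < (ratr q.1 : R)%:E)%E /\
       ~ (law' y z D < (ratr q.2 : R)%:E)%E]) (X y0 t w)] `|`
    [set w | (Some @` [set z | (law' y z D < (ratr q.1 : R)%:E)%E /\
       ~ (law z D < (ratr q.2 : R)%:E)%E]) (X y0 t w)]
  else set0.
have nA q : (P y0).-negligible (A q).
  rewrite /A; case: ifPn => [/andP[q0 qq]|_]; last exact: negligible_set0.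
  by have [? ?] := transported_lawE_lt y t0 PD q0 qq; exact: negligibleU.
pose F k := if unpickle k is Some q then A q else set0.
apply: (@negligibleS _ _ _ _ (\bigcup_k F k)); last first.
  apply: negligible_bigcup => k; rewrite /F; case: (unpickle k) => [q|]; first exact: nA.
  exact: negligible_set0.
have sep (a b : \bar R) : a \is a fin_num -> b \is a fin_num -> (0 <= a)%E -> (a < b)%E ->
    exists q : rat * rat, [/\ 0 <= ratr q.1 :> R, ratr q.1 < ratr q.2 :> R,
      (a < (ratr q.1 : R)%:E)%E & ~ (b < (ratr q.2 : R)%:E)%E].
  move=> fa fb; rewrite -(fineK fa) -(fineK fb) lte_fin lee_fin => a0 ab.
  have [q1] := rat_in_itvoo ab; rewrite in_itv/= => /andP[aq1 q1b].
  have [q2] := rat_in_itvoo q1b; rewrite in_itv/= => /andP[q12 q2b].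
  exists (q1, q2); split=> //=; first exact: le_trans (ltW aq1).
  by apply/negP; rewrite -leNgt lee_fin ltW.
move=> w [z xz neq].
have PD' := path_sets_transported y PD.
have f1 : law z D \is a fin_num by exact: law_fin.
have f2 : law' y z D \is a fin_num by exact: law_fin.
have p1 : (0 <= law z D)%E by exact: measure_ge0.
have p2 : (0 <= law' y z D)%E by exact: measure_ge0.
have M (S : set E) : S z -> (Some @` S) (X y0 t w) by move=> Sz; exists z; rewrite ?xz.
have : (law z D < law' y z D)%E \/ (law' y z D < law z D)%E.
  by apply/orP; rewrite -neq_lt; apply/eqP.
case=> [/(sep _ _ f1 f2 p1)|/(sep _ _ f2 f1 p2)] [q [q0 qq aq bq]];
  (exists (pickle q); first exact: I);
  rewrite /F pickleK /A q0 qq; [left|right]; apply: M; by split.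
Qed.

(** A symmetry of [X y0] for almost all [z] under the law of each [X y0 t], and
    the identity if and only if [f (f y z) = f y \o f z]. *)
Definition defect y z x := finv z (finv y (f (f y z) x)).

Lemma defect_homeo y z : homeomorphism (defect y z).
Proof.
have [g1 [c1 d1 k1 l1]] := finv_homeo z; have [g2 [c2 d2 k2 l2]] := finv_homeo y.
have [g3 [c3 d3 k3 l3]] := f_homeo (f y z).
exists (g3 \o (g2 \o g1)); split.
- move=> x; apply: (@continuous_comp _ _ _ (f (f y z)) (finv z \o finv y)); first exact: c3.
  by apply: continuous_comp; [exact: c2|exact: c1].
- move=> x; apply: (@continuous_comp _ _ _ (g2 \o g1) g3); last exact: d3.
  by apply: continuous_comp; [exact: d1|exact: d2].
- by move=> x; rewrite /defect /= k1 k2 k3.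
- by move=> x; rewrite /defect /= l3 l2 l1.
Qed.

Lemma measurable_scaled_homeo (h : E -> E) k D : homeomorphism h -> 0 < k -> path_sets D ->
  measurable [set w | D (fun t => extend h (X y0 (k * t) w))].
Proof.
move=> hh k0 PD; have := measurable_X_path y0 (path_sets_affine hh (lexx 0) (ltW k0) PD).
rewrite (_ : [set w | _] = [set w | D (fun t => extend h (X y0 (k * t) w))])//.
have E1 w : (fun s => extend h (X y0 (0 + s * k) w)) = (fun t => extend h (X y0 (k * t) w)).
  by apply/funext => s; rewrite add0r mulrC.
by apply/seteqP; split=> w /=; rewrite E1.
Qed.

Variable b : nat * nat -> set E.
Hypothesis b_open : forall n, open (b n).
Hypothesis b_base : forall U y, open U -> U y -> exists n, b n y /\ b n `<=` U.

(** Self-similarity writes the two laws as those of [f z] and of [finv y \o f (f y z)] applied to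
    [X y0] at the same speed [c z], the equality [c (f y z) = c y * c z] being used here. Undoing
    [f z] and the speed leaves [defect y z]. *)
Lemma defect_sym y z :
  (forall s : seq ((nat * nat) * (nat * nat)),
     law z (rational_event b s) = law' y z (rational_event b s)) ->
  sym (P y0) (X y0) (defect y z).
Proof.
move=> H; split; first exact: defect_homeo.
have cz : c z != 0 by rewrite gt_eqF.
have cy : c y != 0 by rewrite gt_eqF.
pose g := finv y \o f (f y z).
have hg : homeomorphism g.
  have [g2 [c2 d2 k2 l2]] := finv_homeo y; have [g3 [c3 d3 k3 l3]] := f_homeo (f y z).
  exists (g3 \o g2); split.
  - by move=> x; apply: continuous_comp; [exact: c3|exact: c2].
  - by move=> x; apply: continuous_comp; [exact: d2|exact: d3].
  - by move=> x; rewrite /g /= k2 k3.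
  - by move=> x; rewrite /g /= l3 l2.
pose Y1 t w := extend (f z) (X y0 (c z * t) w).
pose Y2 t w := extend g (X y0 (c z * t) w).
have Y12 : eq_law (P y0) (P y0) Y1 Y2.
  apply: (eq_law_rational b_open b_base).
  - by move=> w; apply: good_scaled_homeo => //; exact: f_homeo.
  - by move=> w; exact: good_scaled_homeo.
  - by move=> D PD; apply: measurable_scaled_homeo => //; exact: f_homeo.
  - by move=> D PD; exact: measurable_scaled_homeo.
  move=> s; have := H s; have PD := path_sets_rational_event b_open s.
  rewrite /law' /law; have [_ _ _ _ sim] := X_selfsimilar.
  rewrite (sim z _ PD) (sim (f y z) _ (path_sets_transported y PD)) => ->.
  congr (P y0 _); have E1 w : (fun s => extend (finv y) (extend (f (f y z))
      (X y0 (c (f y z) * (0 + s * (c y)^-1)) w))) = Y2 ^~ w.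
    apply/funext => t; rewrite extend_comp add0r cM /Y2; congr (extend _ (X y0 _ w)).
    by field.
  by apply/seteqP; split=> w; rewrite /transported /= E1.
move=> D PD; have := Y12 _ (path_sets_transported z PD).
have E1 w : (fun s => extend (finv z) (Y1 (0 + s * (c z)^-1) w)) = X y0 ^~ w.
  apply/funext => t; rewrite /Y1 (extendK (fK z)); congr (X y0 _ w); by field.
have E2 w : (fun s => extend (finv z) (Y2 (0 + s * (c z)^-1) w)) =
    (fun t => extend (defect y z) (X y0 t w)).
  apply/funext => t; rewrite /Y2 extend_comp; congr (extend _ (X y0 _ w)); by field.
rewrite (_ : [set w | transported z D (Y1^~ w)] = [set w | D (X y0 ^~ w)]); last first.
  by apply/seteqP; split=> w; rewrite /transported /= E1.
by move=> ->; congr (P y0 _); apply/seteqP; split=> w; rewrite /transported /= E2.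
Qed.

(** The exceptional set of the previous comparison is null for all rational events at once, whereas
    some [X y0 t] charges every ball around a point of the support; so some good [z'] lies in the
    ball. *)
Lemma defect_sym_dense y z (O : set E) : open O -> O z -> supp (P y0) (X y0) z ->
  exists2 z', O z' & sym (P y0) (X y0) (defect y z').
Proof.
rewrite openE => oO /oO /nbhs_ballP[e /= e0 eO] /(_ e e0)[t t0 Pt].
apply: contrapT => nex.
pose N (s : seq ((nat * nat) * (nat * nat))) := [set w | exists2 z, X y0 t w = Some z &
  law z (rational_event b s) <> law' y z (rational_event b s)].
pose F k := if unpickle k is Some s then N s else set0.
have nF : (P y0).-negligible (\bigcup_k F k).
  apply: negligible_bigcup => k; rewrite /F; case: (unpickle k) => [s|]; last exact: negligible_set0.
  by apply: transported_law_null => //; exact: path_sets_rational_event.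
have mB : measurable [set w | (Some @` ball z e) (X y0 t w)].
  apply: measurable_borel => //; apply: sub_sigma_algebra; exact: open_metric_ball.
have : (P y0).-negligible [set w | (Some @` ball z e) (X y0 t w)].
  apply: negligibleS nF => w [z' zz' z'X]; apply: contrapT => nw; apply: nex; exists z'; first exact: eO.
  apply: defect_sym => s; apply: contrapT => neq; apply: nw.
  exists (pickle s); first exact: I.
  by rewrite /F pickleK; exists z'.
by move/(negligibleP _ mB) => P0; move: Pt; rewrite P0 ltxx.
Qed.

(** The homeomorphism [finv y] carries the support of [X y] into that of [X y0], and [y] to [y0], so
    an interior point [y] of the former yields the claim. *)
Lemma supp_interior : supp (P y0) (X y0) = [set: E] \/ (exists y, (supp (P y) (X y))° y) ->
  (supp (P y0) (X y0))° y0.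
Proof.
case=> [->|[y sy]]; first by rewrite interiorT.
have : nbhs (f y y0) (supp (P y) (X y)) by rewrite f_right_neutral.
move=> sy'; have nsy : nbhs y0 (f y @^-1` supp (P y) (X y)).
  exact: (@continuous_section f y f_cont y0).
apply: (filterS _ nsy) => z sz e e0.
have nz : nbhs (f y z) (finv y @^-1` ball z e).
  by apply: (@continuous_section finv y finv_cont (f y z)); rewrite fK; exact: nbhsx_ballx.
have /nbhs_ballP[e' /= e'0 He'] := nz.
have [t t0 Pt] := sz e' e'0; exists (c y * t); first by rewrite mulr_ge0// ltW.
apply: (lt_le_trans Pt); have [_ _ _ _ /(_ y [set x | (Some @` ball (f y z) e') (x t)])] := X_selfsimilar.
move=> -> /=; last first.
  apply: sub_sigma_algebra; exists t, (Some @` ball (f y z) e'); split=> //.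
  by apply: open_Some; exact: open_metric_ball.
apply: le_measure; rewrite ?inE.
- have hh := f_homeo y.
  have := @measurable_scaled_homeo (f y) (c y) [set x | (Some @` ball (f y z) e') (x t)] hh (c_gt0 y).
  apply; apply: sub_sigma_algebra; exists t, (Some @` ball (f y z) e'); split=> //.
  by apply: open_Some; exact: open_metric_ball.
- apply: measurable_borel; first by rewrite mulr_ge0// ltW.
  by apply: sub_sigma_algebra; exact: open_metric_ball.
move=> w [v vb]; case xw : (X y0 (c y * t) w) => [u|]//= [vu]; exists u; rewrite ?xw//.
by have := He' _ vb; rewrite /= vu fK.
Qed.

Hypothesis sym_discrete : discrete_set (sym (P y0) (X y0)).
Hypothesis supp_int : (supp (P y0) (X y0))° y0.

Lemma defect_neutral y : defect y y0 = id.
Proof.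
apply/funext => x; rewrite /defect f_right_neutral fK.
by have := finvK y0 x; have [-> _ _] := fc_good.
Qed.

Lemma id_sym : sym (P y0) (X y0) id.
Proof.
split; first by exists id; split=> // ?; exact: cvg_id.
move=> D PD; congr (P y0 _).
have E1 w : (fun t => extend id (X y0 t w)) = X y0 ^~ w.
  by apply/funext => t; case: (X y0 t w).
by apply/seteqP; split=> w /=; rewrite E1.
Qed.

Lemma defect_continuous y : continuous (fun p : E * E => defect y p.1 p.2).
Proof.
have cyp : continuous (fun p : E * E => f (f y p.1) p.2).
  move=> p; apply: (@continuous_comp _ _ _ (fun p : E * E => (f y p.1, p.2)) (fun q => f q.1 q.2) p).
    apply: cvg_pair; last exact: cvg_snd.
    apply: (@continuous_comp _ _ _ fst (f y) p); first exact: cvg_fst.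
    exact: continuous_section.
  exact: f_cont.
move=> p; apply: (@continuous_comp _ _ _ (fun p : E * E => (p.1, finv y (f (f y p.1) p.2)))
  (fun q => finv q.1 q.2) p).
  apply: cvg_pair; first exact: cvg_fst.
  apply: (@continuous_comp _ _ _ (fun p : E * E => f (f y p.1) p.2) (finv y) p); first exact: cyp.
  exact: continuous_section.
exact: finv_cont.
Qed.

Let associative_at y z := forall x, f (f y z) x = f y (f z x).

Let defectE y z x : defect y z x = x <-> f (f y z) x = f y (f z x).
Proof.
by rewrite /defect; split=> [dx|->]; rewrite ?fK// -{2}dx !finvK.
Qed.

Lemma closed_eq_continuous (g h : E -> E) : continuous g -> continuous h ->
  closed [set z | g z = h z].
Proof.
move=> cg ch z; rewrite /closure /= => zcl; apply: (@metric_hausdorff _ E) => A B gA hB.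
have nA : nbhs z (g @^-1` A) by exact: cg.
have nB : nbhs z (h @^-1` B) by exact: ch.
have [z' [gh [gz hz]]] := zcl (g @^-1` A `&` h @^-1` B) (filterI nA nB).
by exists (g z'); split=> //; rewrite gh.
Qed.

Lemma closed_associative_point y x : closed [set z | f (f y z) x = f y (f z x)].
Proof.
have fl (w : E) : continuous (f^~ w).
  move=> z; apply: (@continuous_comp _ _ _ (fun z => (z, w)) (fun p => f p.1 p.2) z).
    by apply: cvg_pair; [exact: cvg_id|exact: cvg_cst].
  exact: f_cont.
apply: closed_eq_continuous => z.
  by apply: (@continuous_comp _ _ _ (f y) (f^~ x) z); [exact: continuous_section|exact: fl].
by apply: (@continuous_comp _ _ _ (f^~ x) (f y) z); [exact: fl|exact: continuous_section].
Qed.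

Lemma associative_closed y : closed [set z | associative_at y z].
Proof.
rewrite (_ : [set _ | _] = \bigcap_x [set z | f (f y z) x = f y (f z x)]).
  by apply: closed_bigI => x _; exact: closed_associative_point.
by apply/seteqP; split=> z' /= H x; [move=> _|]; apply: H.
Qed.

Lemma associative_near y : \forall z \near y0, associative_at y z.
Proof.
have [_ [V Vid Vsym]] := sym_discrete id_sym.
have cvg := cvg_family_compact_id (@defect_continuous y) (defect_neutral y).
have nV : \forall z \near y0, V (defect y z) by exact: cvg.
have nO : nbhs y0 ([set z | V (defect y z)]° `&` (supp (P y0) (X y0))°).
  by apply: filterI; apply: nbhs_interior.
(* Symmetry of the defect is known only for densely many [z]. Failure of associativity is open in
   [z], so a failure at [z] yields one at a nearby [z'] whose defect is a symmetry in [V], hence the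
   identity. *)
apply: filterS nO => z [Vz sz] x; apply: contrapT => neq.
have cl := @closed_associative_point y x.
pose O := [set z | V (defect y z)]° `&` ~` [set z | f (f y z) x = f y (f z x)].
have oO : open O by apply: openI; [exact: open_interior|exact: closed_openC].
have Oz : O z by [].
have [z' [/interior_subset Vz' nz'] sz'] := defect_sym_dense y oO Oz (interior_subset sz).
apply: nz'; apply/defectE.
have : (V `&` sym (P y0) (X y0)) (defect y z') by [].
by rewrite Vsym => ->.
Qed.

Hypothesis E_connected : connected [set: E].

Lemma action_law y z x : f (f y z) x = f y (f z x).
Proof.
suff AT : [set z | associative_at y z] = setT.
  have : [set: E] z by [].
  by rewrite -AT => /(_ x).
apply: E_connected.
- by exists y0 => x'; rewrite f_right_neutral; have [-> _ _] := fc_good.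
- exists [set z | associative_at y z]; last by rewrite setTI.
  (* A point near [z1] is [f z1 w] with [w] near [y0]; associativity at [w] for both [z1] and
     [f y z1], together with that at [z1], gives it at [f z1 w]. *)
  rewrite openE => z1 az1; rewrite /interior.
  have nW := filterI (associative_near z1) (associative_near (f y z1)).
  have : nbhs z1 (finv z1 @^-1` [set w | associative_at z1 w /\ associative_at (f y z1) w]).
    apply: (@continuous_section finv z1 finv_cont z1).
    have e1 : finv z1 z1 = y0 by rewrite -{2}(f_right_neutral z1) fK.
    by rewrite e1; exact: nW.
  apply: filterS => v [a1 a2] x'; set w := finv z1 v in a1 a2.
  have -> : v = f z1 w by rewrite /w finvK.
  by rewrite -az1 a2 az1 a1.
- by exists [set z | associative_at y z]; [exact: associative_closed|rewrite setTI].
Qed.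

End composition.

End killed_levy.

(** * Sections of maps of class C^k *)

Section differentials.
Context {R : realType} {V W : normedModType R}.

Lemma near_eq_diff (f g : V -> W) (x : V) : (\forall z \near x, f z = g z) ->
  differentiable f x -> differentiable g x /\ 'd g x = 'd f x :> (V -> W).
Proof.
move=> fg df; have fgx : f x = g x := nbhs_singleton fg.
have H : g \o shift x = cst (g x) + 'd f x +o_ 0 id.
  have /eqaddoP Hf := diff_locally df.
  apply/eqaddoP => e e0; have := Hf e e0.
  have : \forall h \near (0 : V), f (h + x) = g (h + x).
    by have := fg; rewrite (near_shift 0) subr0.
  apply: filterS2 => h fgh; rewrite /= !fctE /= /cst/= fgh fgx.
  by [].
have dgE := diff_unique (diff_continuous df) H.
split=> //; apply/diff_locallyP; rewrite dgE; split=> //; exact: diff_continuous.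
Qed.

Lemma Ck_on_eq k (U : set V) : open U -> forall f g : V -> W, (forall x, U x -> f x = g x) ->
  Ck_on k U f -> Ck_on k U g.
Proof.
move=> oU; elim: k => [|k IHk] f g fg /=.
  move=> cf x Ux; have nU : \forall z \near x, f z = g z.
    by move: oU; rewrite openE => /(_ x Ux); apply: filterS.
  have cfx : f @ x --> g x by rewrite -(fg x Ux); exact: cf.
  by apply: cvg_trans cfx; apply: near_eq_cvg; apply: filterS nU => z ->.
move=> [df dCk].
have dg x : U x -> differentiable g x /\ 'd g x = 'd f x :> (V -> W).
  move=> Ux; apply: near_eq_diff; last exact: df.
  by move: oU; rewrite openE => /(_ x Ux); apply: filterS.
split=> [x /dg[]//|v]; apply: IHk (dCk v) => x /dg[_ ->].
by [].
Qed.

End differentials.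

(** The differential of the section in direction [u] is that of [F] in direction [(u, 0)], itself a
    section of a map of class one less: the induction closes on this. *)
Lemma Ck_on_section (R : realType) (V V' W : normedModType R) k (U : set V) (U' : set (V * V'))
    (w : V') : open U -> (forall v, U v -> U' (v, w)) ->
  forall F : V * V' -> W, Ck_on k U' F -> Ck_on k U (fun v => F (v, w)).
Proof.
move=> oU UU'; elim: k => [|k IHk] F /=.
  move=> cF v Uv; apply: (@continuous_comp _ _ _ (fun v => (v, w)) F v).
    by apply: cvg_pair; [exact: cvg_id|exact: cvg_cst].
  exact/cF/UU'.
move=> [dF dCk].
have dp v : is_diff v (fun v => (v, w)) (fun u => (u, 0 : V')).
  exact: (is_diff_pair (is_diff_id v) (is_diff_cst w v)).
have dFw v : U v -> is_diff v (fun v => F (v, w)) ('d F (v, w) \o (fun u => (u, 0 : V'))).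
  move=> Uv; apply: (@is_diff_comp _ _ _ _ (fun v => (v, w)) _ F).
  by apply: DiffDef => //; exact/dF/UU'.
split=> [v Uv|u]; first by have [] := dFw v Uv.
apply: (@Ck_on_eq _ _ _ k U oU (fun v => 'd F (v, w) (u, 0))).
  by move=> v Uv; have [_ ->] := dFw v Uv.
exact: (IHk (fun p => 'd F p (u, 0))).
Qed.

Local Notation coord := Defs.coord.

(** * Charts and maps of class C^k on the group *)

Section lie.
Context {R : realType} {E : metricType R}.

Lemma chart_image_open (V : normedModType R) (a : chart E V) (W : set E) :
  chart_valid a -> open W -> open (coord a @` (dom a `&` W)).
Proof.
move=> [od oc ca _ pc] oW.
rewrite (_ : _ @` _ = (coord a @` dom a) `&` (param a @^-1` W)); last first.
  apply/seteqP; split=> v.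
    by move=> [x [dx Wx] <-]; split; [exists x|rewrite /= ca].
  by move=> [[x dx <-]]; rewrite /= ca// => Wx; exists x.
rewrite openE => v [av Wv]; apply: filterI.
  by move: oc; rewrite openE => /(_ v av).
by apply: (pc v av); move: oW; rewrite openE => /(_ _ Wv).
Qed.

(** Meant for the group inverse, which is [finv] with its second argument fixed at [y0]. A chart
    around [e] is fixed, and the product chart is restricted to the slice through [e]. *)
Lemma Ck_map_section (V : normedModType R) k (A : set (chart E V)) (op : E -> E -> E) (e : E) :
  Ck_atlas k A -> continuous (op^~ e) ->
  Ck_map k (prod_atlas A A) A (fun p : E * E => op p.1 p.2) -> Ck_map k A A (op^~ e).
Proof.
move=> [valid cover _] cop [_ CkM]; split=> // a b Aa Ab.
have [a0 Aa0 a0e] := cover e.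
have [_ _ pa0 _ _] := valid a0 Aa0.
have := CkM (prod_chart a a0) b; rewrite /prod_atlas => /(_ _ Ab) CkMab.
have {}CkMab := CkMab (ex_intro _ a (ex_intro _ a0 (And3 Aa Aa0 erefl))).
have oU : open (coord a @` (dom a `&` op^~ e @^-1` dom b)).
  apply: chart_image_open; first exact: valid.
  by have [ob _ _ _ _] := valid b Ab; move/continuousP : cop; exact.
have UU' v : (coord a @` (dom a `&` op^~ e @^-1` dom b)) v ->
    (coord (prod_chart a a0) @` (dom (prod_chart a a0) `&`
      (fun p : E * E => op p.1 p.2) @^-1` dom b)) (v, coord a0 e).
  by move=> [x [ax bx] <-]; exists (x, e).
have := Ck_on_section oU UU' CkMab.
by apply: Ck_on_eq => // v _ /=; rewrite pa0.
Qed.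

End lie.

Theorem theorem1p20 (R : realType) (E : metricType R)
    (E_locally_compact : locally_compact [set: E])
    (E_separable : exists2 Q : set E, countable Q & dense Q)
    (E_connected : connected [set: E])
    (d : E -> measure_display) (Om : forall y, measurableType (d y))
    (P : forall y, probability (Om y) R)
    (X : forall y, R -> Om y -> one_point_compactification E)
    (X_markov : strong_markov_process P X)
    (y0 : E) (f finv : E -> E -> E) (c : E -> R)
    (X_selfsimilar : invariance_components P X y0 f finv c)
    (fc_good : good_components y0 f c)
    (assumption1or2 : supp (P y0) (X y0) = [set: E] \/
                      exists y, (supp (P y) (X y))° y)
    (sym_discrete : discrete_set (sym (P y0) (X y0))) :
  exists inv : E -> E,
    [/\ topological_group f inv y0,
        [/\ continuous c, forall y, 0 < c y &
            forall y z, c (f y z) = c y * c z],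
        exists L : R -> Om y0 -> E,
          let xi : R -> Om y0 -> R := fun t w => ln (1 / c (L t w)) in
          [/\ levy_process (P y0) f inv y0 L,
              {ae P y0, forall w,
                 lifetime y0 (X y0 ^~ w) = phi c (L ^~ w) +oo%E /\
                 forall t, 0 <= t -> (t%:E < phi c (L ^~ w) +oo)%E ->
                   X y0 t w = Some (L (phi_inv c (L ^~ w) t) w)},
              levy_process (P y0) +%R -%R 0 xi &
              {ae P y0, forall w,
                 lifetime y0 (X y0 ^~ w) =
                 (\int[lebesgue_measure]_(s in [set s : R | (0 <= s)%R])
                    (expR (xi s w))%:E)%E}] &
        forall (k n : nat) (A : set (chart E 'rV[R]_n)), (1 <= k)%N ->
          Ck_atlas k A -> Ck_components k A f finv c ->
          Ck_lie_group k A f inv y0 /\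
          [/\ Ck_map k A (@real_atlas R) c, forall y, 0 < c y &
              forall y z, c (f y z) = c y * c z]].
Proof.
have [_ [f_cont finv_cont] c_gt0 c_cont _] := X_selfsimilar.
have [fy0 cy0 cM] := fc_good.
have fyy0 := f_right_neutral X_markov X_selfsimilar.
have [b [b_open b_base]] := countable_base y0 E_separable.
have f_action : forall x y z, f (f x y) z = f x (f y z).
  have sy0 := supp_interior X_markov X_selfsimilar assumption1or2.
  exact: (action_law X_markov X_selfsimilar fc_good b_open b_base sym_discrete sy0).
(* Local compactness provides the compact neighbourhood of [y0] whose exit controls the probability
   of dying. *)
have [K nK [Kc _]] := E_locally_compact y0 I.
have {}nK : nbhs y0 K.
  by apply: (@filterS _ (nbhs y0) _ [set z | [set: E] z -> K z] _ _ nK) => z; exact.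
have mortal0 := mortal_null E_separable X_markov X_selfsimilar fc_good Kc nK.
have levyL := levy_levy_process E_separable X_markov X_selfsimilar fc_good f_action mortal0.
have changeL := levy_time_change X_markov X_selfsimilar mortal0.
have f_group := f_topological_group X_markov X_selfsimilar fc_good f_action.
have [[_ _ _ _ fV] _ inv_cont] := f_group.
have cK y : (c y)^-1 \is Num.pos by rewrite posrE invr_gt0.
exists (group_inv y0 finv); split.
- exact: f_group.
- by [].
- exists (levy X c); split=> //.
  + apply: (levy_process_hom _ _ _ _ levyL (h := fun y => ln (1 / c y))).
    * move=> y; apply: continuous_comp; last by apply: continuous_ln; rewrite divr_gt0.
      by apply: cvgM; [exact: cvg_cst|apply: cvgV => //; [rewrite gt_eqF|exact: c_cont]].
    * by move=> x y; rewrite !div1r cM invfM lnM.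
    * by rewrite cy0 divr1 ln1.
    * move=> y; apply/eqP; rewrite -addr_eq0 addrC !div1r -lnM// -invfM -cM.
      by rewrite fV cy0 invr1 ln1.
  (* The exponential of [xi] is [1 / c] along the path, so the integral is [phi] at [+oo]. *)
  + apply: (filterS _ changeL) => w [-> _]; rewrite /phi.
    rewrite (_ : [set s | _ /\ _] = [set s | 0 <= s]); last first.
      by apply/seteqP; split=> s /= => [[]//|s0]; rewrite leey.
    by apply: eq_integral => s _; rewrite div1r lnK.
- move=> k n A _ atlasA [Ckf Ckfinv Ckc]; split; last by [].
  split=> //; first by have [] := f_group.
  exact: (Ck_map_section atlasA inv_cont Ckfinv).
Qed.
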